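(* Let $d\ge1$, $M>0$ and $\delta>0$. Let $X_1,\dots,X_n$ ($n\ge2$) be i.i.d. from $P=(1-\epsilon)P_{f_\pi}+\epsilon Q$, where $\epsilon\in[0,1)$, $\pi$ is a probability measure with $\mathrm{supp}(\pi)\subseteq[-M,M]^d$, $P_{f_\pi}$ is the distribution with density $f_\pi$, and $Q$ is an arbitrary probability distribution on $\mathbb R^d$. Let $\widehat f$ be the Yatracos' estimator based on $X_1,\dots,X_n$ and set $$\widehat\theta^\star(x)=x+\frac{\nabla f_\pi(x)}{f_\pi(x)},\qquad \widehat\theta_\rho(x)=x+\frac{\nabla\widehat f(x)}{\widehat f(x)\vee\rho}.$$ Then there exists $\rho=\rho(\epsilon,n)>0$ such that $$\sup_{\pi,Q}\mathbb E\Big[\mathbb E_{X\sim f_\pi}\big\|\widehat\theta_\rho(X)-\widehat\theta^\star(X)\big\|^2\Big]\lesssim\mathcal E^2(\epsilon,n),\qquad \mathcal E^2(\epsilon,n):=\epsilon^{2\left(1-\frac{2+\delta}{\log(\log(1/\epsilon)\vee e)}\right)}+\frac1{n^{1-o_d(1)}},$$ where the outer expectation is over $X_1,\dots,X_n$ drawn i.i.d. from $P=(1-\epsilon)P_{f_\pi}+\epsilon Q$, the supremum is over all $Q$ and all $\pi$ with $\mathrm{supp}(\pi)\subseteq[-M,M]^d$, and $o_d(1)$ is a positive real-valued function of $n$ and $d$ which converges to zero as $n\to\infty$.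
   Context: $f_\pi(x)=\int_{\mathbb R^d}\phi_d(x-\theta)\,d\pi(\theta)$ with $\phi_d$ the standard Gaussian density on $\mathbb R^d$; $\mathcal P_{M,d}$ is the set of distributions with density $f_\pi$, $\mathrm{supp}(\pi)\subseteq[-M,M]^d$. $\mathrm{TV}(p,q)=\frac12\int|p-q|$; $\|\cdot\|$ is the Euclidean norm; $a\vee b=\max\{a,b\}$. In the inner expectation $X\sim f_\pi$ is independent of $X_1,\dots,X_n$. Yatracos' estimator: let $\{Q_1,\dots,Q_N\}$ be a minimal-cardinality $\eta$-covering of $\mathcal P_{M,d}$ in total variation (every element of $\mathcal P_{M,d}$ is within TV distance $\eta$ of some $Q_i$), with $\eta\asymp\log^{d/2}(n)/\sqrt n$. Let $A_{ij}=\{x:\frac{dQ_i}{d(Q_i+Q_j)}(x)\ge\frac{dQ_j}{d(Q_i+Q_j)}(x)\}$, $\mathcal A=\{A_{ij}:i\ne j\in[N]\}$, and $\mathrm{dist}(P_1,P_2)=\sup_{A\in\mathcal A}|P_1(A)-P_2(A)|$. With $\widehat P_n=\frac1n\sum_{i=1}^n\delta_{X_i}$, the estimator is $\widehat P:=\operatorname{argmin}_{P'\in\mathcal P_{M,d}}\mathrm{dist}(P',\widehat P_n)$, and $\widehat f$ is its density. At $\epsilon=0$ the first term of $\mathcal E^2$ is read as $0$. The notation $\lesssim$ hides multiplicative constants depending on $M$, $d$ (and the fixed $\delta$), not on $\epsilon$ or $n$. *)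

(* Defs.v *)
From HB Require Import structures.
From mathcomp Require Import all_boot all_order all_algebra.
From mathcomp Require Import all_classical all_reals all_analysis.
From mathcomp Require Import measurable_realfun normal_distribution.

Set Implicit Arguments.
Unset Strict Implicit.
Unset Printing Implicit Defensive.

Import Order.TTheory GRing.Theory Num.Theory.
Import numFieldNormedType.Exports.

Local Open Scope classical_set_scope.
Local Open Scope ring_scope.

(* ['rV[R]_d] carries the product Borel sigma-algebra, generated by the
   coordinates exactly as the library does for [d.-tuple R]. *)
Section row_measurable.
Context {R : realType} (d : nat).

Let coord : 'I_d -> 'rV[R]_d -> R := fun i x => x 0 i.

Let row_set0 : g_sigma_preimage coord set0.
Proof. exact: sigma_algebra0. Qed.

Let row_setC A : g_sigma_preimage coord A -> g_sigma_preimage coord (~` A).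
Proof. exact: sigma_algebraC. Qed.

Let row_bigcup (F : _^nat) : (forall i, g_sigma_preimage coord (F i)) ->
  g_sigma_preimage coord (\bigcup_i (F i)).
Proof. exact: sigma_algebra_bigcup. Qed.

HB.instance Definition _ := @isMeasurable.Build default_measure_display
  'rV[R]_d (g_sigma_preimage coord) row_set0 row_setC row_bigcup.

Lemma measurable_coord (i : 'I_d) :
  measurable_fun [set: 'rV[R]_d] (fun x : 'rV[R]_d => x 0 i).
Proof.
move=> _ Y mY; rewrite setTI; apply: sub_sigma_algebra => /=.
rewrite -bigcup_seq/=; exists i => /=; first by rewrite mem_index_enum.
by exists Y => //; rewrite setTI.
Qed.

Lemma measurable_row d' (T : measurableType d') (f : T -> 'rV[R]_d) :
  (forall i, measurable_fun [set: T] (fun x => f x 0 i)) ->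
  measurable_fun [set: T] f.
Proof.
move=> mf; suff sub : measurable `<=` [set A | measurable (f @^-1` A)].
  by move=> _ A mA; rewrite setTI; exact: sub.
apply: smallest_sub.
  split => [|A /= mA|F /= mF].
  - by rewrite /= preimage_set0.
  - by rewrite setTD preimage_setC; exact: measurableC.
  - by rewrite preimage_bigcup; exact: bigcupT_measurable.
rewrite -bigcup_seq => A [i /= _ [B mB <-]] /=.
by rewrite setTI -comp_preimage -[X in measurable X]setTI; exact: mf.
Qed.

End row_measurable.

(* The [n]-fold product [mu^n]: [mu^(n+1)] is the image of [mu \x mu^n] under
   the canonical bijection [T * T^n -> T^(n+1)]. *)
Section prod_meas.
Context d (T : measurableType d) (R : realType) (mu : set T -> \bar R).

Fixpoint prod_meas (n : nat) : set (n.-tuple T) -> \bar R :=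
  match n with
  | 0 => \d_([tuple] : 0.-tuple T)
  | m.+1 => pushforward (mu \x @prod_meas m)%E
              (fun p : T * m.-tuple T => [tuple of p.1 :: p.2])
  end.

End prod_meas.
Arguments prod_meas {d T R} mu n _.

Section prod_meas_measure.
Context d (T : measurableType d) (R : realType).
Variable mu : {sigma_finite_measure set T -> \bar R}.
Local Open Scope ereal_scope.

Lemma measurable_tuple_cons n :
  measurable_fun [set: T * n.-tuple T] (fun p => [tuple of p.1 :: p.2]).
Proof. exact: measurable_cons. Qed.

Lemma measurable_tuple_uncons n :
  measurable_fun [set: n.+1.-tuple T]
    (fun t => (thead t, [tuple of behead t])).
Proof.
apply: measurable_fun_pair => /=; last exact: measurable_behead.
exact: measurable_tnth.
Qed.

Lemma prod_sigma_finite d' (T' : measurableType d')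
    (m : {sigma_finite_measure set T' -> \bar R}) :
  sigma_finite [set: T * T'] (mu \x m).
Proof.
have /sigma_finiteP[F [TF ndF Foo]] := sigma_finiteT mu.
have /sigma_finiteP[G [TG ndG Goo]] := sigma_finiteT m.
exists (fun n => F n `*` G n).
  rewrite -setXTT TF TG predeqE => -[x y]; split.
    move=> [/= [n _ Fnx] [k _ Gky]]; exists (maxn n k) => //; split.
    - by move: x Fnx; exact/subsetPset/ndF/leq_maxl.
    - by move: y Gky; exact/subsetPset/ndG/leq_maxr.
  by move=> [n _ []/= ? ?]; split; exists n.
move=> k; have [? ?] := Foo k; have [? ?] := Goo k.
split; first exact: measurableX.
by rewrite product_measure1E// lte_mul_pinfty// ge0_fin_numE.
Qed.

Lemma prod_measP n :
  exists m : {sigma_finite_measure set (n.-tuple T) -> \bar R},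
    prod_meas mu n = m :> (set (n.-tuple T) -> \bar R).
Proof.
elim: n => [|n [m mE]].
  pose m : {sigma_finite_measure set (0.-tuple T) -> \bar R} :=
    \d_([tuple] : 0.-tuple T).
  by exists m.
pose c := fun p : T * n.-tuple T => [tuple of p.1 :: p.2].
have mc : measurable_fun setT c := @measurable_tuple_cons n.
pose c' (t : n.+1.-tuple T) := (thead t, [tuple of behead t]).
have mc' : measurable_fun setT c' := @measurable_tuple_uncons n.
have c'K : cancel c' c by move=> t; rewrite /c /c' /= -tuple_eta.
have cK : cancel c c'.
  by move=> [x t]; rewrite /c /c' /= theadE; congr pair; exact/val_inj.
pose nu (A : set (n.+1.-tuple T)) := (mu \x m) (c @^-1` A).
have nu0 : nu set0 = 0 by rewrite /nu preimage_set0 measure0.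
have nu_ge0 A : 0 <= nu A by exact: measure_ge0.
have nus : semi_sigma_additive nu.
  move=> F mF tF mUF; rewrite /nu preimage_bigcup.
  apply: measure_semi_sigma_additive.
  - by move=> k; rewrite -[X in measurable X]setTI; exact: mc.
  - apply/trivIsetP => /= i j _ _ ij; rewrite -preimage_setI.
    by move/trivIsetP : tF => /(_ _ _ _ _ ij) ->//; rewrite preimage_set0.
  - by rewrite -preimage_bigcup -[X in measurable X]setTI; exact: mc.
pose nuM : {measure set (n.+1.-tuple T) -> \bar R} :=
  HB.pack nu (isMeasure.Build _ _ _ nu nu0 nu_ge0 nus).
have nusf : sigma_finite setT nuM.
  have [F TF Foo] : sigma_finite setT (mu \x m).
    exact: prod_sigma_finite.
  exists (fun k => c' @^-1` F k).
    by rewrite -preimage_bigcup -TF preimage_setT.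
  move=> k; have [mFk Fk] := Foo k; split.
    by rewrite -[X in measurable X]setTI; exact: mc'.
  rewrite /nuM /= /nu -comp_preimage.
  by rewrite (_ : c' \o c = id)//; apply/funext => p; exact: cK.
pose nuS : {sigma_finite_measure set (n.+1.-tuple T) -> \bar R} :=
  HB.pack nu nuM (Measure_isSigmaFinite.Build _ _ _ nuM nusf).
by exists nuS => /=; rewrite mE.
Qed.

Let prod_meas0 n : prod_meas mu n set0 = 0.
Proof. by have [m ->] := prod_measP n; rewrite measure0. Qed.

Let prod_meas_ge0 n A : 0 <= prod_meas mu n A.
Proof. by have [m ->] := prod_measP n; exact: measure_ge0. Qed.

Let prod_meas_sigma_additive n : semi_sigma_additive (prod_meas mu n).
Proof.
by have [m ->] := prod_measP n; exact: measure_semi_sigma_additive.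
Qed.

HB.instance Definition _ n := isMeasure.Build _ _ _ (prod_meas mu n)
  (prod_meas0 n) (@prod_meas_ge0 n) (@prod_meas_sigma_additive n).

Let prod_meas_sigma_finite n : sigma_finite setT (prod_meas mu n).
Proof. by have [m ->] := prod_measP n; exact: sigma_finiteT. Qed.

HB.instance Definition _ n := Measure_isSigmaFinite.Build _ _ _
  (prod_meas mu n) (prod_meas_sigma_finite n).

End prod_meas_measure.

Definition iid_law d (T : measurableType d) (R : realType)
  (P : probability T R) (n : nat) : set (n.-tuple T) -> \bar R :=
  prod_meas P n.

Arguments iid_law {d T R} P n _.

Section iid_law_probability.
Context d (T : measurableType d) (R : realType).
Variables (P : probability T R) (n : nat).

HB.instance Definition _ := Measure.on (iid_law P n).

Let iid_law_setT : iid_law P n setT = 1%E.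
Proof.
rewrite /iid_law; elim: n => [|m IH] /=; first by rewrite diracT.
rewrite /pushforward preimage_setT -setXTT.
transitivity (P setT * prod_meas P m setT)%E; first exact: product_measure1E.
by rewrite IH mule1 probability_setT.
Qed.

HB.instance Definition _ :=
  Measure_isProbability.Build _ _ _ (iid_law P n) iid_law_setT.

End iid_law_probability.

Section row_lebesgue.
Context {R : realType} (d : nat).

Definition row_of_tuple (t : d.-tuple (measurableTypeR R)) : 'rV[R]_d :=
  \row_i (tnth t i : R).

Lemma measurable_row_of_tuple : measurable_fun setT row_of_tuple.
Proof.
apply: measurable_row => i.
by under eq_fun do rewrite mxE; exact: measurable_tnth.
Qed.

Definition lebesgue_row : set 'rV[R]_d -> \bar R :=
  pushforward (prod_meas (@lebesgue_measure R) d) row_of_tuple.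

Let lebesgue_row0 : lebesgue_row set0 = 0%E.
Proof. by rewrite /lebesgue_row /pushforward preimage_set0 measure0. Qed.

Let lebesgue_row_ge0 A : (0 <= lebesgue_row A)%E.
Proof. by rewrite /lebesgue_row /pushforward measure_ge0. Qed.

Let lebesgue_row_sigma_additive : semi_sigma_additive lebesgue_row.
Proof.
have mc := measurable_row_of_tuple.
move=> F mF tF mUF; rewrite /lebesgue_row /pushforward preimage_bigcup.
apply: measure_semi_sigma_additive.
- by move=> k; rewrite -[X in measurable X]setTI; exact: mc.
- apply/trivIsetP => /= i j _ _ ij; rewrite -preimage_setI.
  by move/trivIsetP : tF => /(_ _ _ _ _ ij) ->//; rewrite preimage_set0.
- by rewrite -preimage_bigcup -[X in measurable X]setTI; exact: mc.
Qed.

HB.instance Definition _ := isMeasure.Build _ _ _ lebesgue_row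
  lebesgue_row0 lebesgue_row_ge0 lebesgue_row_sigma_additive.

Let lebesgue_row_sigma_finite : sigma_finite setT lebesgue_row.
Proof.
pose c' (x : 'rV[R]_d) : d.-tuple (measurableTypeR R) := [tuple x 0 i | i < d].
have mc' : measurable_fun setT c'.
  apply/measurable_fun_tnthP => i.
  rewrite (_ : _ \o _ = (fun x : 'rV[R]_d => x 0 i)); last first.
    by apply/funext => x /=; rewrite tnth_mktuple.
  exact: measurable_coord.
have [F TF Foo] : sigma_finite setT (prod_meas (@lebesgue_measure R) d).
  exact: sigma_finiteT.
exists (fun k => c' @^-1` F k).
  by rewrite -preimage_bigcup -TF preimage_setT.
move=> k; have [mFk Fk] := Foo k; split.
  by rewrite -[X in measurable X]setTI; exact: mc'.
rewrite /lebesgue_row /pushforward -comp_preimage.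
rewrite (_ : c' \o row_of_tuple = id)//; apply/funext => t /=.
by apply: eq_from_tnth => i; rewrite tnth_mktuple mxE.
Qed.

HB.instance Definition _ := Measure_isSigmaFinite.Build _ _ _
  lebesgue_row lebesgue_row_sigma_finite.

End row_lebesgue.
Arguments lebesgue_row {R} d.

Section prod_meas_integral.
Context d (T : measurableType d) (R : realType).
Variable mu : {sigma_finite_measure set T -> \bar R}.

Lemma integral_prod_meas1 n (g : 'I_n -> T -> R) :
  (forall i, measurable_fun setT (g i)) -> (forall i x, 0 <= g i x) ->
  (forall i, \int[mu]_x (g i x)%:E = 1)%E ->
  (\int[prod_meas mu n]_t (\prod_(i < n) g i (tnth t i))%:E = 1)%E.
Proof.
elim: n => [|n IH] in g * => mg g0 g1.
  by under eq_integral do rewrite big_ord0; rewrite integral_dirac// diracT mul1e.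
have mprod m (h : 'I_m -> T -> R) : (forall i, measurable_fun setT (h i)) ->
    measurable_fun setT (fun t : m.-tuple T => \prod_(i < m) h i (tnth t i)).
  move=> mh; apply: measurable_prod => i _.
  by apply: measurableT_comp => //; exact: measurable_tnth.
pose G (t : n.-tuple T) := \prod_(i < n) g (lift ord0 i) (tnth t i).
have G0 t : 0 <= G t by apply: prodr_ge0.
have mG : measurable_fun setT G.
  by apply: (mprod n (fun i => g (lift ord0 i))).
rewrite /= (ge0_integral_pushforward (@measurable_tuple_cons _ T n))//; last 2 first.
- by apply/measurable_EFinP; exact: mprod.
- by move=> t _; rewrite lee_fin prodr_ge0.
rewrite preimage_setT.
rewrite (eq_integral (fun p : T * n.-tuple T => (g ord0 p.1 * G p.2)%:E)); last first.
  move=> p _ /=; rewrite big_ord_recl tnth0; congr (_ * _)%:E.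
  by apply: eq_bigr => i _; rewrite tnthS.
rewrite fubini_tonelli1//; last 2 first.
- apply/measurable_EFinP/measurable_funM => //; exact: measurableT_comp.
- by move=> p; rewrite lee_fin mulr_ge0.
rewrite -[RHS](g1 ord0); apply: eq_integral => x _.
rewrite /fubini_F /=; under eq_integral do rewrite EFinM.
rewrite ge0_integralZl//; last 3 first.
- exact/measurable_EFinP.
- by move=> t _; rewrite lee_fin.
- by rewrite lee_fin.
by rewrite (IH (fun i => g (lift ord0 i)))// mule1.
Qed.

End prod_meas_integral.

Section gaussian.
Context {R : realType} (d : nat).
Implicit Types (x t : 'rV[R]_d).

Definition enorm x : R := Num.sqrt (\sum_i x 0 i ^+ 2).

Definition gauss_pdf x : R :=
  Num.sqrt (2 * pi) ^- d * expR (- enorm x ^+ 2 / 2).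

Lemma gauss_pdf_ge0 x : 0 <= gauss_pdf x.
Proof. by rewrite mulr_ge0 ?expR_ge0// invr_ge0 exprn_ge0. Qed.

Lemma gauss_pdfE x t :
  gauss_pdf (x - t) = \prod_(i < d) normal_pdf (t 0 i) 1 (x 0 i).
Proof.
rewrite /gauss_pdf sqr_sqrtr; last by apply: sumr_ge0 => i _; exact: sqr_ge0.
under [RHS]eq_bigr do rewrite normal_pdfE ?oner_neq0//.
rewrite big_split/= /normal_peak /normal_fun prodr_const card_ord.
rewrite expr1n mul1r exprVn; congr (_ * _); first by rewrite mulr_natl.
rewrite -expR_sum; congr expR.
rewrite -sumrN mulr_suml; apply: eq_bigr => i _.
by rewrite !mxE.
Qed.

Lemma gauss_pdf_ub x : gauss_pdf x <= Num.sqrt (2 * pi) ^- d.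
Proof.
rewrite ler_piMr ?invr_ge0 ?exprn_ge0//.
by rewrite -[leRHS]expR0 ler_expR mulNr oppr_le0 mulr_ge0 ?sqr_ge0.
Qed.

Lemma measurable_gauss_pdfB :
  measurable_fun setT (fun p : 'rV[R]_d * 'rV[R]_d => gauss_pdf (p.1 - p.2)).
Proof.
rewrite /gauss_pdf; apply: measurable_funM => //.
apply: (@measurableT_comp _ _ _ _ _ _ expR) => //.
apply: measurable_funM => //.
apply: (measurableT_comp (@oppr_measurable R _)).
rewrite (_ : (fun _ => _) = fun p : 'rV[R]_d * 'rV[R]_d =>
    \sum_i (p.1 0 i - p.2 0 i) ^+ 2); last first.
  apply/funext => p; rewrite sqr_sqrtr ?sumr_ge0// => [|i _]; last exact: sqr_ge0.
  by apply: eq_bigr => i _; rewrite !mxE.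
apply: measurable_sum => i; apply: measurable_funX.
apply: measurable_funB.
- exact: (measurableT_comp (measurable_coord i) measurable_fst).
- exact: (measurableT_comp (measurable_coord i) measurable_snd).
Qed.

Lemma integral_gauss_pdfB t :
  (\int[lebesgue_row d]_x (gauss_pdf (x - t))%:E = 1)%E.
Proof.
rewrite (ge0_integral_pushforward (@measurable_row_of_tuple R d))//; last 2 first.
- apply/measurable_EFinP.
  exact: measurableT_comp measurable_gauss_pdfB (pair2_measurable t).
- by move=> x _; rewrite lee_fin gauss_pdf_ge0.
rewrite preimage_setT -[RHS](@integral_prod_meas1 _ _ _ (@lebesgue_measure R) d
  (fun i s => normal_pdf (t 0 i) 1 s))//.
- apply: eq_integral => s _ /=; rewrite gauss_pdfE; congr EFin.
  by apply: eq_bigr => i _; rewrite /row_of_tuple mxE.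
- by move=> i; exact: measurable_normal_pdf.
- by move=> i x; exact: normal_pdf_ge0.
- by move=> i; exact: integral_normal_pdf.
Qed.

End gaussian.

Section gaussian_mixture.
Context {R : realType} (d : nat).
Implicit Types (x : 'rV[R]_d) (pi : probability 'rV[R]_d R).

Definition mix_density pi x : R := (\int[pi]_t gauss_pdf (x - t))%R.

Let measurable_gauss_pdf2 x : measurable_fun setT (fun t : 'rV[R]_d => (gauss_pdf (x - t))%:E).
Proof.
apply/measurable_EFinP.
exact: measurableT_comp (@measurable_gauss_pdfB R d) (pair1_measurable x).
Qed.

Lemma mix_densityE pi x :
  (mix_density pi x)%:E = (\int[pi]_t (gauss_pdf (x - t))%:E)%E.
Proof.
rewrite /mix_density /Rintegral fineK// ge0_fin_numE; last first.
  by apply: integral_ge0 => t _; rewrite lee_fin gauss_pdf_ge0.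
apply: (@le_lt_trans _ _
    (\int[pi]_(t in setT) cst ((Num.sqrt (2 * trigo.pi) ^- d)%:E) t)%E).
  apply: ge0_le_integral => //.
  - by move=> t _; rewrite lee_fin gauss_pdf_ge0.
  - by move=> t _; rewrite lee_fin gauss_pdf_ub.
by rewrite integral_cst//= probability_setT mule1 ltry.
Qed.

Lemma mix_density_ge0 pi x : 0 <= mix_density pi x.
Proof. by apply: Rintegral_ge0 => t _; exact: gauss_pdf_ge0. Qed.

Lemma measurable_mix_density pi : measurable_fun setT (mix_density pi).
Proof.
apply/measurable_EFinP.
rewrite (_ : _ \o _ = fubini_F pi
  (fun p : 'rV[R]_d * 'rV[R]_d => (gauss_pdf (p.1 - p.2))%:E)); last first.
  by apply/funext => x /=; rewrite mix_densityE.
apply: measurable_fun_fubini_tonelli_F => //.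
- by apply/measurable_EFinP; exact: measurable_gauss_pdfB.
- by move=> p; rewrite lee_fin gauss_pdf_ge0.
Qed.

Lemma integral_mix_density pi :
  (\int[lebesgue_row d]_x (mix_density pi x)%:E = 1)%E.
Proof.
under eq_integral do rewrite mix_densityE.
rewrite (@fubini_tonelli _ _ _ _ _ (lebesgue_row d) pi
  (fun p : 'rV[R]_d * 'rV[R]_d => (gauss_pdf (p.1 - p.2))%:E)) /=.
- under eq_integral do rewrite integral_gauss_pdfB.
  by rewrite integral_cst// mul1e; exact: probability_setT.
- by apply/measurable_EFinP; exact: measurable_gauss_pdfB.
- by move=> p; rewrite lee_fin gauss_pdf_ge0.
Qed.

Definition mix_law pi : set 'rV[R]_d -> \bar R :=
  fun A => (\int[lebesgue_row d]_(x in A) (mix_density pi x)%:E)%E.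

Section mix_law_probability.
Variable pi : probability 'rV[R]_d R.

Let mix_law0 : mix_law pi set0 = 0%E.
Proof. by rewrite /mix_law integral_set0. Qed.

Let mix_law_ge0 A : (0 <= mix_law pi A)%E.
Proof. by apply: integral_ge0 => x _; rewrite lee_fin mix_density_ge0. Qed.

Let mix_law_sigma_additive : semi_sigma_additive (mix_law pi).
Proof.
move=> F mF tF mUF; rewrite /mix_law ge0_integral_bigcup//=.
- apply: is_cvg_ereal_nneg_natsum_cond => n _ _.
  by apply: integral_ge0 => x _; rewrite lee_fin mix_density_ge0.
- by apply/measurable_EFinP/measurable_funTS; exact: measurable_mix_density.
- by move=> x _; rewrite lee_fin mix_density_ge0.
Qed.

HB.instance Definition _ := isMeasure.Build _ _ _ (mix_law pi)
  mix_law0 mix_law_ge0 mix_law_sigma_additive.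

Let mix_law_setT : mix_law pi setT = 1%E.
Proof. exact: integral_mix_density. Qed.

HB.instance Definition _ :=
  Measure_isProbability.Build _ _ _ (mix_law pi) mix_law_setT.

End mix_law_probability.

End gaussian_mixture.

Section contamination.
Context d (T : measurableType d) (R : realType).

Definition contaminate (eps : {i01 R}) (P Q : probability T R) :
    set T -> \bar R :=
  measure_add (mscale (1 - eps%:num)%:nng P) (mscale eps%:num%:nng Q).

Variables (eps : {i01 R}) (P Q : probability T R).

HB.instance Definition _ := Measure.on (contaminate eps P Q).

Let contaminate_setT : contaminate eps P Q setT = 1%E.
Proof.
rewrite /contaminate measure_addE/= /mscale/=.
rewrite (probability_setT P) (probability_setT Q) !mule1.
by rewrite -EFinD subrK.
Qed.

HB.instance Definition _ :=
  Measure_isProbability.Build _ _ _ (contaminate eps P Q) contaminate_setT.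

End contamination.

Section sum_measure.
Context d (T : measurableType d) (R : realType).
Variables P Q : {finite_measure set T -> \bar R}.

(* [measure_add] has no finite-measure instance in the library. *)
Definition sum_measure : set T -> \bar R := measure_add P Q.

HB.instance Definition _ := Measure.on sum_measure.

Let sum_measure_fin : fin_num_fun sum_measure.
Proof.
by move=> A mA; rewrite /sum_measure measure_addE fin_numD !fin_num_measure.
Qed.

HB.instance Definition _ :=
  Measure_isFinite.Build _ _ _ sum_measure sum_measure_fin.

End sum_measure.

Section total_variation.
Context d (T : measurableType d) (R : realType).
Implicit Types P Q : probability T R.
Local Open Scope charge_scope.
Local Open Scope ereal_scope.

(* [TV(P, Q) = 1/2 \int |p - q|], with [p] and [q] the densities with respect
   to the dominating measure [P + Q] *)
Definition tv P Q : \bar R :=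
  (2^-1)%:E * \int[sum_measure P Q]_x
    `| ('d (charge_of_finite_measure P) '/d (sum_measure P Q)) x
     - ('d (charge_of_finite_measure Q) '/d (sum_measure P Q)) x |.

Definition yatracos_set P Q : set T :=
  [set x | ('d (charge_of_finite_measure Q) '/d (sum_measure P Q)) x
        <= ('d (charge_of_finite_measure P) '/d (sum_measure P Q)) x].

Definition yatracos_class N (Q : 'I_N -> probability T R) : set (set T) :=
  [set A | exists i j, i != j /\ A = yatracos_set (Q i) (Q j)].

Definition tv_covering (C : set (probability T R)) (eta : R) N
    (Q : 'I_N -> probability T R) :=
  forall P, C P -> exists i, tv P (Q i) <= eta%:E.

(* The centers [Q i] are arbitrary probability measures: they are not required
   to belong to the covered class [C]. *)
Definition minimal_tv_covering (C : set (probability T R)) (eta : R) N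
    (Q : 'I_N -> probability T R) :=
  tv_covering C eta Q /\
  forall N' (Q' : 'I_N' -> probability T R),
    tv_covering C eta Q' -> (N <= N')%N.

End total_variation.

Definition dist_class T (R : realType) (AA : set (set T))
    (P1 P2 : set T -> \bar R) : R :=
  sup [set `|fine (P1 A) - fine (P2 A)| | A in AA].

Definition empirical d (T : measurableType d) (R : realType) n
    (X : n.-tuple T) : set T -> \bar R :=
  fun A => ((n%:R^-1 : R)%:E * \sum_(i < n) \d_(tnth X i) A)%E.

Section expectation.
Context d (T : measurableType d) (R : realType).
Variable P : probability T R.
Local Open Scope ereal_scope.

(* An argmin need not be measurable in the sample, hence the upper integral;
   it is the library's integral on measurable functions
   ([upper_expectationE]). *)
Definition upper_expectation (g : T -> \bar R) : \bar R :=
  ereal_inf [set \int[P]_x h x |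
    h in [set h : T -> \bar R | measurable_fun setT h /\ forall x, g x <= h x]].

Lemma upper_expectationE (g : T -> \bar R) :
  measurable_fun setT g -> (forall x, 0 <= g x) ->
  upper_expectation g = \int[P]_x g x.
Proof.
move=> mg g0; apply/eqP; rewrite eq_le; apply/andP; split.
  by apply: ereal_inf_lbound; exists g.
apply: le_ereal_inf_tmp => _ [h [mh gh] <-].
by apply: ge0_le_integral => // x _; exact: le_trans (gh x).
Qed.

End expectation.

Section empirical_bayes.
Context {R : realType} (d : nat).
Implicit Types (pi Q : probability 'rV[R]_d R) (f : 'rV[R]_d -> R).

Definition msupport pi : set 'rV[R]_d :=
  [set x | forall U, open U -> U x -> (0 < pi U)%E].

Definition cube (M : R) : set 'rV[R]_d :=
  [set x | forall i, - M <= x 0 i <= M].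

Definition mixture_class (M : R) : set (probability 'rV[R]_d R) :=
  [set P | exists2 pi, msupport pi `<=` cube M & P = mix_law pi].

Definition grad f (x : 'rV[R]_d) : 'rV[R]_d :=
  \row_i 'D_(delta_mx 0 i) f x.

Definition oracle_rule pi (x : 'rV[R]_d) : 'rV[R]_d :=
  x + (mix_density pi x)^-1 *: grad (mix_density pi) x.

Definition regularized_rule f (rho : R) (x : 'rV[R]_d) : 'rV[R]_d :=
  x + (Num.max (f x) rho)^-1 *: grad f x.

(* [fhat X] is the Gaussian-mixture version of the density of a minimum-distance
   element of [mixture_class M]; any choice among the minimizers is allowed. *)
Definition is_yatracos_estimator (M eta : R) n
    (fhat : n.-tuple 'rV[R]_d -> 'rV[R]_d -> R) :=
  exists N (Q : 'I_N -> probability 'rV[R]_d R),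
    minimal_tv_covering (mixture_class M) eta Q /\
    forall X, exists2 pihat,
      [/\ msupport pihat `<=` cube M & fhat X = mix_density pihat] &
      forall P', mixture_class M P' ->
        dist_class (yatracos_class Q) (mix_law pihat) (empirical R X) <=
        dist_class (yatracos_class Q) P' (empirical R X).

Definition regret pi f (rho : R) : \bar R :=
  (\int[mix_law pi]_x
     (enorm (regularized_rule f rho x - oracle_rule pi x) ^+ 2)%:E)%E.

Definition expected_regret n (fhat : n.-tuple 'rV[R]_d -> 'rV[R]_d -> R)
    (eps : {i01 R}) (rho : R) pi Q : \bar R :=
  upper_expectation (iid_law (contaminate eps (mix_law pi) Q) n)
    (fun X => regret pi (fhat X) rho).

Definition worst_regret (M : R) n (fhat : n.-tuple 'rV[R]_d -> 'rV[R]_d -> R)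
    (eps : {i01 R}) (rho : R) : \bar R :=
  ereal_sup [set r | exists pi Q,
    msupport pi `<=` cube M /\ r = expected_regret fhat eps rho pi Q].

End empirical_bayes.

Definition regret_rate (R : realType) (delta o eps : R) (n : nat) : R :=
  (if eps == 0 then 0 else
   eps `^ (2 * (1 - (2 + delta) / ln (Num.max (ln eps^-1) (expR 1)))))
  + (n%:R `^ (1 - o))^-1.

Definition covering_radius (R : realType) (d n : nat) : R :=
  ln n%:R `^ (d%:R / 2) / Num.sqrt n%:R.

(* Main.v *)
(* The error of the regularized rule is controlled by f - g and by the difference
   of the first-moment densities (f and g the true and the estimated mixture).
   Both are Gaussian smoothings of the signed measure s = pi - pihat at scale 1,
   and smoothing from a slightly sharper scale bounds them pointwise, up to
   exp(-|x|^2 / 4), by an energy N(u) = \iint exp(u <t, t'>) ds~(t) ds~(t'), where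
   ds~(t) = exp(-|t|^2 / 5) ds(t). The energy N(u) is a power series in u with
   nonnegative coefficients (sums of squared moments), hence for u0 < u < v
     N(u) <= (u / u0)^k N(u0) + (u / v)^k N(v)   for every k.
   N(2/5) is at most a constant times the squared L1 distance of f and g, while
   N(v) <= 4 exp(v d M^2); taking v = (log 1/rho)^(4/5) and k of the order of
   log(1/rho) / loglog(1/rho) gives
     regret <= C exp(4 L / log L) (rho + |f - g|_1^2),  L = log(1/rho) / 2.
   Truncating the same power series bounds the covering numbers: mixtures whose
   moments of order about log n / loglog n agree up to a grid step are close in
   L1. The L1 risk of the estimator then follows from Yatracos' argument and an
   exponential moment bound over the finite class of comparison sets. *)

From HB Require Import structures.
Require Import Defs.
From mathcomp Require Import all_boot all_order all_algebra.
From mathcomp Require Import all_classical all_reals all_analysis.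
From mathcomp Require Import measurable_realfun ring lra.

Import Order.TTheory GRing.Theory Num.Theory.
Import numFieldNormedType.Exports.

Local Open Scope classical_set_scope.
Local Open Scope ring_scope.

Set Implicit Arguments.
Unset Strict Implicit.
Unset Printing Implicit Defensive.

(** * Bounded measurable functions and Gaussian kernels *)

(** The regret integrates the squared error against f, that is (f error)^2 / f, and f(x) is at least
    a constant times exp(-|x|^2 / 2 - O(r)) on |x| <= r. Hence the squares of the pointwise bounds
    must carry the full factor exp(-|x|^2 / 2), which fixes the Gaussian precisions used below.
    Dividing then costs only exp(O(r)), and r of order L^(4/5) makes the tail O(rho). The
    coefficient of L / log L is a budget: the rate in eps tolerates 4 + 2 delta for every delta > 0,
    so 4 must suffice. The interpolation from u0 = 2/5 to u = 8/5 costs 4^k. With v of order L^b the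
    compactness term falls to rho once k = (2/b) L / log L, so 4^k costs (2/b) log 4, which is below
    4 when b > log 2; and b < 1 makes exp(O(L^b)), which covers both exp(O(r)) and N(v), negligible
    against the margin. With b = 4/5 and log 4 <= 3/2 the first cost is 15/4, and 1/4 is left for
    the second. Taking rho = max(eps^2, 1 / (n + 1)) keeps L below both log(1/eps) and log n, so
    that each part of the rate pays only for itself. *)

Section bounded_measurable.
Context d (T : measurableType d) (R : realType).
Implicit Types f g : T -> R.

(** A class closed under sums, products, powers and [expR], so that integrability against a finite
    measure is checked by closure. *)
Definition bddm f := measurable_fun setT f /\ exists c, forall x, `|f x| <= c.

Lemma bddm_cst (c : R) : bddm (fun=> c).
Proof. by split => //; exists `|c|. Qed.

Lemma bddmD f g : bddm f -> bddm g -> bddm (fun x => f x + g x).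
Proof.
move=> [mf [c fc]] [mg [c' gc]]; split; first exact: measurable_funD.
by exists (c + c') => x; rewrite (le_trans (ler_normD _ _))// lerD.
Qed.

Lemma bddmM f g : bddm f -> bddm g -> bddm (fun x => f x * g x).
Proof.
move=> [mf [c fc]] [mg [c' gc]]; split; first exact: measurable_funM.
by exists (c * c') => x; rewrite normrM ler_pM.
Qed.

Lemma bddmZ (k : R) f : bddm f -> bddm (fun x => k * f x).
Proof. by move=> bf; exact: (bddmM (bddm_cst k) bf). Qed.

Lemma bddmB f g : bddm f -> bddm g -> bddm (fun x => f x - g x).
Proof.
move=> bf bg; rewrite (_ : (fun _ => _) = fun x => f x + (-1) * g x).
  exact: (bddmD bf (bddmZ (-1) bg)).
by apply/funext => x; rewrite mulN1r.
Qed.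

Lemma bddmX f n : bddm f -> bddm (fun x => f x ^+ n).
Proof.
move=> bf; elim: n => [|n IH]; first exact: bddm_cst.
under eq_fun do rewrite exprS; exact: (bddmM bf IH).
Qed.

Lemma bddm_sum (I : Type) (r : seq I) (F : I -> T -> R) :
  (forall i, bddm (F i)) -> bddm (fun x => \sum_(i <- r) F i x).
Proof.
move=> bF; elim: r => [|i r IH].
  by under eq_fun do rewrite big_nil; exact: bddm_cst.
under eq_fun do rewrite big_cons; exact: (bddmD (bF i) IH).
Qed.

Lemma bddm_expR f : bddm f -> bddm (fun x => expR (f x)).
Proof.
move=> [mf [c fc]]; split; first exact: measurableT_comp.
by exists (expR c) => x; rewrite ger0_norm ?expR_ge0// ler_expR (le_trans (ler_norm _)).
Qed.

Lemma bddm_integrable (mu : {measure set T -> \bar R}) f :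
  (mu setT < +oo)%E -> bddm f -> mu.-integrable setT (EFin \o f).
Proof.
move=> mufin [mf [c fc]]; apply: measurable_bounded_integrable => //.
exists c; split; first exact: num_real.
by move=> x cx y _ /=; rewrite (le_trans (fc y))// ltW.
Qed.

Lemma fin_measureT (mu : {finite_measure set T -> \bar R}) : (mu setT < +oo)%E.
Proof. by rewrite ltey_eq fin_num_measure. Qed.

Lemma bddm_int (mu : {finite_measure set T -> \bar R}) f :
  bddm f -> mu.-integrable setT (EFin \o f).
Proof. by apply: bddm_integrable; exact: fin_measureT. Qed.

Lemma EFin_Rintegral (mu : {measure set T -> \bar R}) f :
  mu.-integrable setT (EFin \o f) ->
  (\int[mu]_x f x)%:E = (\int[mu]_x (f x)%:E)%E.
Proof. by move=> i; rewrite /Rintegral fineK// integrable_fin_num. Qed.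

Lemma le_norm_Rintegral (mu : {measure set T -> \bar R}) f g :
  measurable_fun setT f -> mu.-integrable setT (EFin \o g) ->
  (forall x, `|f x| <= g x) ->
  mu.-integrable setT (EFin \o f) /\
  `|\int[mu]_x f x| <= \int[mu]_x g x.
Proof.
move=> mf ig fg; have i : mu.-integrable setT (EFin \o f).
  apply: (le_integrable _ _ _ ig) => //; first exact/measurable_EFinP.
  by move=> x _; rewrite lee_fin/= (le_trans (fg x))// ler_norm.
split => //; rewrite (le_trans (le_normr_Rintegral _ i))//.
by apply: le_Rintegral => //; exact: (integrable_norm i).
Qed.

Lemma norm_Rintegral_le (mu : {measure set T -> \bar R}) f (c : R) :
  (mu setT < +oo)%E ->
  measurable_fun setT f -> (forall x, `|f x| <= c) ->
  `|\int[mu]_x f x| <= c * fine (mu setT).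
Proof.
move=> mufin mf fc; have ic := bddm_integrable mufin (bddm_cst c).
by have [_] := le_norm_Rintegral mf ic fc; rewrite Rintegral_cst.
Qed.

(* Minimize the integral of [(f - l g)^2] over [l]. *)
Lemma Rintegral_cauchy_schwarz (mu : {measure set T -> \bar R}) f g :
  mu.-integrable setT (EFin \o (fun x => f x ^+ 2)) ->
  mu.-integrable setT (EFin \o (fun x => g x ^+ 2)) ->
  mu.-integrable setT (EFin \o (fun x => f x * g x)) ->
  0 < \int[mu]_x g x ^+ 2 ->
  (\int[mu]_x (f x * g x)) ^+ 2 <= (\int[mu]_x f x ^+ 2) * (\int[mu]_x g x ^+ 2).
Proof.
move=> iff igg ifg; set F := (\int[mu]_x f x ^+ 2); set G := \int[mu]_x _.
set C := \int[mu]_x _ => G0; pose l := C / G.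
suff : 0 <= F - C ^+ 2 / G.
  by rewrite subr_ge0 ler_pdivrMr.
have -> : F - C ^+ 2 / G = F + (- (2 * l)) * C + l ^+ 2 * G.
  by rewrite /l; field; rewrite gt_eqF.
have i1 : mu.-integrable setT (EFin \o (fun x => - (2 * l) * (f x * g x))).
  exact: (integrableZl measurableT (- (2 * l)) ifg).
have i2 : mu.-integrable setT (EFin \o (fun x => l ^+ 2 * (g x) ^+ 2)).
  exact: (integrableZl measurableT (l ^+ 2) igg).
rewrite -(RintegralZl (- (2 * l)) measurableT ifg) -(RintegralZl (l ^+ 2) measurableT igg).
rewrite -RintegralD// -RintegralD//; last exact: (integrableD measurableT iff i1).
apply: Rintegral_ge0 => x _.
have -> : f x ^+ 2 + - (2 * l) * (f x * g x) + l ^+ 2 * g x ^+ 2 = (f x - l * g x) ^+ 2.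
  by ring.
exact: sqr_ge0.
Qed.

End bounded_measurable.

Lemma bddm_comp d (T : measurableType d) d' (T' : measurableType d')
    (R : realType) (h : T' -> T) (f : T -> R) :
  measurable_fun setT h -> bddm f -> bddm (fun x => f (h x)).
Proof.
move=> mh [mf [c fc]]; split; last by exists c.
exact: measurableT_comp.
Qed.

(** * Fubini's theorem for dominated kernels *)

Section dominated_fubini.
Context d1 d2 (S : measurableType d1) (T : measurableType d2) (R : realType).
Variables (nu : {sigma_finite_measure set S -> \bar R}).
Variables (mu : {finite_measure set T -> \bar R}).
Variables (G : S * T -> R) (C : R).
Hypothesis mG : measurable_fun setT G.
Hypothesis bG : forall z, exists c, forall t, `|G (z, t)| <= c.
Hypothesis GC : forall t, (\int[nu]_z `|G (z, t)|%:E <= C%:E)%E.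

(** The integral over [z] is bounded uniformly in [t] and [mu] is finite, so Tonelli, integrating
    over [z] inside, bounds the double integral. *)
Lemma dominated_integrable : (nu \x mu)%E.-integrable setT (EFin \o G).
Proof.
apply/integrable21ltyP; first exact/measurable_EFinP.
apply: (@le_lt_trans _ _ (\int[mu]_t (cst C%:E t))%E).
  apply: ge0_le_integral => //.
  - by move=> t _; apply: integral_ge0.
  - apply: (measurable_fun_fubini_tonelli_G (abse \o (EFin \o G))) => //.
      by apply: measurableT_comp => //; exact/measurable_EFinP.
    by move=> p; exact: abse_ge0.
  - by move=> t _; exact: GC.
rewrite integral_cst// ltey_eq fin_numM// fin_num_measure//.
Qed.

Let sec1 z : measurable_fun setT (fun t => G (z, t)).
Proof. exact: (measurableT_comp mG (pair1_measurable z)). Qed.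

Let sec2 t : measurable_fun setT (fun z => G (z, t)).
Proof. exact: (measurableT_comp mG (pair2_measurable t)). Qed.

Lemma dominated_section_integrable t :
  nu.-integrable setT (EFin \o (fun z => G (z, t))).
Proof.
apply/integrableP; split; first exact/measurable_EFinP.
exact: (le_lt_trans (GC t) (ltry _)).
Qed.

Let int1 z : mu.-integrable setT (EFin \o (fun t => G (z, t))).
Proof. by apply: bddm_int; split. Qed.

Lemma dominated_marginal_integrable :
  nu.-integrable setT (EFin \o (fun z => \int[mu]_t G (z, t))).
Proof.
have := integrable_fubini_F dominated_integrable.
congr (_.-integrable _ _); apply/funext => z /=.
by rewrite (EFin_Rintegral (int1 z)).
Qed.

Lemma dominated_marginal_bddm : bddm (fun t => \int[nu]_z G (z, t)).
Proof.
split.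
  apply/measurable_EFinP; have := measurable_fubini_G dominated_integrable.
  congr (measurable_fun _ _); apply/funext => t /=.
  by rewrite (EFin_Rintegral (dominated_section_integrable t)).
exists C => t; rewrite -lee_fin (le_trans _ (GC t))//.
have i := dominated_section_integrable t.
rewrite EFin_normr_Rintegral// le_abse_integral//.
exact/measurable_EFinP.
Qed.

Lemma dominated_fubini :
  \int[mu]_t (\int[nu]_z G (z, t)) = \int[nu]_z (\int[mu]_t G (z, t)).
Proof.
have i := dominated_integrable.
transitivity (fine (\int[mu]_t \int[nu]_z (G (z, t))%:E)%E).
  congr fine; apply: eq_integral => t _ /=.
  by rewrite EFin_Rintegral//; exact: dominated_section_integrable.
rewrite -(Fubini i); congr fine; apply: eq_integral => z _ /=.
by rewrite EFin_Rintegral.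
Qed.

End dominated_fubini.

Section vectors.
Context {R : realType} (d : nat).
Implicit Types x y z : 'rV[R]_d.

Definition dot x y : R := \sum_i x 0 i * y 0 i.
Definition sq x : R := dot x x.

Lemma dotC x y : dot x y = dot y x.
Proof. by apply: eq_bigr => i _; rewrite mulrC. Qed.

Lemma sqE x : sq x = \sum_i x 0 i ^+ 2.
Proof. by apply: eq_bigr => i _; rewrite expr2. Qed.

Lemma sq_ge0 x : 0 <= sq x.
Proof. by rewrite sqE sumr_ge0// => i _; exact: sqr_ge0. Qed.

Lemma enorm_sq x : enorm x ^+ 2 = sq x.
Proof. by rewrite /enorm sqr_sqrtr -?sqE ?sq_ge0. Qed.

Lemma sqB x y : sq (x - y) = sq x + sq y - 2 * dot x y.
Proof.
rewrite /sq /dot mulr_sumr -big_split/= -sumrB; apply: eq_bigr => i _.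
by rewrite !mxE; ring.
Qed.

Lemma sqD x y : sq (x + y) = sq x + sq y + 2 * dot x y.
Proof.
rewrite /sq /dot mulr_sumr -!big_split/=; apply: eq_bigr => i _.
by rewrite !mxE; ring.
Qed.

Lemma sqZ (a : R) x : sq (a *: x) = a ^+ 2 * sq x.
Proof.
rewrite /sq /dot mulr_sumr; apply: eq_bigr => i _.
by rewrite !mxE; ring.
Qed.

Lemma dotDl x y z : dot (x + y) z = dot x z + dot y z.
Proof.
by rewrite /dot -big_split/=; apply: eq_bigr => i _; rewrite !mxE mulrDl.
Qed.

Lemma dotZl (a : R) x y : dot (a *: x) y = a * dot x y.
Proof. by rewrite /dot mulr_sumr; apply: eq_bigr => i _; rewrite !mxE mulrA. Qed.

Lemma dotDr x y z : dot x (y + z) = dot x y + dot x z.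
Proof. by rewrite dotC dotDl !(dotC x). Qed.

Lemma dotZr (a : R) x y : dot x (a *: y) = a * dot x y.
Proof. by rewrite dotC dotZl dotC. Qed.

Lemma sqN x : sq (- x) = sq x.
Proof. by rewrite -scaleN1r sqZ sqrrN expr1n mul1r. Qed.

Lemma sqBC x y : sq (x - y) = sq (y - x).
Proof. by rewrite -opprB sqN. Qed.

(** Unnormalized Gaussian kernel of precision [a]. Negative [a] is used too: the kernel is then a
    growing weight, the inverse of the kernel of precision [- a]. *)
Definition gk (a : R) x y := expR (- (a / 2) * sq (x - y)).

Lemma gkC a x y : gk a x y = gk a y x.
Proof. by rewrite /gk sqBC. Qed.

Lemma gk_gt0 a x y : 0 < gk a x y.
Proof. exact: expR_gt0. Qed.

Lemma gk_ge0 a x y : 0 <= gk a x y.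
Proof. exact: expR_ge0. Qed.

Lemma gk_le1 a x y : 0 <= a -> gk a x y <= 1.
Proof.
move=> a0; rewrite -expR0 ler_expR mulNr oppr_le0 mulr_ge0 ?sq_ge0//.
by rewrite divr_ge0.
Qed.

(** Completing the square in [z]: precisions add, the centre is the weighted mean, and the factor
    free of [z] has the harmonic precision. *)
Lemma gk_mul a b x y z : 0 < a -> 0 < b ->
  gk a x z * gk b z y =
  gk (a * b / (a + b)) x y * gk (a + b) ((a + b)^-1 *: (a *: x + b *: y)) z.
Proof.
move=> a0 b0; rewrite /gk -!expRD; congr expR.
have ab : a + b != 0 by rewrite gt_eqF// addr_gt0.
rewrite !sqB !(sqZ, dotZl, sqD, dotDl, dotZr, dotC z).
by field.
Qed.

End vectors.

Section vector_measurability.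
Context {R : realType} (d : nat) d' (T : measurableType d').
Implicit Types f g : T -> 'rV[R]_d.

Lemma measurable_coord_comp f i : measurable_fun setT f ->
  measurable_fun setT (fun t => f t 0 i).
Proof. by move=> mf; apply: measurableT_comp (measurable_coord i) mf. Qed.

Lemma measurable_dot f g : measurable_fun setT f -> measurable_fun setT g ->
  measurable_fun setT (fun t => dot (f t) (g t)).
Proof.
move=> mf mg; apply: measurable_sum => i.
by apply: measurable_funM; exact: measurable_coord_comp.
Qed.

Lemma measurable_sqB f g : measurable_fun setT f -> measurable_fun setT g ->
  measurable_fun setT (fun t => sq (f t - g t)).
Proof.
move=> mf mg; under eq_fun do rewrite sqB.
apply: measurable_funB; last by apply: measurable_funM => //; exact: measurable_dot.
by apply: measurable_funD; exact: measurable_dot.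
Qed.

Lemma measurable_gk a f g : measurable_fun setT f -> measurable_fun setT g ->
  measurable_fun setT (fun t => gk a (f t) (g t)).
Proof.
move=> mf mg; apply: measurableT_comp => //; apply: measurable_funM => //.
exact: measurable_sqB.
Qed.

End vector_measurability.

Section gaussian_integrals.
Context {R : realType} (d : nat).
Implicit Types x y z : 'rV[R]_d.

(** The total mass of a Gaussian kernel of precision [a]. *)
Definition gc (a : R) : R := Num.sqrt (2 * pi / a) ^+ d.

Lemma gc_gt0 a : 0 < a -> 0 < gc a.
Proof.
by move=> a0; rewrite exprn_gt0// sqrtr_gt0 divr_gt0// mulr_gt0// pi_gt0.
Qed.

Lemma integral_gk a x : 0 < a ->
  (\int[lebesgue_row d]_z (gk a x z)%:E = (gc a)%:E)%E.
Proof.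
move=> a0; have s0 : (Num.sqrt a)^-1 != 0 :> R by rewrite invr_neq0// gt_eqF// sqrtr_gt0.
have E z : gk a x z =
    gc a * \prod_(i < d) normal_pdf (x 0 i) (Num.sqrt a)^-1 (z 0 i).
  under eq_bigr do rewrite normal_pdfE//.
  rewrite big_split/= /normal_peak /normal_fun prodr_const card_ord.
  have -> : (Num.sqrt a)^-1 ^+ 2 = a^-1 by rewrite exprVn sqr_sqrtr ?ltW.
  rewrite /gc.
  have -> : a^-1 * pi *+ 2 = 2 * pi / a by rewrite -mulr_natl; ring.
  rewrite mulrA exprVn mulfV ?mul1r; last by rewrite gt_eqF// gc_gt0.
  rewrite -expR_sum /gk; congr expR; rewrite sqE mulr_sumr; apply: eq_bigr => i _.
  rewrite !mxE -mulr_natl; field.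
  by rewrite gt_eqF.
under eq_integral do rewrite E EFinM.
have mp : measurable_fun setT (fun z : 'rV[R]_d =>
    \prod_(i < d) normal_pdf (x 0 i) (Num.sqrt a)^-1 (z 0 i)).
  apply: measurable_prod => i _.
  by apply: (measurableT_comp (measurable_normal_pdf _ _)); exact: measurable_coord.
have p0 (z : 'rV[R]_d) : 0 <= \prod_(i < d) normal_pdf (x 0 i) (Num.sqrt a)^-1 (z 0 i).
  by apply: prodr_ge0 => i _; exact: normal_pdf_ge0.
rewrite ge0_integralZl//; last 3 first.
- exact/measurable_EFinP.
- by move=> z _; rewrite lee_fin.
- by rewrite lee_fin ltW// gc_gt0.
rewrite (ge0_integral_pushforward (@measurable_row_of_tuple R d))//; last 2 first.
- exact/measurable_EFinP.
- by move=> z _; rewrite lee_fin.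
rewrite preimage_setT (_ : (\int[_]_z _)%E = 1%E) ?mule1//.
rewrite -[RHS](@integral_prod_meas1 _ _ _ (@lebesgue_measure R) d
  (fun i s => normal_pdf (x 0 i) (Num.sqrt a)^-1 s))//.
- apply: eq_integral => s _ /=; congr EFin.
  by apply: eq_bigr => i _; rewrite /row_of_tuple mxE.
- by move=> i; exact: measurable_normal_pdf.
- by move=> i y; exact: normal_pdf_ge0.
- by move=> i; exact: integral_normal_pdf.
Qed.

Lemma integrable_gk a x : 0 < a ->
  (lebesgue_row d).-integrable setT (EFin \o (gk a x)).
Proof.
move=> a0; apply/integrableP; split.
  by apply/measurable_EFinP; exact: measurable_gk.
under eq_integral do rewrite /= ger0_norm ?gk_ge0//.
by rewrite integral_gk// ltry.
Qed.

Lemma Rintegral_gk a x : 0 < a -> (\int[lebesgue_row d]_z gk a x z) = gc a.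
Proof. by move=> a0; rewrite /Rintegral integral_gk. Qed.

Lemma integral_gk_mul a b x y : 0 < a -> 0 < b ->
  \int[lebesgue_row d]_z (gk a x z * gk b z y) =
  gc (a + b) * gk (a * b / (a + b)) x y.
Proof.
move=> a0 b0; under eq_Rintegral do rewrite gk_mul//.
rewrite RintegralZl//; last by apply: integrable_gk; exact: addr_gt0.
by rewrite Rintegral_gk ?addr_gt0// mulrC.
Qed.

End gaussian_integrals.

(** * Gaussian smoothing of a signed measure *)

Section smoothing.
Context d (T : measurableType d) (R : realType) (n : nat).
Variables (mu : {finite_measure set T -> \bar R}) (X : T -> 'rV[R]_n) (B : R).
Hypotheses (mX : measurable_fun setT X) (XB : forall t, sq (X t) <= B).
Implicit Types (s : T -> R) (a b : R) (x y z : 'rV[R]_n).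

(** The smoothing at precision [a] of the image under [X] of the signed measure with density [s].
    Keeping [X] abstract lets the same lemmas serve one prior and a pair of priors. *)
Definition smooth s a z := \int[mu]_t (s t * gk a (X t) z).

Lemma bddm_gk a z : 0 <= a -> bddm (fun t => gk a (X t) z).
Proof.
move=> a0; split; first exact: measurable_gk.
by exists 1 => t; rewrite ger0_norm ?gk_ge0// gk_le1.
Qed.

Lemma measurable_gk_pair a : measurable_fun setT
  (fun p : 'rV[R]_n * T => gk a (X p.2) p.1).
Proof. by apply: measurable_gk => //; exact: measurableT_comp. Qed.

Let le_integral_dominated (f g : 'rV[R]_n -> R) : measurable_fun setT f ->
  (lebesgue_row n).-integrable setT (EFin \o g) ->
  (forall z, `|f z| <= g z) ->
  (\int[lebesgue_row n]_z `|f z|%:E <= (\int[lebesgue_row n]_z g z)%:E)%E.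
Proof.
move=> mf ig fg; rewrite EFin_Rintegral//; apply: ge0_le_integral => //.
- by apply/measurable_EFinP; exact: measurableT_comp.
- by case/integrableP : ig.
- by move=> z _; rewrite lee_fin.
Qed.

Section fubini.
Variables (s : T -> R) (a : R) (h g : 'rV[R]_n -> R).
Hypotheses (bs : bddm s) (a0 : 0 <= a) (mh : measurable_fun setT h).
Hypothesis ig : (lebesgue_row n).-integrable setT (EFin \o g).
Hypothesis hg : forall t z, `|gk a (X t) z * h z| <= g z.

Let G (p : 'rV[R]_n * T) := s p.2 * gk a (X p.2) p.1 * h p.1.

Let mG : measurable_fun setT G.
Proof.
apply: measurable_funM; last exact: measurableT_comp.
apply: measurable_funM; last exact: measurable_gk_pair.
by apply: measurableT_comp => //; case: bs.
Qed.

Let bG z : exists c, forall t, `|G (z, t)| <= c.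
Proof.
have [ms [c sc]] := bs; exists (c * g z) => t.
by rewrite /G/= -mulrA normrM ler_pM.
Qed.

Let GC : exists C, forall t, (\int[lebesgue_row n]_z `|G (z, t)|%:E <= C%:E)%E.
Proof.
have [ms [c sc]] := bs; exists (\int[lebesgue_row n]_z (c * g z)) => t.
apply: le_integral_dominated.
- exact: (measurableT_comp mG (pair2_measurable t)).
- exact: (integrableZl measurableT c ig).
- by move=> z; rewrite /G/= -mulrA normrM ler_pM.
Qed.

Let smoothE z : smooth s a z * h z = \int[mu]_t G (z, t).
Proof.
rewrite /smooth /G/= -RintegralZr//.
by apply: bddm_int; apply: bddmM => //; exact: bddm_gk.
Qed.

Let igk t : (lebesgue_row n).-integrable setT (EFin \o (fun z => gk a (X t) z * h z)).
Proof.
have mf : measurable_fun setT (fun z => gk a (X t) z * h z).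
  by apply: measurable_funM => //; exact: measurable_gk.
exact: (le_norm_Rintegral mf ig (hg t)).1.
Qed.

Lemma smooth_integrable :
  (lebesgue_row n).-integrable setT (EFin \o (fun z => smooth s a z * h z)).
Proof.
have [C GC'] := GC; under eq_fun do rewrite smoothE.
exact: (dominated_marginal_integrable mu mG bG GC').
Qed.

Lemma smooth_fubini_bddm :
  bddm (fun t => s t * \int[lebesgue_row n]_z (gk a (X t) z * h z)).
Proof.
have [C GC'] := GC; have := dominated_marginal_bddm mu mG GC'.
congr bddm; apply/funext => t; rewrite /G/= -RintegralZl//.
by apply: eq_Rintegral => z _; rewrite mulrA.
Qed.

(** Here [h] may grow at infinity, as long as one integrable [g] dominates its product with every
    kernel; a Gaussian weight of negative precision will be used this way. *)
Lemma smooth_fubini :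
  \int[lebesgue_row n]_z (smooth s a z * h z) =
  \int[mu]_t (s t * \int[lebesgue_row n]_z (gk a (X t) z * h z)).
Proof.
have [C GC'] := GC; under eq_Rintegral do rewrite smoothE.
rewrite -(dominated_fubini mu mG bG GC'); apply: eq_Rintegral => t _.
rewrite /G/= -RintegralZl//.
by apply: eq_Rintegral => z _; rewrite mulrA.
Qed.

End fubini.

(** Multiplied by [gk 1 0] the smoothing is integrable by Fubini, hence measurable; [gk (-1) 0] then
    undoes the multiplication. *)
Lemma measurable_smooth s a : bddm s -> 0 <= a -> measurable_fun setT (smooth s a).
Proof.
move=> bs a0; have mg1 : measurable_fun setT (gk 1 0 : 'rV[R]_n -> R).
  exact: measurable_gk.
have ig : (lebesgue_row n).-integrable setT (EFin \o (gk 1 (0 : 'rV[R]_n))).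
  by apply: integrable_gk; exact: ltr01.
have := @smooth_integrable s a (gk 1 0) (gk 1 0) bs a0 mg1 ig.
case/(_ _)/integrableP => [t z|/measurable_EFinP m _].
  by rewrite ger0_norm ?mulr_ge0 ?gk_ge0// ler_piMl ?gk_ge0 ?gk_le1.
rewrite (_ : smooth s a = (fun z => smooth s a z * gk 1 0 z * gk (-1) 0 z)).
  by apply: measurable_funM => //; exact: measurable_gk.
apply/funext => z; rewrite -mulrA /gk -expRD -mulrDl.
by rewrite (_ : _ + _ = 0) ?mul0r ?expR0 ?mulr1//; lra.
Qed.

(** The semigroup property: variances add under successive smoothing, so the precisions [a] and [b]
    combine into [a * b / (a + b)]. *)
Lemma smooth_conv s a b y : bddm s -> 0 < a -> 0 < b ->
  smooth s (a * b / (a + b)) y * gc n (a + b) =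
  \int[lebesgue_row n]_z (smooth s a z * gk b z y).
Proof.
move=> bs a0 b0.
rewrite (@smooth_fubini s a (fun z => gk b z y) (gk b y))//.
- under [in RHS]eq_Rintegral do rewrite integral_gk_mul// mulrCA mulrC.
  rewrite /smooth -RintegralZr//.
  by apply: bddm_int; apply: bddmM => //; apply: bddm_gk; rewrite divr_ge0 ?mulr_ge0 ?addr_ge0 ?ltW.
- exact: ltW.
- exact: measurable_gk.
- exact: integrable_gk.
- move=> t z; rewrite ger0_norm ?mulr_ge0 ?gk_ge0// (gkC b y).
  by rewrite ler_piMl ?gk_ge0 ?gk_le1 ?ltW.
Qed.

Lemma smooth_gk_integrable s a b y : bddm s -> 0 <= a -> 0 < b ->
  (lebesgue_row n).-integrable setT (EFin \o (fun z => smooth s a z * gk b z y)).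
Proof.
move=> bs a0 b0; apply: (@smooth_integrable s a (fun z => gk b z y) (gk b y)) => //.
- exact: measurable_gk.
- exact: integrable_gk.
- move=> t z; rewrite ger0_norm ?mulr_ge0 ?gk_ge0// (gkC b y).
  by rewrite ler_piMl ?gk_ge0 ?gk_le1.
Qed.

Lemma integrable_smooth s a : bddm s -> 0 < a ->
  (lebesgue_row n).-integrable setT (EFin \o smooth s a).
Proof.
move=> bs a0; rewrite (_ : smooth s a = fun z => smooth s a z * 1); last first.
  by apply/funext => z; rewrite mulr1.
pose h (z : 'rV[R]_n) := expR (a * B / 2) * gk (a / 2) 0 z.
apply: (@smooth_integrable s a (cst 1) h) => //; first exact: ltW.
- have ig : (lebesgue_row n).-integrable setT (EFin \o (gk (a / 2) (0 : 'rV[R]_n))).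
    by apply: integrable_gk; rewrite divr_gt0.
  exact: (integrableZl measurableT (expR (a * B / 2)) ig).
- move=> t z; rewrite mulr1 ger0_norm ?gk_ge0// /h /gk -expRD ler_expR.
  rewrite sub0r sqN sqB.
  (* This square gives |X - z|^2 >= |z|^2 / 2 - |X|^2, a Gaussian bound that is uniform in [t]. *)
  have : 0 <= sq (z - 2 *: X t) by exact: sq_ge0.
  rewrite sqB sqZ dotZr (dotC z) => H; have Bt := XB t.
  have : 0 <= a * (sq z + 2 ^+ 2 * sq (X t) - 2 * (2 * dot (X t) z)) by rewrite mulr_ge0// ltW.
  have : 0 <= a * (B - sq (X t)) by rewrite mulr_ge0 ?subr_ge0// ltW.
  nra.
Qed.

End smoothing.

(** * Energies of exponential kernels *)

Section exponential_series.
Context {R : realType}.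
Implicit Types x b : R.

Lemma cvg_series_exp_coeff x : series (exp_coeff x) @ \oo --> expR x.
Proof. exact: is_cvg_series_exp_coeff. Qed.

(** The terms beyond [m] are compared one by one with those at [b]; this makes the exponential
    series converge uniformly on bounded sets. *)
Lemma expR_tail x b m : `|x| <= b ->
  `|expR x - series (exp_coeff x) m| <= expR b - series (exp_coeff b) m.
Proof.
move=> xb; pose L k := `|series (exp_coeff x) k - series (exp_coeff x) m|.
pose U k := series (exp_coeff b) k - series (exp_coeff b) m.
have cL : L @ \oo --> `|expR x - series (exp_coeff x) m|.
  by apply: cvg_norm; apply: cvgB; [exact: cvg_series_exp_coeff|exact: cvg_cst].
have cU : U @ \oo --> expR b - series (exp_coeff b) m.
  by apply: cvgB; [exact: cvg_series_exp_coeff|exact: cvg_cst].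
apply: (ler_cvg_to cL cU).
near=> k; have mk : (m <= k)%N by near: k; exact: nbhs_infty_ge.
rewrite /L /U !sub_series_geq//; apply: (le_trans (ler_norm_sum _ _ _)).
apply: ler_sum => j _; rewrite /exp_coeff/= normrM normrX normfV.
by rewrite normr_nat ler_wpM2r ?invr_ge0 ?ler0n// lerXn2r ?nnegrE ?(le_trans _ xb).
Unshelve. all: by end_near. Qed.

End exponential_series.

Section double_integral.
Context d (T : measurableType d) (R : realType).
Variables (mu : {finite_measure set T -> \bar R}).
Implicit Types (H : T * T -> R) (f : T -> R).

Definition dint H := \int[mu]_t \int[mu]_z H (z, t).

Lemma bddm_fst f : bddm f -> bddm (fun p : T * T => f p.1).
Proof. exact: bddm_comp measurable_fst. Qed.

Lemma bddm_snd f : bddm f -> bddm (fun p : T * T => f p.2).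
Proof. exact: bddm_comp measurable_snd. Qed.

Lemma bddm_sec H t : bddm H -> bddm (fun z => H (z, t)).
Proof. exact: bddm_comp (pair2_measurable t). Qed.

Lemma bddm_marginal H : bddm H -> bddm (fun t => \int[mu]_z H (z, t)).
Proof.
move=> bH; have [mH [c Hc]] := bH; apply: (dominated_marginal_bddm mu mH) => t.
apply: (@le_trans _ _ (\int[mu]_z (cst c%:E z))%E); last first.
  by rewrite integral_cst//= -[X in (_ * X)%E]fineK ?fin_num_measure// -EFinM.
apply: ge0_le_integral => //.
- apply/measurable_EFinP; apply: measurableT_comp => //.
  exact: (bddm_sec t bH).1.
- by move=> z _; rewrite lee_fin.
Qed.

Lemma dintD H1 H2 : bddm H1 -> bddm H2 ->
  dint (fun p => H1 p + H2 p) = dint H1 + dint H2.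
Proof.
move=> b1 b2; rewrite /dint -RintegralD//; last 2 first.
- by apply: bddm_int; exact: bddm_marginal.
- by apply: bddm_int; exact: bddm_marginal.
apply: eq_Rintegral => t _; rewrite RintegralD//.
- by apply: bddm_int; exact: bddm_sec.
- by apply: bddm_int; exact: bddm_sec.
Qed.

Lemma dintZ k H : bddm H -> dint (fun p => k * H p) = k * dint H.
Proof.
move=> bH; rewrite /dint -RintegralZl//; last by apply: bddm_int; exact: bddm_marginal.
apply: eq_Rintegral => t _; rewrite RintegralZl//.
by apply: bddm_int; exact: bddm_sec.
Qed.

Lemma dintB H1 H2 : bddm H1 -> bddm H2 ->
  dint (fun p => H1 p - H2 p) = dint H1 - dint H2.
Proof.
move=> b1 b2; transitivity (dint (fun p => H1 p + (-1) * H2 p)).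
  by congr dint; apply/funext => p; rewrite mulN1r.
by rewrite (dintD b1 (bddmZ (-1) b2)) (dintZ (-1) b2) mulN1r.
Qed.

Lemma dint_sum (I : Type) (r : seq I) (F : I -> T * T -> R) :
  (forall i, bddm (F i)) ->
  dint (fun p => \sum_(i <- r) F i p) = \sum_(i <- r) dint (F i).
Proof.
move=> bF; elim: r => [|i r IH].
  rewrite big_nil -[RHS](mul0r (dint (fun=> 0))) -dintZ; last exact: bddm_cst.
  by congr dint; apply/funext => p; rewrite big_nil mul0r.
rewrite big_cons -IH -(dintD (bF i) (bddm_sum r bF)).
by congr dint; apply/funext => p; rewrite big_cons.
Qed.

Lemma norm_dint_le H c : bddm H -> (forall p, `|H p| <= c) ->
  `|dint H| <= c * fine (mu setT) ^+ 2.
Proof.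
move=> bH Hc; rewrite expr2 mulrA; apply: norm_Rintegral_le.
- exact: fin_measureT.
- exact: (bddm_marginal bH).1.
- move=> t; apply: norm_Rintegral_le => //; first exact: fin_measureT.
  exact: (bddm_sec t bH).1.
Qed.

Lemma dint_prod f : bddm f -> dint (fun p => f p.1 * f p.2) = (\int[mu]_t f t) ^+ 2.
Proof.
move=> bf; have i := bddm_int mu bf; rewrite expr2.
rewrite -[RHS](RintegralZl (\int[mu]_t f t) measurableT i).
apply: eq_Rintegral => t _.
by rewrite -[RHS](RintegralZr (f t) measurableT i).
Qed.

End double_integral.

Section energy.
Context d (T : measurableType d) (R : realType) (n : nat).
Variables (mu : {finite_measure set T -> \bar R}) (X : T -> 'rV[R]_n) (B : R).
Hypotheses (mX : measurable_fun setT X) (XB : forall t, sq (X t) <= B).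
Implicit Types (s : T -> R) (K : R -> R).

(** Words ['I_j -> 'I_n] rather than multi-indices: the j-th power of the inner product then expands
    without multinomial coefficients. *)
Definition monomial j (w : {ffun 'I_j -> 'I_n}) (x : 'rV[R]_n) := \prod_i x 0 (w i).

Lemma dot_expn (x y : 'rV[R]_n) j :
  dot x y ^+ j = \sum_(w : {ffun 'I_j -> 'I_n}) monomial w x * monomial w y.
Proof.
rewrite /dot -[in LHS](card_ord j) -prodr_const (bigA_distr_bigA (fun _ i => x 0 i * y 0 i)).
by apply: eq_bigr => w _; rewrite -big_split.
Qed.

Lemma norm_dot_le (x y : 'rV[R]_n) : `|dot x y| <= (sq x + sq y) / 2.
Proof.
have := sq_ge0 (x - y); have := sq_ge0 (x + y); rewrite sqB sqD => h1 h2.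
by rewrite ler_norml; apply/andP; split; lra.
Qed.

Lemma norm_dotX_le t t' : `|dot (X t) (X t')| <= B.
Proof.
apply: le_trans (norm_dot_le _ _) _; have := XB t; have := XB t'; lra.
Qed.

Lemma bddm_coord i : bddm (fun t => X t 0 i).
Proof.
split; first exact: measurable_coord_comp.
exists (B + 1) => t; have : `|X t 0 i| ^+ 2 <= B.
  rewrite real_normK ?num_real// (le_trans _ (XB t))// sqE (bigD1 i)//= lerDl.
  by apply: sumr_ge0 => j _; exact: sqr_ge0.
have := normr_ge0 (X t 0 i); nra.
Qed.

Lemma bddm_monomial j (w : {ffun 'I_j -> 'I_n}) : bddm (fun t => monomial w (X t)).
Proof.
rewrite /monomial; elim: (index_enum _) => [|i r IH].
  by under eq_fun do rewrite big_nil; exact: bddm_cst.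
under eq_fun do rewrite big_cons; apply: bddmM => //; exact: bddm_coord.
Qed.

Lemma bddm_dot : bddm (fun p : T * T => dot (X p.1) (X p.2)).
Proof.
split; first by apply: measurable_dot; exact: measurableT_comp.
by exists B => p; exact: norm_dotX_le.
Qed.

Definition energy s K := dint mu (fun p => s p.1 * s p.2 * K (dot (X p.1) (X p.2))).

Definition moment s j (w : {ffun 'I_j -> 'I_n}) := \int[mu]_t (s t * monomial w (X t)).

(** The expansion into words separates the two variables, so each term is the square of a moment.
    The positivity of these coefficients is what the interpolation rests on. *)
Lemma energy_expn s j : bddm s ->
  energy s (fun t => t ^+ j) = \sum_(w : {ffun 'I_j -> 'I_n}) moment s w ^+ 2.
Proof.
move=> bs; rewrite /energy /moment.
pose F (w : {ffun 'I_j -> 'I_n}) t := s t * monomial w (X t).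
have bF w : bddm (F w) by apply: bddmM => //; exact: bddm_monomial.
transitivity (dint mu (fun p => \sum_w F w p.1 * F w p.2)).
  congr dint; apply/funext => p; rewrite dot_expn mulr_sumr; apply: eq_bigr => w _.
  by rewrite mulrACA.
rewrite dint_sum => [|w]; last by apply: bddmM; [exact: bddm_fst|exact: bddm_snd].
by apply: eq_bigr => w _; rewrite dint_prod.
Qed.

Lemma energy_expn_ge0 s j : bddm s -> 0 <= energy s (fun t => t ^+ j).
Proof.
by move=> bs; rewrite energy_expn// sumr_ge0// => w _; exact: sqr_ge0.
Qed.

Lemma bddm_weight s K : bddm s -> bddm (fun p : T * T => K (dot (X p.1) (X p.2))) ->
  bddm (fun p : T * T => s p.1 * s p.2 * K (dot (X p.1) (X p.2))).
Proof.
by move=> bs bK; apply: bddmM => //; apply: bddmM; [exact: bddm_fst|exact: bddm_snd].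
Qed.

(** Termwise integration: inner products are bounded by [B], so the remainder is at most a constant
    times that of the exponential series at |u| |B|. The shift [a] is 0 for exponential energies and
    1 for the kernel t exp(u t) coming from first moments. *)
Lemma energy_expR_cvg s a u : bddm s ->
  \sum_(0 <= j < m) u ^+ j / j`!%:R * energy s (fun t => t ^+ (j + a)) @[m --> \oo]
  --> energy s (fun t => t ^+ a * expR (u * t)).
Proof.
move=> bs; have [ms [c sc]] := bs; have bdot := bddm_dot.
pose S m x := \sum_(0 <= j < m) u ^+ j / j`!%:R * x ^+ (j + a).
have SE m x : S m x = x ^+ a * series (exp_coeff (u * x)) m.
  rewrite /S seriesEnat/= mulr_sumr; apply: eq_bigr => j _.
  by rewrite /exp_coeff/= exprD exprMn; ring.
have bS m : bddm (fun p : T * T => S m (dot (X p.1) (X p.2))).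
  by apply: bddm_sum => j; apply: bddmZ; exact: bddmX.
have bE : bddm (fun p : T * T => (fun t => t ^+ a * expR (u * t)) (dot (X p.1) (X p.2))).
  by apply: bddmM; [exact: bddmX|apply: bddm_expR; exact: bddmZ].
have ES m : \sum_(0 <= j < m) u ^+ j / j`!%:R * energy s (fun t => t ^+ (j + a)) =
    energy s (S m).
  pose F j (p : T * T) := u ^+ j / j`!%:R *
    (s p.1 * s p.2 * dot (X p.1) (X p.2) ^+ (j + a)).
  have bW j := bddm_weight (K := fun x => x ^+ (j + a)) bs (bddmX (j + a) bdot).
  transitivity (\sum_(0 <= j < m) dint mu (F j)).
    by apply: eq_bigr => j _; exact: (esym (dintZ mu _ (bW j))).
  rewrite -dint_sum => [|j]; last exact: bddmZ.
  congr dint; apply/funext => p; rewrite mulr_sumr; apply: eq_bigr => j _.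
  by rewrite /F mulrCA.
rewrite (eq_cvg _ _ ES).
pose D := c ^+ 2 * `|B| ^+ a * fine (mu setT) ^+ 2.
pose b := `|u| * `|B|.
have bnd m : `|energy s (S m) - energy s (fun t => t ^+ a * expR (u * t))| <=
    D * (expR b - series (exp_coeff b) m).
  have bWE := bddm_weight (K := fun t => t ^+ a * expR (u * t)) bs bE.
  have bWS := bddm_weight (K := S m) bs (bS m).
  rewrite distrC /energy -(dintB mu bWE bWS).
  set H := (X in dint mu X).
  have bH : bddm H by exact: bddmB.
  suff : forall p, `|H p| <= c ^+ 2 * `|B| ^+ a * (expR b - series (exp_coeff b) m).
    by move=> /(norm_dint_le mu bH); rewrite /D mulrAC.
  move=> p; rewrite /H -mulrBr SE -mulrBr !normrM mulrA.
  have dB : `|dot (X p.1) (X p.2)| <= `|B|.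
    by rewrite (le_trans (norm_dotX_le _ _))// ler_norm.
  apply: ler_pM => //.
    rewrite expr2 normrX; apply: ler_pM => //; first exact: ler_pM.
    by rewrite lerXn2r ?nnegrE.
  by apply: expR_tail; rewrite normrM ler_wpM2l.
apply/cvgrPdist_le => e e0.
have : D * (expR b - series (exp_coeff b) m) @[m --> \oo] --> D * (expR b - expR b).
  by apply: cvgMl_tmp; apply: cvgB; [exact: cvg_cst|exact: cvg_series_exp_coeff].
rewrite subrr mulr0.
move=> /cvgrPdist_le/(_ e e0); apply: filterS => m; rewrite sub0r normrN => h.
by rewrite distrC (le_trans (bnd m))// (le_trans _ h)// ler_norm.
Qed.

End energy.

Lemma bernoulli_8_7 (R : realFieldType) j : 1 + j%:R / 7 <= (8 / 7 : R) ^+ j.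
Proof.
elim: j => [|j IH]; first by rewrite expr0 mul0r addr0.
have j0 : 0 <= j%:R :> R by rewrite ler0n.
by rewrite exprS -natr1; nra.
Qed.

Section exponential_energy.
Context d (T : measurableType d) (R : realType) (n : nat).
Variables (mu : {finite_measure set T -> \bar R}) (X : T -> 'rV[R]_n) (B : R).
Hypotheses (mX : measurable_fun setT X) (XB : forall t, sq (X t) <= B).
Variable s : T -> R.
Hypothesis bs : bddm s.

Definition exp_energy f u := energy mu X f (fun t => expR (u * t)).

Let E j := energy mu X s (fun t => t ^+ j).

Let E_ge0 j : 0 <= E j. Proof. exact: (energy_expn_ge0 mu mX XB j bs). Qed.

Let psum u m := \sum_(0 <= j < m) u ^+ j / j`!%:R * E j.

Let psum_term_le (c u v : R) j : u ^+ j <= c * v ^+ j ->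
  u ^+ j / j`!%:R * E j <= c * (v ^+ j / j`!%:R * E j).
Proof.
move=> h; rewrite !mulrA ler_wpM2r// ler_wpM2r// invr_ge0 ler0n//.
Qed.

Let term_ge0 u j : 0 <= u -> 0 <= u ^+ j / j`!%:R * E j.
Proof. by move=> u0; rewrite !mulr_ge0 ?invr_ge0 ?exprn_ge0. Qed.

Let psum_ge0 u m : 0 <= u -> 0 <= psum u m.
Proof. by move=> u0; apply: sumr_ge0 => j _; exact: term_ge0. Qed.

Let psum_mono u : 0 <= u -> nondecreasing_seq (psum u).
Proof.
move=> u0 m m' mm'; rewrite /psum (big_cat_nat (leq0n m) mm')//= lerDl.
by apply: sumr_ge0 => j _; exact: term_ge0.
Qed.

Let psum_cvg u : psum u m @[m --> \oo] --> exp_energy s u.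
Proof.
have := energy_expR_cvg (mu := mu) (a := 0) (u := u) mX XB bs.
rewrite (_ : (fun m => _) = psum u); last first.
  by apply/funext => m; apply: eq_bigr => j _; rewrite addn0.
by congr (_ --> energy _ _ _ _); apply/funext => t; rewrite expr0 mul1r.
Qed.

Lemma exp_partial_le u m : 0 <= u ->
  \sum_(0 <= j < m) u ^+ j / j`!%:R * energy mu X s (fun t => t ^+ j) <= exp_energy s u.
Proof.
move=> u0; have cc : psum u m @[_ --> \oo] --> psum u m by exact: cvg_cst.
change (psum u m <= exp_energy s u); apply: (ler_cvg_to cc (psum_cvg (u := u))).
by near=> k; apply: psum_mono => //; near: k; exact: nbhs_infty_ge.
Unshelve. all: by end_near. Qed.

Lemma exp_energy_ge0 u : 0 <= u -> 0 <= exp_energy s u.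
Proof. by move=> u0; rewrite (le_trans _ (exp_partial_le 0 u0))// big_geq. Qed.

Lemma exp_energy_mono u v : 0 <= u -> u <= v -> exp_energy s u <= exp_energy s v.
Proof.
move=> u0 uv; apply: (ler_cvg_to (psum_cvg (u := u)) (psum_cvg (u := v))).
near=> k; apply: ler_sum => j _; rewrite -[leRHS]mul1r; apply: psum_term_le.
by rewrite mul1r lerXn2r ?nnegrE ?(le_trans u0).
Unshelve. all: by end_near. Qed.

(** From degree [k] on, u^j <= (u/v)^k v^j. The head is kept as it is, since it is bounded in two
    ways: by an energy at a smaller argument, and by differences of discretized moments. *)
Lemma exp_energy_split u v k : 0 < u -> u <= v ->
  exp_energy s u <=
    \sum_(0 <= j < k) u ^+ j / j`!%:R * energy mu X s (fun t => t ^+ j) +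
    (u / v) ^+ k * exp_energy s v.
Proof.
move=> u0 uv; have v0 : 0 < v := lt_le_trans u0 uv.
have cv : psum u k + (u / v) ^+ k * psum v m @[m --> \oo] -->
    psum u k + (u / v) ^+ k * exp_energy s v.
  by apply: cvgD; [exact: cvg_cst|apply: cvgMl_tmp; exact: psum_cvg].
apply: (ler_cvg_to (psum_cvg (u := u)) cv).
near=> m; have km : (k <= m)%N by near: m; exact: nbhs_infty_ge.
rewrite {1}/psum (big_cat_nat (leq0n k) km)//= lerD2l.
apply: (@le_trans _ _ ((u / v) ^+ k * \sum_(k <= j < m) v ^+ j / j`!%:R * E j)).
  rewrite mulr_sumr big_nat_cond [leRHS]big_nat_cond.
  apply: ler_sum => j /andP[/andP[kj _] _]; apply: psum_term_le.
  have -> : u ^+ j = (u / v) ^+ j * v ^+ j.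
    by rewrite -exprMn divfK// gt_eqF.
  rewrite ler_wpM2r ?exprn_ge0 ?(ltW v0)// ler_wiXn2l//.
    by rewrite divr_ge0 ?ltW.
  by rewrite ler_pdivrMr// mul1r.
rewrite ler_wpM2l//; first by rewrite exprn_ge0// divr_ge0 ?ltW.
rewrite /psum [leRHS](big_cat_nat (leq0n k) km)//= lerDr.
by apply: psum_ge0; rewrite ltW.
Unshelve. all: by end_near. Qed.

(** Below degree [k], u^j <= (u/u0)^k u0^j because u0 <= u; the rest is [exp_energy_split]. *)
Lemma exp_energy_interp u0 u v k : 0 < u0 -> u0 <= u -> u <= v ->
  exp_energy s u <= (u / u0) ^+ k * exp_energy s u0 + (u / v) ^+ k * exp_energy s v.
Proof.
move=> u00 u0u uv; have u_gt0 : 0 < u := lt_le_trans u00 u0u.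
apply: (le_trans (exp_energy_split k u_gt0 uv)); rewrite lerD2r.
apply: (@le_trans _ _ ((u / u0) ^+ k * psum u0 k)); last first.
  rewrite ler_wpM2l ?exprn_ge0 ?divr_ge0 ?(ltW u00) ?(ltW u_gt0)//.
  by apply: exp_partial_le; exact: ltW.
rewrite /psum mulr_sumr big_nat_cond [leRHS]big_nat_cond.
apply: ler_sum => j /andP[/andP[_ jk] _]; apply: psum_term_le.
have -> : u ^+ j = (u / u0) ^+ j * u0 ^+ j by rewrite -exprMn divfK// gt_eqF.
rewrite ler_wpM2r ?exprn_ge0 ?(ltW u00)// ler_weXn2l//; last exact: ltnW.
by rewrite ler_pdivlMr// mul1r.
Qed.

(** The factor t shifts the series by one. The coefficient of degree m = j + 1 gains 7 (8/7)^m / m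
    when 7/5 is raised to 8/5 and the factor 5 is included, and by Bernoulli's inequality this gain
    is at least 1. *)
Lemma energy_mul_expR_le :
  energy mu X s (fun t => t * expR (7 / 5 * t)) <= 5 * exp_energy s (8 / 5).
Proof.
have cv := energy_expR_cvg (mu := mu) (a := 1) (u := 7 / 5) mX XB bs.
have cv8 : 5 * psum (8 / 5) m.+1 @[m --> \oo] --> 5 * exp_energy s (8 / 5).
  by apply: cvgMl_tmp; rewrite (@cvg_shiftS _ (psum (8 / 5))); exact: psum_cvg.
have -> : (fun t : R => t * expR (7 / 5 * t)) = (fun t => t ^+ 1 * expR (7 / 5 * t)).
  by apply/funext => t; rewrite expr1.
apply: (ler_cvg_to cv cv8).
near=> m; rewrite /psum big_nat_recl// mulrDr.
apply: (@le_trans _ _ (5 * \sum_(0 <= i < m) (8 / 5) ^+ i.+1 / (i.+1)`!%:R * E i.+1)).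
  rewrite mulr_sumr; apply: ler_sum => j _; rewrite addn1 mulrA.
  rewrite ler_wpM2r//; first exact: E_ge0.
  have j0 : 0 < j.+1%:R :> R by rewrite ltr0n.
  have -> : 5 * ((8 / 5) ^+ j.+1 / (j.+1)`!%:R) =
      7 * (8 / 7) ^+ j.+1 / j.+1%:R * ((7 / 5) ^+ j / j`!%:R) :> R.
    rewrite (_ : 8 / 5 = 8 / 7 * (7 / 5)); last by field.
    rewrite exprMn [(7 / 5) ^+ j.+1]exprS factS natrM.
    have f0 : j`!%:R != 0 :> R by rewrite pnatr_eq0 -lt0n fact_gt0.
    move: (lt0r_neq0 j0) f0 ((8 / 7) ^+ j.+1) ((7 / 5) ^+ j).
    by move: (j.+1%:R) (j`!%:R) => a b a0 b0 p q; field; rewrite a0 b0.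
  rewrite ler_peMl ?divr_ge0 ?exprn_ge0// ler_pdivlMr// mul1r.
  by have := bernoulli_8_7 R j.+1; lra.
rewrite lerDr mulr_ge0//.
by rewrite expr0 mul1r mulr_ge0 ?invr_ge0.
Unshelve. all: by end_near. Qed.

Lemma exp_energy_le c u : 0 <= u -> (forall t, `|s t| <= c) ->
  exp_energy s u <= c ^+ 2 * expR (u * B) * fine (mu setT) ^+ 2.
Proof.
move=> u0 sc; apply: (le_trans (ler_norm _)).
have bW : bddm (fun p : T * T => s p.1 * s p.2 * expR (u * dot (X p.1) (X p.2))).
  apply: (bddm_weight (K := fun x => expR (u * x)) bs).
  by apply: bddm_expR; apply: bddmZ; exact: bddm_dot mX XB.
apply: (norm_dint_le mu bW) => p; rewrite !normrM.
apply: ler_pM => //; first by rewrite expr2 ler_pM.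
rewrite ger0_norm ?expR_ge0// ler_expR ler_wpM2l//.
by apply: le_trans (ler_norm _) _; exact: norm_dotX_le.
Qed.

(** The coordinate weights of the first moments recombine into an inner product, which puts all
    first-moment energies into a single kernel t exp(u t). *)
Lemma sum_exp_energy_coord u :
  \sum_i exp_energy (fun t => s t * X t 0 i) u =
  energy mu X s (fun t => t * expR (u * t)).
Proof.
rewrite /exp_energy /energy -dint_sum => [|i]; last first.
  apply: bddmM; last by apply: bddm_expR; apply: bddmZ; exact: bddm_dot mX XB.
  have b := bddmM bs (bddm_coord mX XB i).
  by apply: bddmM; [exact: (bddm_fst b)|exact: (bddm_snd b)].
congr dint; apply/funext => p; rewrite {3}/dot mulr_suml mulr_sumr.
by apply: eq_bigr => i _; ring.
Qed.

End exponential_energy.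

Lemma sqr_mul_gk (R : realType) n (a b D : R) (x y : 'rV[R]_n) : b = 2 * a ->
  (D * gk a x y) ^+ 2 = D ^+ 2 * gk b x y.
Proof.
move=> ->; rewrite exprMn [in LHS](expr2 (gk _ _ _)) /gk -expRD; congr (_ * expR _).
by field.
Qed.

(** * Smoothings at precision one and energies *)

Section kernel_bounds.
Context d (T : measurableType d) (R : realType) (n : nat).
Variables (mu : {finite_measure set T -> \bar R}) (X : T -> 'rV[R]_n) (B : R).
Hypotheses (mX : measurable_fun setT X) (XB : forall t, sq (X t) <= B).
Implicit Types s : T -> R.

(** The factor exp(-|t|^2 / 5) left over by completing squares. The precisions are chosen so that
    the same factor appears in the pointwise upper bound and in the L1 lower bound, which makes both
    of them energies of one measure. *)
Definition tilt s t := s t * gk (2 / 5) (X t) 0.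

Lemma bddm_tilt s : bddm s -> bddm (tilt s).
Proof. by move=> bs; apply: bddmM => //; apply: bddm_gk. Qed.

Let gk95_le t z : gk (9 / 5) (X t) z <= expR (9 / 10 * B) * gk (9 / 10) 0 z.
Proof.
rewrite /gk -expRD ler_expR sub0r sqN sqB; have Bt := XB t.
have := sq_ge0 (z - 2 *: X t); rewrite sqB sqZ dotZr (dotC z) => H; lra.
Qed.

(* With this Gaussian weight the integral over [z] of the product of two kernels
   is a tilted exponential kernel, so the left-hand side is an energy. *)
Lemma integral_smooth_sqr s : bddm s ->
  (lebesgue_row n).-integrable setT
    (EFin \o (fun z => smooth mu X s (9 / 5) z ^+ 2 * gk (- (9 / 7)) z 0)) /\
  \int[lebesgue_row n]_z (smooth mu X s (9 / 5) z ^+ 2 * gk (- (9 / 7)) z 0) =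
  gc n (81 / 35) * exp_energy mu X (tilt s) (7 / 5).
Proof.
move=> bs; have [ms [c sc]] := bs.
have a0 : 0 <= 9 / 5 :> R by rewrite divr_ge0.
set D := smooth mu X s (9 / 5).
have mD : measurable_fun setT D by exact: measurable_smooth.
have mw : measurable_fun setT (fun z : 'rV[R]_n => gk (- (9 / 7)) z 0).
  exact: measurable_gk.
pose K := expR (9 / 10 * B).
have gauss t t' z : gk (9 / 5) (X t) z * (gk (9 / 5) (X t') z * gk (- (9 / 7)) z 0)
    <= K * K * gk (18 / 35) 0 z.
  have E : gk (9 / 10) 0 z * (gk (9 / 10) 0 z * gk (- (9 / 7)) z 0) = gk (18 / 35) 0 z.
    by rewrite /gk -!expRD; congr expR; rewrite sub0r subr0 sqN; lra.
  rewrite -E mulrA [leRHS](_ : _ = (K * gk (9 / 10) 0 z) *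
    (K * gk (9 / 10) 0 z) * gk (- (9 / 7)) z 0); last by ring.
  rewrite ler_wpM2r ?gk_ge0//; apply: ler_pM; rewrite ?gk_ge0//; exact: gk95_le.
have ig (L : R) : (lebesgue_row n).-integrable setT
    (EFin \o (fun z => L * gk (18 / 35) 0 z)).
  have i : (lebesgue_row n).-integrable setT (EFin \o gk (18 / 35) (0 : 'rV[R]_n)).
    by apply: integrable_gk; rewrite divr_gt0.
  exact: (integrableZl measurableT L i).
have Dbound z : `|D z * gk (- (9 / 7)) z 0| <= c * fine (mu setT) * (K * gk (9 / 10) 0 z * gk (- (9 / 7)) z 0).
  rewrite normrM (ger0_norm (gk_ge0 _ _ _)) mulrA ler_wpM2r ?gk_ge0//.
  rewrite mulrAC; apply: norm_Rintegral_le.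
  - exact: fin_measureT.
  - by apply: measurable_funM => //; exact: measurable_gk.
  - move=> t; rewrite normrM (ger0_norm (gk_ge0 _ _ _)).
    by apply: ler_pM; rewrite ?gk_ge0//; exact: gk95_le.
have fub1 t z : `|gk (9 / 5) (X t) z * (D z * gk (- (9 / 7)) z 0)| <=
    c * fine (mu setT) * K * K * gk (18 / 35) 0 z.
  rewrite normrM (ger0_norm (gk_ge0 _ _ _)).
  apply: (le_trans (ler_pM _ _ (gk95_le t z) (Dbound z))); rewrite ?gk_ge0//.
  rewrite [gk (18 / 35) 0 z](_ : _ = gk (9 / 10) 0 z * (gk (9 / 10) 0 z * gk (- (9 / 7)) z 0)).
    by rewrite le_eqVlt; apply/orP; left; apply/eqP; rewrite -/K; ring.
  by rewrite /gk -!expRD; congr expR; rewrite sub0r subr0 sqN; lra.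
have E z : D z ^+ 2 * gk (- (9 / 7)) z 0 = D z * (D z * gk (- (9 / 7)) z 0).
  by rewrite expr2 mulrA.
under eq_fun do rewrite E.
have mh : measurable_fun setT (fun z => D z * gk (- (9 / 7)) z 0).
  exact: measurable_funM.
split; first exact: (smooth_integrable mu mX bs a0 mh (ig _) fub1).
rewrite (smooth_fubini mu mX bs a0 mh (ig _) fub1) /exp_energy /energy /dint.
have be : bddm (fun p : T * T => tilt s p.1 * tilt s p.2 * expR (7 / 5 * dot (X p.1) (X p.2))).
  apply: (bddm_weight (K := fun x => expR (7 / 5 * x)) (bddm_tilt bs)).
  by apply: bddm_expR; apply: bddmZ; exact: (bddm_dot mX XB).
have ie := bddm_int mu (bddm_marginal mu be).
rewrite -[RHS](RintegralZl (gc n (81 / 35)) measurableT ie).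
apply: eq_Rintegral => t _.
have mh2 : measurable_fun setT (fun z => gk (9 / 5) (X t) z * gk (- (9 / 7)) z 0).
  by apply: measurable_funM => //; exact: measurable_gk.
have fub2 t' z : `|gk (9 / 5) (X t') z * (gk (9 / 5) (X t) z * gk (- (9 / 7)) z 0)| <=
    K * K * gk (18 / 35) 0 z.
  by rewrite ger0_norm ?mulr_ge0 ?gk_ge0//; exact: gauss.
have -> : \int[lebesgue_row n]_z (gk (9 / 5) (X t) z * (D z * gk (- (9 / 7)) z 0)) =
    \int[lebesgue_row n]_z (D z * (gk (9 / 5) (X t) z * gk (- (9 / 7)) z 0)).
  by apply: eq_Rintegral => z _; rewrite mulrCA.
rewrite (smooth_fubini mu mX bs a0 mh2 (ig _) fub2).
have it := bddm_int mu (bddm_sec t be).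
rewrite -[RHS](RintegralZl (gc n (81 / 35)) measurableT it).
have ib := bddm_int mu (smooth_fubini_bddm mu mX bs mh2 (ig _) fub2).
rewrite -[LHS](RintegralZl (s t) measurableT ib).
apply: eq_Rintegral => t' _ /=.
have -> : \int[lebesgue_row n]_z (gk (9 / 5) (X t') z * (gk (9 / 5) (X t) z * gk (- (9 / 7)) z 0))
    = \int[lebesgue_row n]_z ((gk (2 / 5) (X t) 0 * gk (2 / 5) (X t') 0 *
      expR (7 / 5 * dot (X t') (X t))) * gk (81 / 35) ((7 / 9) *: (X t + X t')) z).
  apply: eq_Rintegral => z _; rewrite /gk -!expRD; congr expR.
  by rewrite !subr0 !(sqB, sqZ, dotZl, sqD, dotDl) (dotC (X t') (X t)); field.
rewrite RintegralZl//; last by apply: integrable_gk; rewrite divr_gt0.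
by rewrite Rintegral_gk ?divr_gt0// /tilt; ring.
Qed.

Definition smooth_cst : R := gc n (81 / 35) * gc n (81 / 14) / gc n (81 / 20) ^+ 2.

Lemma smooth_cst_gt0 : 0 < smooth_cst.
Proof.
have g (a b : R) : 0 < a -> 0 < b -> 0 < gc n (a / b).
  by move=> a0 b0; apply: gc_gt0; rewrite divr_gt0.
apply: divr_gt0; first by rewrite mulr_gt0// g.
by apply: exprn_gt0; rewrite g.
Qed.

(** Precision 1 is reached from 9/5 by a further smoothing of precision 9/4, as 5/9 + 4/9 = 1.
    Cauchy-Schwarz is applied with the weight of precision 9/7, because 7/9 + 2/9 = 1 makes the
    integral of the squared second factor proportional to [gk 1 0 x]. The squared first factor is
    then integrated by [integral_smooth_sqr]. *)
Lemma smooth1_sqr_le s x : bddm s ->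
  smooth mu X s 1 x ^+ 2 <= smooth_cst * gk 1 0 x * exp_energy mu X (tilt s) (7 / 5).
Proof.
move=> bs; have [i2 E2] := integral_smooth_sqr bs.
have c0 : 0 < gc n (81 / 20) :> R by rewrite gc_gt0 ?divr_gt0.
have p1 : 0 < 9 / 5 :> R by rewrite divr_gt0.
have p2 : 0 < 9 / 4 :> R by rewrite divr_gt0.
have := smooth_conv mu mX x bs p1 p2.
have -> : 9 / 5 + 9 / 4 = 81 / 20 :> R by field.
have -> : 9 / 5 * (9 / 4) / (81 / 20) = 1 :> R by field.
move=> conv.
pose F z := smooth mu X s (9 / 5) z * gk (- (9 / 14)) z 0.
pose G z : R := gk (9 / 14) 0 z * gk (9 / 4) z x.
have FG z : smooth mu X s (9 / 5) z * gk (9 / 4) z x = F z * G z.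
  rewrite /F /G -mulrA [gk _ _ _ * (_ * _)]mulrA.
  have -> : gk (- (9 / 14)) z 0 * gk (9 / 14) 0 z = 1 :> R.
    by rewrite /gk -expRD -[RHS]expR0; congr expR; rewrite subr0 sub0r sqN; field.
  by rewrite mul1r.
have F2 z : F z ^+ 2 = smooth mu X s (9 / 5) z ^+ 2 * gk (- (9 / 7)) z 0.
  by apply: sqr_mul_gk; field.
have G2 z : G z ^+ 2 = gk (9 / 7) 0 z * gk (9 / 2) z x.
  rewrite /G (@sqr_mul_gk _ _ _ (9 / 2)); last by field.
  by rewrite -(mul1r (gk (9 / 14) 0 z)) (@sqr_mul_gk _ _ _ (9 / 7)) ?expr1n ?mul1r//; field.
have e97 : 9 / 7 + 9 / 2 = 81 / 14 :> R by field.
have e1 : 9 / 7 * (9 / 2) / (81 / 14) = 1 :> R by field.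
have IG : \int[lebesgue_row n]_z G z ^+ 2 = gc n (81 / 14) * gk 1 0 x.
  under eq_Rintegral do rewrite G2.
  by rewrite integral_gk_mul ?divr_gt0// e97 e1.
have iG2 : (lebesgue_row n).-integrable setT (EFin \o (fun z => G z ^+ 2)).
  have ig : (lebesgue_row n).-integrable setT (EFin \o gk (9 / 7) (0 : 'rV[R]_n)).
    by apply: integrable_gk; rewrite divr_gt0.
  apply: (le_integrable _ _ _ ig) => //.
    apply/measurable_EFinP; under eq_fun do rewrite G2.
    by apply: measurable_funM; exact: measurable_gk.
  move=> z _ /=; rewrite lee_fin G2 !ger0_norm ?mulr_ge0 ?gk_ge0//.
  by rewrite ler_piMr ?gk_ge0 ?gk_le1// divr_ge0.
have CS : (\int[lebesgue_row n]_z (F z * G z)) ^+ 2 <=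
    (\int[lebesgue_row n]_z F z ^+ 2) * (\int[lebesgue_row n]_z G z ^+ 2).
  apply: Rintegral_cauchy_schwarz => //.
  - by under eq_fun do rewrite F2.
  - under eq_fun do rewrite -FG.
    by apply: smooth_gk_integrable; rewrite ?divr_ge0 ?divr_gt0.
  - by rewrite IG mulr_gt0 ?gk_gt0 ?gc_gt0 ?divr_gt0.
have key : smooth mu X s 1 x * gc n (81 / 20) = \int[lebesgue_row n]_z (F z * G z).
  by rewrite conv; apply: eq_Rintegral => z _; exact: FG.
have IF : \int[lebesgue_row n]_z F z ^+ 2 =
    gc n (81 / 35) * exp_energy mu X (tilt s) (7 / 5).
  by rewrite -E2; apply: eq_Rintegral => z _; exact: F2.
have c20 : 0 < gc n (81 / 20) ^+ 2 :> R by rewrite exprn_gt0.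
rewrite -key IG IF exprMn in CS; rewrite -(ler_pM2r c20) (le_trans CS)//.
rewrite le_eqVlt; apply/orP; left; apply/eqP.
move: c0; rewrite /smooth_cst; move: (gc n (81 / 20)) => c c0; field.
by rewrite gt_eqF.
Qed.

(** Smoothing further with the kernel of precision 2, which is at most 1, bounds the smoothing at
    precision 2/3 uniformly by the L1 norm. Integrated against the smoothing at precision 1 it gives
    the kernel of precision 2/5, that is the tilted energy at 2/5, so this energy is at most sup
    norm times L1 norm. *)
Lemma smooth_l1_le s : bddm s ->
  gc n (5 / 3) * gc n 3 * exp_energy mu X (tilt s) (2 / 5) <=
  (\int[lebesgue_row n]_z `|smooth mu X s 1 z|) ^+ 2.
Proof.
move=> bs; have l01 : 0 < 1 :> R by exact: ltr01.
set D := smooth mu X s 1; set I := \int[_]_z _.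
have mD : measurable_fun setT D by exact: measurable_smooth.
have iD : (lebesgue_row n).-integrable setT (EFin \o D) by exact: (integrable_smooth mu mX XB bs).
have iaD : (lebesgue_row n).-integrable setT (EFin \o (fun z => `|D z|)).
  exact: (integrable_norm iD).
have b23 z : gc n 3 * `|smooth mu X s (2 / 3) z| <= I.
  have := smooth_conv mu mX z bs l01 (ltr0n R 2).
  have -> : 1 + 2 = 3 :> R by ring.
  rewrite mul1r => conv.
  rewrite -[gc n 3]gtr0_norm ?gc_gt0// -normrM mulrC conv.
  have mDg : measurable_fun setT (fun y => D y * gk 2 y z).
    by apply: measurable_funM => //; exact: measurable_gk.
  have H y : `|D y * gk 2 y z| <= `|D y|.
    by rewrite normrM (ger0_norm (gk_ge0 _ _ _)) ler_piMr// gk_le1.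
  exact: (le_norm_Rintegral mDg iaD H).2.
have a23 : 0 <= 2 / 3 :> R by rewrite divr_ge0.
have dom t z : `|gk (2 / 3) (X t) z * D z| <= `|D z|.
  by rewrite normrM (ger0_norm (gk_ge0 _ _ _)) ler_piMl// gk_le1.
have fub := smooth_fubini mu mX bs a23 mD iaD dom.
have EE : gc n (5 / 3) * exp_energy mu X (tilt s) (2 / 5) =
    \int[lebesgue_row n]_z (smooth mu X s (2 / 3) z * D z).
  rewrite fub /exp_energy /energy /dint.
  have be : bddm (fun p : T * T => tilt s p.1 * tilt s p.2 * expR (2 / 5 * dot (X p.1) (X p.2))).
    apply: (bddm_weight (K := fun x => expR (2 / 5 * x)) (bddm_tilt bs)).
    by apply: bddm_expR; apply: bddmZ; exact: (bddm_dot mX XB).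
  have ie := bddm_int mu (bddm_marginal mu be).
  rewrite -[LHS](RintegralZl (gc n (5 / 3)) measurableT ie).
  apply: eq_Rintegral => t _.
  have -> : \int[lebesgue_row n]_z (gk (2 / 3) (X t) z * D z) =
      \int[lebesgue_row n]_z (D z * gk (2 / 3) z (X t)).
    by apply: eq_Rintegral => z _; rewrite mulrC gkC.
  have p23 : 0 < 2 / 3 :> R by rewrite divr_gt0.
  have := smooth_conv mu mX (X t) bs l01 p23.
  have -> : 1 + 2 / 3 = 5 / 3 :> R by field.
  have -> : 1 * (2 / 3) / (5 / 3) = 2 / 5 :> R by field.
  move=> <-.
  rewrite mulrA mulrC; congr (_ * _); rewrite /smooth.
  have bg : bddm (fun t' => s t' * gk (2 / 5) (X t') (X t)).
    by apply: bddmM => //; apply: bddm_gk.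
  rewrite -(RintegralZl (s t) measurableT (bddm_int mu bg)).
  apply: eq_Rintegral => t' _ /=; rewrite /tilt.
  have -> : gk (2 / 5) (X t') (X t) = gk (2 / 5) (X t') 0 * gk (2 / 5) (X t) 0 *
      expR (2 / 5 * dot (X t') (X t)) :> R.
    by rewrite /gk -!expRD; congr expR; rewrite !subr0 sqB; field.
  by ring.
rewrite mulrAC EE expr2 mulrC.
have m23 : measurable_fun setT (smooth mu X s (2 / 3)) by exact: measurable_smooth.
have iI : (lebesgue_row n).-integrable setT (EFin \o (fun z => I / gc n 3 * `|D z|)).
  exact: (integrableZl measurableT _ iaD).
have mSD : measurable_fun setT (fun z => smooth mu X s (2 / 3) z * D z) by exact: measurable_funM.
have g3 : 0 < gc n 3 :> R by rewrite gc_gt0.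
have dI z : `|smooth mu X s (2 / 3) z * D z| <= I / gc n 3 * `|D z|.
  by rewrite normrM ler_wpM2r// ler_pdivlMr// mulrC.
have [_ H] := le_norm_Rintegral mSD iI dI.
rewrite (RintegralZl _ measurableT iaD) in H.
apply: (@le_trans _ _ (gc n 3 * (I / gc n 3 * I))).
  by rewrite ler_wpM2l ?(ltW g3)// (le_trans (ler_norm _)).
by rewrite mulrA mulrCA divff ?gt_eqF// mulr1.
Qed.

End kernel_bounds.

(** * Mixtures carried by a cube *)

Section gradient.
Context d (T : measurableType d) (R : realType) (n : nat).
Variables (mu : {finite_measure set T -> \bar R}) (X : T -> 'rV[R]_n) (B : R).
Hypotheses (mX : measurable_fun setT X) (XB : forall t, sq (X t) <= B).
Implicit Types s : T -> R.

Lemma is_derive_gk (y x : 'rV[R]_n) i (h : R) :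
  is_derive h 1 (fun h : R => gk 1 y (h *: delta_mx 0 i + x))
    ((y 0 i - x 0 i - h) * gk 1 y (h *: delta_mx 0 i + x)).
Proof.
have E h' : gk 1 y (h' *: delta_mx 0 i + x) =
    gk 1 y x * expR (h' * (y 0 i - x 0 i) + (- 2^-1) * (h' * h')).
  have de z : dot z (delta_mx 0 i) = z 0 i :> R.
    rewrite /dot (bigD1 i)//= big1 ?addr0 ?mxE ?eqxx ?mulr1// => j ji.
    by rewrite !mxE (negbTE ji) andbF mulr0.
  have se : sq (delta_mx 0 i : 'rV[R]_n) = 1 by rewrite /sq de mxE !eqxx.
  rewrite /gk -expRD; congr expR; rewrite !sqB sqD sqZ dotDr !dotZr dotZl se de.
  by rewrite (dotC _ x) de; field.
rewrite (funext E : (fun h : R => _) = _) E; apply: is_derive_eq => /=.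
by rewrite /GRing.scale/= ?mulr0 ?mulr1 ?addr0 ?add0r; field.
Qed.

(** Differentiation under the integral sign: for a displacement in ]-1, 1[ the derivative of the
    integrand is dominated by a constant, because [s] and the coordinates of [X] are bounded. *)
Lemma derive_smooth s (x : 'rV[R]_n) i : bddm s ->
  'D_(delta_mx 0 i) (smooth mu X s 1) x =
  smooth mu X (fun t => s t * X t 0 i) 1 x - x 0 i * smooth mu X s 1 x.
Proof.
move=> bs; have [ms [c sc]] := bs; have [mXi [b Xb]] := bddm_coord mX XB i.
pose f (h : R) t := s t * gk 1 (X t) (h *: delta_mx 0 i + x).
have bf h : bddm (f h) by apply: bddmM => //; exact: bddm_gk.
have df (h : R) (t : T) : is_derive h 1 (fun h => f h t)
    (s t * ((X t 0 i - x 0 i - h) * gk 1 (X t) (h *: delta_mx 0 i + x))).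
  rewrite /f; have Dg := is_derive_gk (X t) x i h; apply: is_derive_eq.
  by rewrite /GRing.scale/= ?mulr0 ?add0r ?addr0.
pose G (t : T) := `|c| * (`|b| + `|x 0 i| + 1).
have GB (h : R) (t : T) : `]-1, 1[%classic h -> setT t -> `|'D_1 (fun h => f h t) h| <= G t.
  rewrite /= in_itv/= => /andP[h1 h2] _; rewrite (derive_val (is_derive := df h t)).
  rewrite normrM; apply: ler_pM => //; first by rewrite (le_trans (sc t))// ler_norm.
  rewrite normrM (ger0_norm (gk_ge0 _ _ _)) -[leRHS]mulr1; apply: ler_pM; rewrite ?gk_ge0 ?gk_le1//.
  rewrite (le_trans (ler_normB _ _))// lerD//; last by rewrite ltW// ltr_norml h1 h2.
  by rewrite (le_trans (ler_normB _ _))// lerD2r (le_trans (Xb t))// ler_norm.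
have I0 : `]-1, 1[%classic (0 : R) by rewrite /= in_itv/= ltrN10 ltr01.
have intf (h : R) : `]-1, 1[%classic h -> mu.-integrable setT (EFin \o f h).
  by move=> _; exact: bddm_int.
have derf (h : R) (t : T) : `]-1, 1[%classic h -> setT t -> derivable (f ^~ t) h 1.
  by move=> _ _; exact: (ex_derive (is_derive := df h t)).
have G0 t : 0 <= G t by rewrite mulr_ge0// addr_ge0// addr_ge0.
have GU (h : R) (t : T) : `]-1, 1[%classic h -> setT t -> `|partial1of2 f h t| <= G t.
  by rewrite partial1of2E; exact: GB.
have iG : mu.-integrable setT (EFin \o G) by apply: bddm_int; exact: bddm_cst.
have := cvg_differentiation_under_integral measurableT I0 intf derf G0 iG GU.
have f0 : \int[mu]_t f 0 t = smooth mu X s 1 x.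
  by apply: eq_Rintegral => t _; rewrite /f scale0r add0r.
have fh (h : R) : \int[mu]_t f h t = smooth mu X s 1 (h *: delta_mx 0 i + x).
  by apply: eq_Rintegral => t _; rewrite /f.
clearbody f; have dq (h : R) : h^-1 *: (\int[mu]_t f (h + 0) t - \int[mu]_t f 0 t) =
    h^-1 *: (smooth mu X s 1 (h *: delta_mx 0 i + x) - smooth mu X s 1 x).
  by rewrite f0 fh addr0.
rewrite (eq_cvg _ _ dq) => cv.
transitivity (\int[mu]_t partial1of2 f 0 t); first exact: (cvg_lim (@Rhausdorff R) cv).
rewrite /smooth -RintegralZl//; last first.
  by apply: bddm_int; apply: bddmM => //; exact: bddm_gk.
rewrite -RintegralB//; last 2 first.
- apply: bddm_int; apply: bddmM; last exact: bddm_gk.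
  by apply: bddmM => //; exact: (bddm_coord mX XB).
- by apply: bddm_int; apply: bddmZ; apply: bddmM => //; exact: bddm_gk.
apply: eq_Rintegral => t _; rewrite partial1of2E (derive_val (is_derive := df 0 t)).
by rewrite scale0r add0r subr0; ring.
Qed.

End gradient.

(** * A difference of two probabilities as a weighted measure *)

Section signed_pair.
Context d (T : measurableType d) (R : realType).
Implicit Types p q : probability T R.

Let measurable_tag (b : bool) : measurable_fun setT (pair b : T -> bool * T).
Proof. exact: pair1_measurable. Qed.

HB.instance Definition _ (b : bool) :=
  isMeasurableFun.Build _ _ _ _ (pair b : T -> bool * T) (measurable_tag b).

Definition tag_fun (b : bool) : {mfun T >-> (bool * T)%type} := (pair b : T -> bool * T).

(* The difference [p - q] is represented as [sgn] times a positive measure on two copies of [T]. *)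
Definition pair_measure p q :=
  sum_measure (distribution p (tag_fun true)) (distribution q (tag_fun false)).

HB.instance Definition _ p q := FiniteMeasure.on (pair_measure p q).

Definition sgn (z : bool * T) : R := if z.1 then 1 else -1.

Lemma measurable_sgn : measurable_fun setT sgn.
Proof.
apply: (measurableT_comp (f := fun b : bool => if b then 1 else -1 : R)) => //.
Qed.

Lemma norm_sgn z : `|sgn z| = 1.
Proof. by rewrite /sgn; case: z.1; rewrite ?normrN normr1. Qed.

Lemma bddm_sgn : bddm sgn.
Proof. by split; [exact: measurable_sgn|exists 1 => z; rewrite norm_sgn]. Qed.

Lemma pair_measureT p q : fine (pair_measure p q setT) = 2.
Proof.
rewrite /pair_measure /sum_measure measure_addE.
transitivity (fine (1 + 1 : \bar R)) => //; congr (fine (_ + _)).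
- exact: (probability_setT (distribution p (tag_fun true))).
- exact: (probability_setT (distribution q (tag_fun false))).
Qed.

Lemma Rintegral_pair p q (f : bool * T -> R) : bddm f ->
  \int[pair_measure p q]_z f z = \int[p]_t f (true, t) + \int[q]_t f (false, t).
Proof.
move=> bf; have [mf _] := bf.
have mEf : measurable_fun setT (EFin \o f) by exact/measurable_EFinP.
have bt b : bddm (fun t => f (b, t)) by exact: (bddm_comp (@measurable_tag b)).
rewrite /Rintegral /pair_measure /sum_measure integral_measure_add//; last 2 first.
- exact: bddm_int.
- exact: bddm_int.
rewrite !integral_distribution//; last 2 first.
- by apply: bddm_int; exact: bt.
- by apply: bddm_int; exact: bt.
rewrite fineD//.
- by apply: integrable_fin_num => //; apply: bddm_int; exact: bt.
- by apply: integrable_fin_num => //; apply: bddm_int; exact: bt.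
Qed.

Lemma Rintegral_pair_sgn p q (f : T -> R) : bddm f ->
  \int[pair_measure p q]_z (sgn z * f z.2) = \int[p]_t f t - \int[q]_t f t.
Proof.
move=> bf; rewrite Rintegral_pair; last first.
  by apply: bddmM; [exact: bddm_sgn|exact: (bddm_comp measurable_snd)].
rewrite /sgn/=; congr (_ + _); first by apply: eq_Rintegral => t _; rewrite mul1r.
by rewrite -[RHS]mulN1r -(RintegralZl (-1) measurableT (bddm_int q bf)).
Qed.

End signed_pair.

Section mixtures_on_cube.
Context {R : realType} (d : nat) (M : R).
Hypothesis M0 : 0 <= M.
Implicit Types (p q : probability 'rV[R]_d R) (x : 'rV[R]_d).

(** Projection onto the cube. It changes nothing almost surely for a prior carried by the cube, and
    it makes the integrands bounded everywhere. *)
Definition clip (x : 'rV[R]_d) : 'rV[R]_d := \row_i Num.max (- M) (Num.min (x 0 i) M).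

Definition carried p := p (~` cube M) = 0%E.

Definition sqradius : R := d%:R * M ^+ 2.

Lemma sqradius_ge0 : 0 <= sqradius.
Proof. by rewrite mulr_ge0 ?sqr_ge0. Qed.

Lemma measurable_clip : measurable_fun setT clip.
Proof.
apply: measurable_row => i; under eq_fun do rewrite mxE.
by apply: measurable_maxr => //; apply: measurable_minr => //; exact: measurable_coord.
Qed.

Lemma clip_cube x : cube M (clip x).
Proof.
move=> i; rewrite mxE le_max lexx/= ge_max ge_min lexx orbT andbT.
by rewrite (le_trans _ M0)// oppr_le0.
Qed.

Lemma clip_id x : cube M x -> clip x = x.
Proof.
move=> cx; apply/rowP => i; rewrite mxE; have /andP[h1 h2] := cx i.
by rewrite (min_idPl h2) (max_idPr h1).
Qed.

Lemma sq_clip x : sq (clip x) <= sqradius.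
Proof.
rewrite sqE /sqradius mulr_natl -[in leRHS](card_ord d) -sumr_const.
apply: ler_sum => i _; have /andP[h1 h2] := clip_cube x i.
rewrite -real_normK ?num_real// lerXn2r ?nnegrE//.
by rewrite ler_norml h1 h2.
Qed.

Lemma measurable_cube : measurable (cube M : set 'rV[R]_d).
Proof.
rewrite (_ : cube M = \bigcap_(i in [set: 'I_d]) ((fun x : 'rV[R]_d => x 0 i) @^-1` `[- M, M])).
  apply: fin_bigcap_measurable => [|i _]; first exact: finite_finset.
  by rewrite -[X in measurable X]setTI; exact: measurable_coord.
apply/seteqP; split=> x /= cx i; first by move=> _; rewrite /= in_itv/=; exact: cx.
by have := cx i Logic.I; rewrite /= in_itv.
Qed.

Definition gnorm : R := Num.sqrt (2 * pi) ^- d.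

Lemma gnorm_gt0 : 0 < gnorm.
Proof. by rewrite invr_gt0 exprn_gt0// sqrtr_gt0 mulr_gt0// pi_gt0. Qed.

Lemma gauss_gk x t : gauss_pdf (x - t) = gnorm * gk 1 t x.
Proof.
by rewrite /gauss_pdf /gk enorm_sq sqBC; congr (_ * expR _); field.
Qed.

Lemma smooth_scale p (a : 'rV[R]_d -> R) x : bddm a ->
  smooth p clip (fun t => gnorm * a t) 1 x = gnorm * smooth p clip a 1 x.
Proof.
move=> ba; rewrite /smooth -RintegralZl//.
  by apply: eq_Rintegral => t _; rewrite mulrA.
by apply: bddm_int; apply: bddmM => //; apply: bddm_gk => //; exact: measurable_clip.
Qed.

Lemma mix_density_smooth p x : carried p ->
  mix_density p x = gnorm * smooth p clip (fun=> 1) 1 x.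
Proof.
move=> cp; have bg := bddm_gk measurable_clip x ler01.
rewrite /smooth -RintegralZl//; last first.
  by apply: bddm_int; apply: bddmZ.
rewrite /mix_density /Rintegral; congr fine; apply: ae_eq_integral => //.
- apply/measurable_EFinP; under eq_fun do rewrite gauss_gk.
  by apply: measurable_funM => //; exact: measurable_gk.
- by apply/measurable_EFinP; exact: (bddmZ gnorm (bddmZ 1 bg)).1.
- exists (~` cube M); split; [apply: measurableC; exact: measurable_cube|exact: cp|].
  move=> t /= h; apply: contra_not h => ct _.
  by rewrite gauss_gk clip_id// mul1r.
Qed.

(** The density f weighted by the i-th coordinate of the parameter: the numerator of the posterior
    mean in Tweedie's formula. *)
Definition weighted_density p i x := gnorm * smooth p clip (fun t => clip t 0 i) 1 x.

Lemma grad_mix_density p x i : carried p ->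
  grad (mix_density p) x 0 i = weighted_density p i x - x 0 i * mix_density p x.
Proof.
move=> cp; have b1 := bddm_cst 'rV[R]_d (1 : R).
have bi := bddm_coord measurable_clip sq_clip i.
rewrite mxE (_ : mix_density p = smooth p clip (fun=> gnorm * 1) 1); last first.
  by apply/funext => y; rewrite mix_density_smooth// (smooth_scale p y b1).
rewrite (derive_smooth p measurable_clip sq_clip x i (bddmZ gnorm b1)).
rewrite /weighted_density -(smooth_scale p x bi); congr (_ - _).
by congr (smooth _ _ _ _ _); apply/funext => t; rewrite mulr1.
Qed.

Definition pair_weight := tilt (fun z : bool * 'rV[R]_d => clip z.2) (@sgn _ 'rV[R]_d R).

(** The energy N(u) for the signed measure [p - q]. *)
Definition gap p q u := exp_energy (pair_measure p q) (fun z => clip z.2) pair_weight u.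

Definition l1_dist p q := \int[lebesgue_row d]_x `|mix_density p x - mix_density q x|.

Let mc2 : measurable_fun setT (fun z : bool * 'rV[R]_d => clip z.2).
Proof. exact: (measurableT_comp measurable_clip). Qed.

Let c2B (z : bool * 'rV[R]_d) : sq (clip z.2) <= sqradius.
Proof. exact: sq_clip. Qed.

Let smooth_pair p q (a : 'rV[R]_d -> R) x : bddm a ->
  smooth (pair_measure p q) (fun z => clip z.2) (fun z => sgn R z * a z.2) 1 x =
  smooth p clip a 1 x - smooth q clip a 1 x.
Proof.
move=> ba; have bf : bddm (fun t => a t * gk 1 (clip t) x).
  by apply: bddmM => //; exact: (bddm_gk measurable_clip x ler01).
rewrite /smooth -(Rintegral_pair_sgn p q bf).
by apply: eq_Rintegral => z _; rewrite mulrA.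
Qed.

Let smooth_sgn p q x : carried p -> carried q ->
  mix_density p x - mix_density q x =
  gnorm * smooth (pair_measure p q) (fun z => clip z.2) (@sgn _ _ R) 1 x.
Proof.
move=> cp cq; rewrite !mix_density_smooth// -mulrBr -smooth_pair; last exact: bddm_cst.
by congr (_ * smooth _ _ _ _ _); apply/funext => z; rewrite mulr1.
Qed.

Let g2 : 0 <= gnorm ^+ 2. Proof. exact: sqr_ge0. Qed.

Lemma density_gap p q x : carried p -> carried q ->
  (mix_density p x - mix_density q x) ^+ 2 <=
  gnorm ^+ 2 * (smooth_cst R d * gk 1 0 x * gap p q (7 / 5)).
Proof.
move=> cp cq; rewrite smooth_sgn// exprMn ler_wpM2l//.
by apply: (smooth1_sqr_le _ mc2 c2B); exact: bddm_sgn.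
Qed.

Lemma gap_mono p q u v : 0 <= u -> u <= v -> gap p q u <= gap p q v.
Proof.
by apply: (exp_energy_mono _ mc2 c2B); apply: bddm_tilt => //; exact: bddm_sgn.
Qed.

Lemma gap_ge0 p q u : 0 <= u -> 0 <= gap p q u.
Proof.
by apply: (exp_energy_ge0 _ mc2 c2B); apply: bddm_tilt => //; exact: bddm_sgn.
Qed.

(** The pointwise bound at precision 1 is applied to each coordinate weight and summed. The sum is
    the energy of t exp(7/5 t), which moves the argument of the energy from 7/5 to 8/5. *)
Lemma weighted_density_gap p q x :
  \sum_i (weighted_density p i x - weighted_density q i x) ^+ 2 <=
  gnorm ^+ 2 * (smooth_cst R d * gk 1 0 x * (5 * gap p q (8 / 5))).
Proof.
pose s i (z : bool * 'rV[R]_d) := sgn R z * clip z.2 0 i.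
have bs i : bddm (s i).
  by apply: bddmM; [exact: bddm_sgn|exact: (bddm_coord mc2 c2B)].
have E i : weighted_density p i x - weighted_density q i x =
    gnorm * smooth (pair_measure p q) (fun z => clip z.2) (s i) 1 x.
  rewrite /weighted_density -mulrBr -smooth_pair//.
  exact: (bddm_coord measurable_clip sq_clip).
under eq_bigr do rewrite E exprMn; rewrite -mulr_sumr ler_wpM2l//.
have bt := bddm_tilt mc2 (@bddm_sgn _ 'rV[R]_d R).
have := energy_mul_expR_le (pair_measure p q) mc2 c2B bt.
rewrite -(sum_exp_energy_coord (pair_measure p q) mc2 c2B bt) => H.
have C0 : 0 <= smooth_cst R d * gk 1 0 x by rewrite mulr_ge0 ?gk_ge0 ?ltW ?smooth_cst_gt0.
apply: le_trans (ler_wpM2l C0 H); rewrite mulr_sumr; apply: ler_sum => i _.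
have := smooth1_sqr_le (pair_measure p q) mc2 c2B x (bs i).
suff -> : tilt (fun z : bool * 'rV[R]_d => clip z.2) (s i) =
  fun z => tilt (fun z => clip z.2) (@sgn _ _ R) z * clip z.2 0 i by [].
by apply/funext => z; rewrite /tilt /s mulrAC.
Qed.

Definition l1_cst : R := (gnorm ^+ 2 * (gc d (5 / 3) * gc d 3))^-1.

Lemma l1_cst_gt0 : 0 < l1_cst.
Proof. by rewrite invr_gt0 !mulr_gt0 ?gc_gt0 ?exprn_gt0 ?gnorm_gt0 ?divr_gt0. Qed.

Let sgn_smooth_l1 p q : carried p -> carried q -> l1_dist p q =
  gnorm * \int[lebesgue_row d]_x
    `|smooth (pair_measure p q) (fun z => clip z.2) (@sgn _ _ R) 1 x|.
Proof.
move=> cp cq; have i := integrable_smooth (pair_measure p q) mc2 c2B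
  (@bddm_sgn _ 'rV[R]_d R) ltr01.
rewrite -(RintegralZl gnorm measurableT (integrable_norm i)).
apply: eq_Rintegral => x _; rewrite /= smooth_sgn// normrM ger0_norm//.
by rewrite ltW// gnorm_gt0.
Qed.

(* Interpolation in the exponent: [2/5] is controlled by the L1 distance and [v] only by compactness. *)
Lemma gap_bound p q v k : carried p -> carried q -> 8 / 5 <= v ->
  gap p q (8 / 5) <=
  4 ^+ k * (l1_cst * l1_dist p q ^+ 2) + (8 / 5 / v) ^+ k * (4 * expR (v * sqradius)).
Proof.
move=> cp cq v85; have bs := @bddm_sgn _ 'rV[R]_d R.
have bt := bddm_tilt mc2 bs; have v0 : 0 <= v by rewrite (le_trans _ v85)// divr_ge0.
have c1 : 0 < 2 / 5 :> R by rewrite divr_gt0.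
have c2 : 2 / 5 <= 8 / 5 :> R by lra.
apply: (le_trans (exp_energy_interp (pair_measure p q) mc2 c2B bt k c1 c2 v85)).
have -> : 8 / 5 / (2 / 5) = 4 :> R by field.
apply: lerD; last first.
  rewrite ler_wpM2l ?exprn_ge0 ?divr_ge0//.
  apply: (le_trans (exp_energy_le (c := 1) (pair_measure p q) mc2 c2B bt v0 _)) => [z|].
    rewrite normrM norm_sgn mul1r ger0_norm ?gk_ge0// gk_le1//.
  by rewrite pair_measureT expr1n mul1r mulrC -natrX.
rewrite ler_wpM2l ?exprn_ge0// /l1_cst sgn_smooth_l1// [leRHS]mulrC.
rewrite ler_pdivlMr ?mulr_gt0 ?gc_gt0 ?exprn_gt0 ?gnorm_gt0 ?divr_gt0//.
rewrite exprMn [leLHS]mulrC -mulrA ler_wpM2l//.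
exact: (smooth_l1_le (pair_measure p q) mc2 c2B bs).
Qed.

End mixtures_on_cube.

(** * Regret in terms of the gap between two mixtures *)

Section mixture_law.
Context {R : realType} (d : nat).
Implicit Types (p : probability 'rV[R]_d R).

Lemma integrable_mix_density p :
  (lebesgue_row d).-integrable setT (EFin \o mix_density p).
Proof.
apply/integrableP; split; first by apply/measurable_EFinP; exact: measurable_mix_density.
under eq_integral do rewrite /= ger0_norm ?mix_density_ge0//.
by rewrite integral_mix_density ltry.
Qed.

Lemma mix_law_dominates p : mix_law p `<< lebesgue_row d.
Proof.
apply/null_content_dominatesP => A mA A0; rewrite /mix_law.
apply: null_set_integral => //.
by apply/measurable_EFinP/measurable_funTS; exact: measurable_mix_density.
Qed.

(** The law is given by its values on sets, so its Radon-Nikodym derivative is first identified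
    almost everywhere with the mixture density. *)
Lemma ge0_integral_mix_law p (h : 'rV[R]_d -> R) :
  measurable_fun setT h -> (forall x, 0 <= h x) ->
  (\int[mix_law p]_x (h x)%:E = \int[lebesgue_row d]_x (h x * mix_density p x)%:E)%E.
Proof.
move=> mh h0; have dom := mix_law_dominates p.
have mE : measurable_fun setT (EFin \o h) by exact/measurable_EFinP.
have hE0 x : (0 <= (EFin \o h) x)%E by rewrite lee_fin.
rewrite -(Radon_Nikodym_SigmaFinite.change_of_variables dom hE0 measurableT mE).
apply: ae_eq_integral => //.
- apply: emeasurable_funM => //; apply: (measurable_int (lebesgue_row d)).
  exact: Radon_Nikodym_SigmaFinite.f_integrable.
- by apply/measurable_EFinP/measurable_funM => //; exact: measurable_mix_density.
under [X in ae_eq _ _ _ X]eq_fun do rewrite EFinM.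
apply: ae_eqe_mul2l; apply: integral_ae_eq => //.
- exact: Radon_Nikodym_SigmaFinite.f_integrable.
- by apply/measurable_EFinP; exact: measurable_mix_density.
- by move=> A _ mA; rewrite -Radon_Nikodym_SigmaFinite.f_integral.
Qed.

End mixture_law.

Section density_bounds.
Context {R : realType} (d : nat) (M : R).
Hypothesis M0 : 0 <= M.
Implicit Types (p q : probability 'rV[R]_d R) (x : 'rV[R]_d).
Local Notation B := (sqradius d M).
Local Notation gnorm := (gnorm (R := R) d).

Let gn0 : 0 <= gnorm.
Proof. by apply: ltW; exact: gnorm_gt0. Qed.

Lemma mix_density_upper p x : carried M p ->
  mix_density p x <= gnorm * expR (B / 2) * gk (1 / 2) 0 x.
Proof.
move=> cp; rewrite (mix_density_smooth x cp) -mulrA ler_wpM2l//.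
apply: (le_trans (ler_norm _)).
have -> : expR (B / 2) * gk (1 / 2) 0 x = expR (B / 2) * gk (1 / 2) 0 x * fine (p setT).
  by rewrite probability_setT mulr1.
apply: norm_Rintegral_le; first exact: fin_measureT.
  by apply: measurable_funM => //; apply: measurable_gk => //; exact: measurable_clip.
move=> t; rewrite mul1r ger0_norm ?gk_ge0// /gk -expRD ler_expR sub0r sqN sqB.
have := sq_clip M0 t; have := sq_ge0 (x - 2 *: clip M t).
rewrite sqB sqZ dotZr (dotC x); lra.
Qed.

(** From |x + r t|^2 >= 0 with |x| <= r and |t|^2 <= B one gets - <t, x> <= r (B + 1) / 2: on the
    ball the density is comparable to the kernel centred at 0 up to exp(O(r)). *)
Lemma mix_density_lower p x r : carried M p -> 0 < r -> sq x <= r ^+ 2 ->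
  gnorm * expR (- (B / 2) - r * (B + 1) / 2) * gk 1 0 x <= mix_density p x.
Proof.
move=> cp r0 xr; rewrite (mix_density_smooth x cp) -mulrA ler_wpM2l//.
rewrite /smooth.
have b1 := bddm_gk (@measurable_clip R d M) x ler01.
set c := expR _ * gk 1 0 x; have -> : c = \int[p]_t (cst c t).
  have E : fine (p setT) = 1 by rewrite probability_setT.
  by rewrite Rintegral_cst//; exact: esym (etrans (congr1 ( *%R c) E) (mulr1 c)).
apply: le_Rintegral => //.
- by apply: bddm_int; exact: bddm_cst.
- by apply: bddm_int; exact: bddmZ.
move=> t _; rewrite mul1r /c /gk -expRD ler_expR sub0r sqN sqB.
have := sq_clip M0 t; have := sq_ge0 (clip M t + r^-1 *: x).
have := sq_ge0 (x + r *: clip M t).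
rewrite !sqD !sqZ !dotZr (dotC x) => h _ hB.
have : sq x <= r ^+ 2 by [].
have rB : 0 <= r ^+ 2 * (B - sq (clip M t)) by rewrite mulr_ge0 ?sqr_ge0 ?subr_ge0.
have : - dot (clip M t) x <= r * (B + 1) / 2.
  rewrite -(ler_pM2l r0); nra.
by lra.
Qed.

Lemma mix_density_gt0 p x : carried M p -> 0 < mix_density p x.
Proof.
move=> cp; have r0 : 0 < Num.sqrt (sq x) + 1 by rewrite ltr_wpDl.
apply: lt_le_trans (mix_density_lower cp r0 _).
  by rewrite !mulr_gt0 ?gnorm_gt0 ?expR_gt0 ?gk_gt0.
rewrite sqrrD sqr_sqrtr ?sq_ge0// expr1n mulr1.
by have := sqrtr_ge0 (sq x); lra.
Qed.

(** The posterior mean lies in the cube, coordinate by coordinate. *)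
Lemma sum_sqr_weighted_density p x : carried M p ->
  \sum_i weighted_density M p i x ^+ 2 <= B * mix_density p x ^+ 2.
Proof.
move=> cp; have -> : B * mix_density p x ^+ 2 = \sum_(i < d) (M * mix_density p x) ^+ 2.
  by rewrite sumr_const card_ord -[RHS]mulr_natl exprMn /sqradius; ring.
apply: ler_sum => i _; rewrite -(real_normK (num_real (weighted_density M p i x))).
rewrite lerXn2r ?nnegrE ?mulr_ge0 ?mix_density_ge0//.
rewrite /weighted_density (mix_density_smooth x cp) normrM ger0_norm//.
rewrite mulrCA ler_wpM2l//.
have mc := @measurable_clip R d M; have b1 := bddm_gk mc x ler01.
have i1 := bddm_int p (bddmZ 1 b1).
rewrite -(RintegralZl M measurableT i1).
have iM := bddm_int p (bddmZ M (bddmZ 1 b1)).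
have mi : measurable_fun setT (fun t : 'rV[R]_d => clip M t 0 i * gk 1 (clip M t) x).
  exact: (bddmM (bddm_coord mc (sq_clip M0) i) b1).1.
apply: (le_norm_Rintegral mi iM _).2 => t.
rewrite normrM mul1r (ger0_norm (gk_ge0 _ _ _)) ler_wpM2r ?gk_ge0//.
by have /andP[h1 h2] := clip_cube M0 t i; rewrite ler_norml h1 h2.
Qed.

End density_bounds.

Section sq_inequalities.
Context {R : realType} (d : nat).
Implicit Types x y : 'rV[R]_d.

Lemma sqD_le x y : sq (x + y) <= 2 * sq x + 2 * sq y.
Proof. by have := sq_ge0 (x - y); rewrite sqB sqD; lra. Qed.

Lemma sqB_le x y : sq (x - y) <= 2 * sq x + 2 * sq y.
Proof. by rewrite -(sqN y); exact: sqD_le. Qed.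

End sq_inequalities.

(** * Pointwise error of the regularized rule *)

Section rule_error.
Context {R : realType} (d : nat) (M : R).
Hypothesis M0 : 0 <= M.
Variables (p q : probability 'rV[R]_d R) (rho : R).
Hypotheses (cp : carried M p) (cq : carried M q) (rho0 : 0 < rho).
Implicit Types (x : 'rV[R]_d).
Local Notation B := (sqradius d M).
Local Notation gnorm := (gnorm (R := R) d).
Local Notation f := (mix_density p).
Local Notation g := (mix_density q).

Definition rule_error x := regularized_rule g rho x - oracle_rule p x.

Let W (r : probability 'rV[R]_d R) x := \row_i weighted_density M r i x.

Let gradE r x : carried M r -> grad (mix_density r) x = W r x - mix_density r x *: x.
Proof.
by move=> cr; apply/rowP => i; rewrite (grad_mix_density M0)// !mxE mulrC.
Qed.

Let sqW r x : carried M r -> sq (W r x) <= B * mix_density r x ^+ 2.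
Proof.
move=> cr; apply: le_trans (sum_sqr_weighted_density M0 x cr).
by rewrite sqE le_eqVlt; apply/orP; left; apply/eqP; apply: eq_bigr => i _; rewrite mxE.
Qed.

Let sq_grad r x : carried M r ->
  sq (grad (mix_density r) x) <= 2 * (B + sq x) * mix_density r x ^+ 2.
Proof.
move=> cr; rewrite gradE//; apply: (le_trans (sqB_le _ _)).
by rewrite sqZ; have := sqW x cr; lra.
Qed.

Let errorE x :
  rule_error x = (Num.max (g x) rho)^-1 *: grad g x - (f x)^-1 *: grad f x.
Proof. by rewrite /rule_error /regularized_rule /oracle_rule opprD addrACA subrr add0r. Qed.

Let f0 x : 0 < f x. Proof. exact: (mix_density_gt0 M0 x cp). Qed.

Let m0 x : 0 < Num.max (g x) rho. Proof. by rewrite lt_max rho0 orbT. Qed.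

Let sq_reg x : sq ((Num.max (g x) rho)^-1 *: grad g x) <= 2 * (B + sq x).
Proof.
rewrite sqZ exprVn mulrC ler_pdivrMr ?exprn_gt0//; apply: (le_trans (sq_grad x cq)).
rewrite ler_wpM2l ?mulr_ge0 ?addr_ge0 ?sqradius_ge0 ?sq_ge0//.
by rewrite lerXn2r ?nnegrE ?mix_density_ge0 ?(ltW (m0 x))// le_max lexx.
Qed.

(** Both corrections have squared norm at most 2 (B + |x|^2), the regularized one because its
    denominator is at least g. This crude bound serves where f < rho and outside the ball. *)
Lemma sq_rule_error_le x : sq (rule_error x) <= 8 * (B + sq x).
Proof.
rewrite errorE; apply: (le_trans (sqB_le _ _)).
have h1 := sq_reg x; have : sq ((f x)^-1 *: grad f x) <= 2 * (B + sq x).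
  rewrite sqZ exprVn mulrC ler_pdivrMr ?exprn_gt0//; exact: sq_grad.
by lra.
Qed.

(** With m = max(g, rho) and u = grad g / m, f times the error equals (grad g - grad f) + (f - m) u.
    Both terms are controlled by differences of densities, and u by the posterior mean bound. *)
Lemma sq_rule_error_density_le x : rho <= f x ->
  f x ^+ 2 * sq (rule_error x) <=
    4 * \sum_i (weighted_density M p i x - weighted_density M q i x) ^+ 2 +
    8 * (f x - g x) ^+ 2 * (B + sq x).
Proof.
move=> rf; rewrite -sqZ errorE.
set m := Num.max (g x) rho; set u := m^-1 *: grad g x.
have mp : 0 < m := m0 x.
have mu : m *: u = grad g x by rewrite scalerA divff ?gt_eqF// scale1r.
have su : sq u <= 2 * (B + sq x) := sq_reg x.
clearbody u; have -> : f x *: (u - (f x)^-1 *: grad f x) =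
    (grad g x - grad f x) + (f x - m) *: u.
  rewrite scalerBr scalerA divff ?gt_eqF// scale1r scalerBl mu.
  by rewrite [RHS]addrC addrA subrK.
apply: (le_trans (sqD_le _ _)).
have H1 : sq (grad g x - grad f x) <=
    2 * \sum_i (weighted_density M p i x - weighted_density M q i x) ^+ 2 +
    2 * ((f x - g x) ^+ 2 * sq x).
  rewrite !gradE//.
  have -> : W q x - g x *: x - (W p x - f x *: x) = (W q x - W p x) + (f x - g x) *: x.
    by rewrite scalerBl opprB addrACA [- (g x *: x) + _]addrC addrACA; congr (_ + _); rewrite addrC.
  apply: (le_trans (sqD_le _ _)); rewrite sqZ lerD2r ler_wpM2l//.
  rewrite sqE le_eqVlt; apply/orP; left; apply/eqP; apply: eq_bigr => i _.
  by rewrite !mxE; ring.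
have H2 : sq ((f x - m) *: u) <= (f x - g x) ^+ 2 * (2 * (B + sq x)).
  rewrite sqZ; apply: ler_pM; rewrite ?sqr_ge0 ?sq_ge0 ?su//.
  (* If g <= rho, then m = rho lies between g and f, so |f - m| <= |f - g| also in this case. *)
  rewrite /m; case: (leP (g x) rho) => h; last by [].
  have g0 := mix_density_ge0 q x; rewrite lerXn2r ?nnegrE ?subr_ge0//; lra.
have BX : 0 <= (f x - g x) ^+ 2 * B by rewrite mulr_ge0 ?sqr_ge0 ?sqradius_ge0.
move: (\sum_i _) H1 H2 => S H1 H2; lra.
Qed.

End rule_error.

Section regret_bound.
Context {R : realType} (d : nat) (M : R).
Hypothesis M0 : 0 <= M.
Variables (p q : probability 'rV[R]_d R) (rho r : R).
Hypotheses (cp : carried M p) (cq : carried M q) (rho0 : 0 < rho).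
Hypotheses (r1 : 1 <= r) (r_rho : expR (- (r ^+ 2 / 16)) <= rho).
Implicit Types (x : 'rV[R]_d).
Local Notation B := (sqradius d M).
Local Notation gnorm := (gnorm (R := R) d).
Local Notation f := (mix_density p).
Local Notation g := (mix_density q).
Local Notation err := (rule_error p q rho).
Local Notation G := (gap M p q (8 / 5)).

Let f0 x : 0 < f x. Proof. exact: (mix_density_gt0 M0 x cp). Qed.

Let B0 : 0 <= B. Proof. exact: sqradius_ge0. Qed.

Let G0 : 0 <= G. Proof. by apply: (gap_ge0 M0). Qed.

Let r0 : 0 < r. Proof. by rewrite (lt_le_trans _ r1). Qed.

Let gm : gap M p q (7 / 5) <= G. Proof. by apply: (gap_mono M0); lra. Qed.

Let near_arith (S Q P b : R) : S <= 5 * P -> Q <= P * b ->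
  4 * S + 8 * Q <= (20 + 8 * b) * P.
Proof. by lra. Qed.

Let density_gap_le x :
  (f x - g x) ^+ 2 <= gnorm ^+ 2 * (smooth_cst R d * gk 1 0 x * G).
Proof.
apply: le_trans (density_gap M0 x cp cq) _.
apply: ler_wpM2l; first exact: sqr_ge0.
by apply: ler_wpM2l gm; rewrite mulr_ge0 ?gk_ge0// ltW// smooth_cst_gt0.
Qed.

Definition near_cst : R :=
  (28 + 8 * B) * (1 + gnorm * smooth_cst R d) * expR (B / 2).

Definition near_rate : R := 2 + (B + 1) / 2.

Definition far_cst : R := 8 * (B + 16) * gnorm * expR (B / 2).

Let gn0 : 0 < gnorm. Proof. exact: gnorm_gt0. Qed.

Let sc0 : 0 < smooth_cst R d. Proof. exact: smooth_cst_gt0. Qed.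

Let le_expR2 : r ^+ 2 <= expR (2 * r).
Proof.
have h : r <= expR r by have := expR_ge1Dx r; lra.
have -> : 2 * r = r + r by ring.
by rewrite expRD expr2; apply: ler_pM => //; exact: ltW.
Qed.

Lemma error_density_near x : sq x <= r ^+ 2 ->
  sq (err x) * f x <= near_cst * expR (near_rate * r) * (rho + G).
Proof.
move=> xr; have X0 := sq_ge0 x.
set e := expR (B / 2 + r * (B + 1) / 2).
have e1 : 1 <= e.
  by rewrite -[leLHS]expR0 ler_expR addr_ge0 ?divr_ge0 ?mulr_ge0 ?addr_ge0 ?(ltW r0).
pose A := 20 + 8 * (B + r ^+ 2).
pose K := gnorm * smooth_cst R d.
have K0 : 0 <= K by rewrite mulr_ge0 ?ltW.
have A0 : 0 <= A by rewrite addr_ge0// mulr_ge0// addr_ge0// sqr_ge0.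
have e0 : 0 <= e by rewrite (le_trans _ e1).
have KeG : 0 <= K * e * G by rewrite mulr_ge0// mulr_ge0.
suff H : sq (err x) * f x <= A * (rho + K * e * G).
  have E : expR (near_rate * r) = expR (2 * r) * expR (r * (B + 1) / 2).
    by rewrite -expRD; congr expR; rewrite /near_rate; field.
  have AE : A <= (28 + 8 * B) * expR (2 * r).
    have e2 : 1 <= expR (2 * r) by rewrite (le_trans _ le_expR2)// -[leLHS](expr1n _ 2) lerXn2r ?nnegrE ?(ltW r0).
    have : 0 <= B * (expR (2 * r) - 1) by rewrite mulr_ge0// subr_ge0.
    by have := le_expR2; rewrite /A; lra.
  have KE : rho + K * e * G <= (1 + K) * e * (rho + G).
    rewrite mulrDr lerD//.
      rewrite ler_peMl ?(ltW rho0)// -[leLHS]mul1r ler_pM// lerDl//.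
    by rewrite ler_wpM2r// ler_wpM2r ?(le_trans _ e1)// lerDr.
  apply: (le_trans H); apply: (le_trans (ler_pM _ _ AE KE)) => //.
    by rewrite addr_ge0 ?(ltW rho0)// KeG.
  rewrite E /near_cst -/K /e expRD le_eqVlt; apply/orP; left; apply/eqP; ring.
(* Where f < rho, the crude bound on the error already gives a multiple of rho. *)
case: (leP rho (f x)) => rf; last first.
  have : sq (err x) * f x <= 8 * (B + r ^+ 2) * rho.
    apply: ler_pM; rewrite ?sq_ge0 ?(ltW (f0 x)) ?(ltW rf)//.
    apply: (le_trans (sq_rule_error_le M0 cp cq rho0 x)).
    by rewrite ler_pM2l// lerD2l.
  move/le_trans; apply; rewrite [leRHS]mulrDr -[leLHS]addr0 lerD//.
    by rewrite ler_wpM2r ?(ltW rho0)// /A; lra.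
  by rewrite mulr_ge0.
have H := sq_rule_error_density_le M0 cp cq rho0 rf.
have low := mix_density_lower M0 cp r0 xr.
pose k := gk 1 0 x.
have k0 : 0 < k by exact: gk_gt0.
(* The Gaussian factor of the squared bounds is absorbed by one factor f, at the price of [e], which
   is exp(O(r)). *)
have fe : gnorm * k <= f x * e.
  have e_gt0 : 0 < e := lt_le_trans ltr01 e1.
  rewrite -ler_pdivrMr// (le_trans _ low)// le_eqVlt; apply/orP; left; apply/eqP.
  rewrite -/k mulrAC; congr (_ * _); rewrite /e -expRN; congr (_ * expR _).
  by field.
have H2 : f x ^+ 2 * sq (err x) <= A * (gnorm ^+ 2 * (smooth_cst R d * k * G)).
  apply: (le_trans H); set P := gnorm ^+ 2 * (smooth_cst R d * k * G).
  have D2 : (f x - g x) ^+ 2 <= P := density_gap_le x.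
  have W2 : \sum_i (weighted_density M p i x - weighted_density M q i x) ^+ 2 <= 5 * P.
    have -> : 5 * P = gnorm ^+ 2 * (smooth_cst R d * k * (5 * G)) by rewrite /P; ring.
    exact: weighted_density_gap M0 p q x.
  have BX : 0 <= B + sq x by rewrite addr_ge0.
  have P0 : 0 <= P by rewrite (le_trans _ D2)// sqr_ge0.
  have : (f x - g x) ^+ 2 * (B + sq x) <= P * (B + r ^+ 2).
    by apply: ler_pM; rewrite ?sqr_ge0 ?lerD2l.
  by rewrite -mulrA; exact: near_arith.
have : sq (err x) * f x <= A * (K * e * G).
  rewrite -(ler_pM2l (f0 x)).
  have -> : f x * (sq (err x) * f x) = f x ^+ 2 * sq (err x) by ring.
  apply: (le_trans H2).
  have -> : A * (gnorm ^+ 2 * (smooth_cst R d * k * G)) =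
    A * (K * G) * (gnorm * k) by rewrite /K; ring.
  have -> : f x * (A * (K * e * G)) = A * (K * G) * (f x * e) by ring.
  by rewrite ler_wpM2l// mulr_ge0// mulr_ge0.
move/le_trans; apply; rewrite ler_wpM2l// lerDr ltW//.
Qed.

(** The upper bound on f carries exp(-|x|^2 / 4), which is split in three: exp(-|x|^2 / 16) absorbs
    the polynomial error bound, another such factor is at most rho, and exp(-|x|^2 / 8) stays for
    integration. *)
Lemma error_density_far x : r ^+ 2 <= sq x ->
  sq (err x) * f x <= far_cst * rho * gk (1 / 4) 0 x.
Proof.
move=> xr; have X0 := sq_ge0 x.
have H1 := sq_rule_error_le M0 cp cq rho0 x; have H2 := mix_density_upper M0 x cp.
have H3 : B + sq x <= (B + 16) * expR (sq x / 16).
  have := expR_ge1Dx (sq x / 16) => h.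
  have : 0 <= B * (expR (sq x / 16) - 1 - sq x / 16) by rewrite mulr_ge0//; lra.
  have : 0 <= B * (sq x / 16) by rewrite mulr_ge0// divr_ge0.
  lra.
have H4 : expR (- (sq x / 16)) <= rho.
  by apply: le_trans r_rho; rewrite ler_expR; lra.
apply: (le_trans (ler_pM _ _ H1 H2)); rewrite ?sq_ge0 ?(ltW (f0 x))//.
apply: (@le_trans _ _ (8 * ((B + 16) * expR (sq x / 16)) * (gnorm * expR (B / 2) * gk (1 / 2) 0 x))).
  apply: ler_wpM2r; last exact: (ler_wpM2l (ler0n _ 8) H3).
  exact: mulr_ge0 (mulr_ge0 (ltW gn0) (expR_ge0 _)) (gk_ge0 _ _ _).
have -> : 8 * ((B + 16) * expR (sq x / 16)) * (gnorm * expR (B / 2) * gk (1 / 2) 0 x) =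
    far_cst * expR (- (sq x / 16)) * gk (1 / 4) 0 x.
  have -> : gk (1 / 2) 0 x = expR (- (sq x / 16)) * expR (- (sq x / 16)) * gk (1 / 4) 0 x.
    by rewrite /gk -!expRD; congr expR; rewrite sub0r sqN; field.
  have e16 : expR (sq x / 16) * expR (- (sq x / 16)) = 1.
    by rewrite -expRD subrr expR0.
  rewrite /far_cst; move: e16; move: (expR (sq x / 16)) (expR (- (sq x / 16))) => a b ab.
  transitivity (8 * (B + 16) * (gnorm * expR (B / 2)) * b * gk (1 / 4) 0 x * (a * b)); first by ring.
  by rewrite ab; ring.
apply: (ler_wpM2r (gk_ge0 _ _ _)); apply: ler_wpM2l H4.
apply: mulr_ge0 (expR_ge0 _); apply: mulr_ge0 (ltW gn0).
by rewrite mulr_ge0// addr_ge0.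
Qed.

End regret_bound.

Lemma measurable_invr_gt0 d (T : measurableType d) (R : realType) (h : T -> R) :
  (forall x, 0 < h x) -> measurable_fun setT h -> measurable_fun setT (fun x => (h x)^-1).
Proof.
move=> h0 mh; rewrite (_ : (fun x => (h x)^-1) = (fun x => expR (- ln (h x)))).
  by apply: measurableT_comp => //; apply: measurable_funN; exact: measurableT_comp.
by apply/funext => x; rewrite expRN lnK// posrE.
Qed.

Section regret_integral.
Context {R : realType} (d : nat) (M : R).
Hypothesis M0 : 0 <= M.
Variables (p q : probability 'rV[R]_d R) (rho : R).
Hypotheses (cp : carried M p) (cq : carried M q) (rho0 : 0 < rho).
Implicit Types (x : 'rV[R]_d).
Local Notation err := (rule_error p q rho).
Local Notation G := (gap M p q (8 / 5)).

Lemma measurable_grad_mix_density r i : carried M r ->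
  measurable_fun setT (fun x => grad (mix_density r) x 0 i).
Proof.
move=> cr; rewrite (_ : (fun x => _) =
  (fun x => weighted_density M r i x - x 0 i * mix_density r x)); last first.
  by apply/funext => x; rewrite (grad_mix_density M0).
apply: measurable_funB.
  apply: measurable_funM => //; apply: measurable_smooth => //.
    exact: measurable_clip.
  exact: (bddm_coord (@measurable_clip R d M) (sq_clip M0)).
by apply: measurable_funM; [exact: measurable_coord|exact: measurable_mix_density].
Qed.

Lemma measurable_rule_error : measurable_fun setT (fun x => sq (err x)).
Proof.
under eq_fun do rewrite sqE; apply: measurable_sum => i; apply: measurable_funX.
have E x : err x 0 i =
    (x 0 i + (Num.max (mix_density q x) rho)^-1 * grad (mix_density q) x 0 i) -
    (x 0 i + (mix_density p x)^-1 * grad (mix_density p) x 0 i) by rewrite !mxE.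
under eq_fun do rewrite E; apply: measurable_funB.
  apply: measurable_funD; first exact: measurable_coord.
  apply: measurable_funM; last exact: measurable_grad_mix_density.
  apply: measurable_invr_gt0 => [x|]; first by rewrite lt_max rho0 orbT.
  by apply: measurable_maxr => //; exact: measurable_mix_density.
apply: measurable_funD; first exact: measurable_coord.
apply: measurable_funM; last exact: measurable_grad_mix_density.
apply: measurable_invr_gt0 => [x|]; first exact: (mix_density_gt0 M0).
exact: measurable_mix_density.
Qed.

Definition regret_cst : R :=
  near_cst d M * expR 2^-1 * Num.sqrt (2 * pi) ^+ d + far_cst d M * gc d (1 / 4).

Definition regret_exp : R := near_rate d M + d%:R.

Lemma near_cst_ge0 : 0 <= near_cst d M.
Proof.
have B0 := sqradius_ge0 d M; rewrite /near_cst mulr_ge0 ?expR_ge0//.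
apply: mulr_ge0; first by rewrite addr_ge0// mulr_ge0.
apply: addr_ge0 => //; apply: mulr_ge0; apply: ltW.
  exact: gnorm_gt0.
exact: smooth_cst_gt0.
Qed.

Lemma far_cst_ge0 : 0 <= far_cst d M.
Proof.
have B0 := sqradius_ge0 d M; rewrite /far_cst mulr_ge0 ?expR_ge0//.
apply: mulr_ge0; first by rewrite mulr_ge0// addr_ge0.
by apply: ltW; exact: gnorm_gt0.
Qed.

(** On the ball the bound is constant in x; the indicator of the ball is replaced by exp(1/2) times
    a Gaussian of variance r^2, whose mass grows like r^d <= exp(d r). This is the summand [d%:R] in
    [regret_exp]. *)
Lemma regret_bound r : 1 <= r -> expR (- (r ^+ 2 / 16)) <= rho ->
  (regret p (mix_density q) rho <=
    (regret_cst * expR (regret_exp * r) * (rho + G))%:E)%E.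
Proof.
move=> r1 r_rho; have r0 : 0 < r by rewrite (lt_le_trans _ r1).
have G0 : 0 <= G by apply: (gap_ge0 M0); rewrite divr_ge0.
have N0 := near_cst_ge0; have F0 := far_cst_ge0.
have rG : 0 <= rho + G by rewrite addr_ge0// ltW.
pose a := near_cst d M * expR (near_rate d M * r) * (rho + G) * expR 2^-1.
pose b := far_cst d M * rho.
have NE : 0 <= near_cst d M * expR (near_rate d M * r) * (rho + G).
  exact: mulr_ge0 (mulr_ge0 N0 (expR_ge0 _)) rG.
have a0 : 0 <= a by exact: mulr_ge0 NE (expR_ge0 _).
have b0 : 0 <= b by exact: mulr_ge0 F0 (ltW rho0).
pose U x := a * gk (1 / r ^+ 2) 0 x + b * gk (1 / 4) 0 x.
have Up x : sq (err x) * mix_density p x <= U x.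
  case: (leP (sq x) (r ^+ 2)) => xr.
    apply: (le_trans (error_density_near M0 cp cq rho0 r1 xr)).
    have e1 : 1 <= expR 2^-1 * gk (1 / r ^+ 2) 0 x.
      rewrite /gk -expRD -[leLHS]expR0 ler_expR sub0r sqN.
      have : sq x / r ^+ 2 <= 1 by rewrite ler_pdivrMr ?exprn_gt0// mul1r.
      by rewrite div1r; lra.
    have := ler_wpM2l NE e1; rewrite mulr1 mulrA => h; apply: (le_trans h).
    by rewrite lerDl; exact: mulr_ge0 b0 (gk_ge0 _ _ _).
  apply: (le_trans (error_density_far M0 cp cq rho0 r_rho (ltW xr))).
  by rewrite lerDr; exact: mulr_ge0 a0 (gk_ge0 _ _ _).
have p1 : 0 < 1 / r ^+ 2 by rewrite divr_gt0 ?exprn_gt0.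
have p2 : 0 < 1 / 4 :> R by rewrite divr_gt0.
have i1 := integrable_gk (0 : 'rV[R]_d) p1; have i2 := integrable_gk (0 : 'rV[R]_d) p2.
have iU : (lebesgue_row d).-integrable setT (EFin \o U).
  exact: (integrableD measurableT (integrableZl measurableT a i1)
    (integrableZl measurableT b i2)).
rewrite /regret; under eq_integral do rewrite enorm_sq.
rewrite (ge0_integral_mix_law p measurable_rule_error (fun x => sq_ge0 _)).
apply: (@le_trans _ _ (\int[lebesgue_row d]_x (U x)%:E)%E).
  apply: ge0_le_integral => //.
  - by move=> x _; rewrite lee_fin mulr_ge0 ?sq_ge0 ?mix_density_ge0.
  - apply/measurable_EFinP/measurable_funM; first exact: measurable_rule_error.
    exact: measurable_mix_density.
  - by case/integrableP : iU.
  - by move=> x _; rewrite lee_fin.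
rewrite -EFin_Rintegral// lee_fin RintegralD//; last 2 first.
- exact: (integrableZl measurableT a i1).
- exact: (integrableZl measurableT b i2).
rewrite (RintegralZl a measurableT i1) (RintegralZl b measurableT i2) !Rintegral_gk//.
have gr : gc d (1 / r ^+ 2) <= Num.sqrt (2 * pi) ^+ d * expR (d%:R * r).
  rewrite /gc div1r invrK sqrtrM ?mulr_ge0 ?pi_ge0// sqrtr_sqr gtr0_norm// exprMn.
  rewrite ler_wpM2l ?exprn_ge0 ?sqrtr_ge0// expRM_natl lerXn2r ?nnegrE ?expR_ge0 ?ltW//.
  by have := expR_gt1Dx (lt0r_neq0 r0); lra.
have -> : regret_cst * expR (regret_exp * r) * (rho + G) =
    a * (Num.sqrt (2 * pi) ^+ d * expR (d%:R * r)) +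
    far_cst d M * gc d (1 / 4) * (rho + G) * expR (regret_exp * r).
  have E : expR (regret_exp * r) = expR (near_rate d M * r) * expR (d%:R * r).
    by rewrite -expRD -mulrDl.
  by rewrite /regret_cst /a E; ring.
rewrite lerD ?ler_wpM2l//.
have g4 : 0 < gc d (1 / 4) :> R by exact: gc_gt0.
have -> : b * gc d (1 / 4) = far_cst d M * gc d (1 / 4) * rho * 1 by rewrite /b; ring.
have c0 : 0 <= far_cst d M * gc d (1 / 4) by rewrite mulr_ge0// ltW.
apply: ler_pM => //; first by rewrite mulr_ge0// ltW.
  by rewrite ler_wpM2l// lerDl.
rewrite -[leLHS]expR0 ler_expR mulr_ge0 ?(ltW r0)// /regret_exp /near_rate.
by rewrite !addr_ge0// mulr_ge0// addr_ge0// sqradius_ge0.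
Qed.

End regret_integral.

(** * Total variation and the minimum distance estimator *)

Section carrier.
Context {R : realType} (d : nat).
Implicit Types (U : set 'rV[R]_d) (p : probability 'rV[R]_d R).

(** Boxes with rational centres and radii 1 / (m + 1) form a countable base of the topology, and
    each is a finite intersection of coordinate conditions. *)
Let box (b : 'rV[rat]_d * nat) : set 'rV[R]_d :=
  [set x | forall i, ball (ratr (b.1 0 i) : R) b.2.+1%:R^-1 (x 0 i)].

Let measurable_box b : measurable (box b).
Proof.
rewrite (_ : box b = \bigcap_(i in [set: 'I_d])
  ((fun x : 'rV[R]_d => x 0 i) @^-1` ball (ratr (b.1 0 i) : R) b.2.+1%:R^-1)).
  apply: fin_bigcap_measurable => [|i _]; first exact: finite_finset.
  rewrite -[X in measurable X]setTI; apply: measurable_coord => //.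
  exact: measurable_ball.
by apply/seteqP; split=> [x bx i _|x bx i]; exact: bx.
Qed.

Let open_box U x : open U -> U x -> exists2 b, box b x & box b `<=` U.
Proof.
move=> oU Ux; have /nbhs_ballP[e /= e0 eU] : nbhs x U by exact: open_nbhs_nbhs.
pose k := Num.trunc (2 / e).
have ke : k.+1%:R^-1 * 2 < e.
  by rewrite -ltr_pdivlMr// invf_plt ?posrE ?divr_gt0// invf_div; exact: truncnS_gt.
have k0 : 0 < k.+1%:R^-1 :> R by rewrite invr_gt0.
have ex i : exists q : rat, `|ratr q - x 0 i| < k.+1%:R^-1.
  have /rat_in_itvoo[q] : x 0 i - k.+1%:R^-1 < x 0 i + k.+1%:R^-1.
    by rewrite ltrD2l (lt_trans _ k0)// oppr_lt0.
  by rewrite in_itv/= => /andP[h1 h2]; exists q; rewrite ltr_norml; apply/andP; split; [rewrite ltrBrDl|rewrite ltrBlDl].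
pose c i := sval (cid (ex i)).
have cE i : `|ratr (c i) - x 0 i| < k.+1%:R^-1 by rewrite /c; case: cid.
exists (\row_i c i, k) => [i|y yb]; first by rewrite /= mxE; exact: cE.
apply: eU; split=> // j i; rewrite (ord1 j); have := yb i; rewrite /= mxE => h.
have yx : `|x 0 i - y 0 i| <= `|x 0 i - ratr (c i)| + `|ratr (c i) - y 0 i|.
  exact: ler_distD.
apply: (le_lt_trans yx); apply: lt_trans ke; rewrite mulr_natr mulr2n.
by apply: ltrD => //; rewrite distrC.
Qed.

Let boxes (P : set ('rV[rat]_d * nat)) (n : nat) : set 'rV[R]_d :=
  if @unpickle ('rV[rat]_d * nat)%type n is Some b then
    if `[< P b >] then box b else set0 else set0.

Let bigcup_boxes P x : (exists2 b, P b & box b x) -> (\bigcup_n boxes P n) x.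
Proof.
move=> [b Pb bx]; exists (pickle b) => //; rewrite /boxes pickleK.
by case: asboolP.
Qed.

Let boxes_sub P U n : (forall b, P b -> box b `<=` U) -> boxes P n `<=` U.
Proof.
move=> PU x; rewrite /boxes; case: unpickle => // b; case: asboolP => // Pb.
exact: PU.
Qed.

Let measurable_boxes P n : measurable (boxes P n).
Proof. by rewrite /boxes; case: unpickle => // b; case: asboolP. Qed.

(** The sigma-algebra is generated by the coordinates, so an open set is reached as the countable
    union of the boxes it contains. *)
Lemma open_measurable_row U : open U -> measurable U.
Proof.
move=> oU; rewrite (_ : U = \bigcup_n boxes [set b | box b `<=` U] n).
  exact: bigcupT_measurable.
apply/seteqP; split=> x; last by move=> [n _]; exact: boxes_sub.
by move=> Ux; apply: bigcup_boxes; have [b bx bU] := open_box oU Ux; exists b.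
Qed.

(** Each point outside the support lies in a null box, and there are countably many boxes. *)
Lemma msupport_carried p (M : R) : msupport p `<=` cube M -> carried M p.
Proof.
move=> pM; have mC : measurable (~` cube M : set 'rV[R]_d).
  by apply: measurableC; exact: measurable_cube.
pose P : set ('rV[rat]_d * nat) := [set b | p (box b) = 0%E].
apply/negligibleP => //; apply: (@negligibleS _ _ _ p (\bigcup_n boxes P n)).
  move=> x /= nx; apply: bigcup_boxes.
  have /existsNP[U /not_implyP[oU /not_implyP[Ux /negP]]] : ~ msupport p x.
    by apply: contra_not nx; exact: pM.
  rewrite -leNgt => pU; have [b bx bU] := open_box oU Ux; exists b => //.
  apply/eqP; rewrite eq_le measure_ge0 andbT (le_trans _ pU)//.
  by apply: le_measure => //; rewrite inE//; exact: open_measurable_row.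
apply: negligible_bigcup => n; rewrite /boxes; case: unpickle => [b|]; last exact: negligible_set0.
case: asboolP => Pb; last exact: negligible_set0.
by apply/negligibleP.
Qed.

End carrier.

Section signed_density.
Context d (T : measurableType d) (R : realType).
Variables (mu : {measure set T -> \bar R}) (h : T -> R).
Hypothesis ih : mu.-integrable setT (EFin \o h).

Let mh : measurable_fun setT h.
Proof. by apply/measurable_EFinP; case/integrableP : ih. Qed.

(** Pointwise |h| = 2 max(h, 0) - h. When h has integral zero, the L1 norm is thus read off a single
    set. *)
Lemma Rintegral_norm_split :
  \int[mu]_x `|h x| = 2 * \int[mu]_(x in [set x | 0 <= h x]) h x - \int[mu]_x h x.
Proof.
have E : h \_ [set x | 0 <= h x] = fun x => Num.max (h x) 0.
  apply/funext => x; rewrite patchE; case: ifPn.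
    by rewrite inE/= => h0; rewrite (max_idPl h0).
  by rewrite notin_setE/= => /negP; rewrite -ltNge => h0; rewrite (max_idPr (ltW h0)).
have im : mu.-integrable setT (EFin \o (fun x => Num.max (h x) 0)).
  apply: (le_integrable _ _ _ ih) => //.
    by apply/measurable_EFinP; exact: measurable_maxr.
  by move=> x _ /=; rewrite lee_fin; case: (leP (h x) 0); rewrite ?normr0.
rewrite [X in 2 * X]Rintegral_mkcond E -(RintegralZl 2 measurableT im) -RintegralB//; last first.
  exact: (integrableZl measurableT 2 im).
apply: eq_Rintegral => x _; case: (leP (h x) 0) => h0.
  by rewrite ler0_norm//; ring.
by rewrite gtr0_norm//; ring.
Qed.

Lemma norm_Rintegral_set_le A : measurable A ->
  `|\int[mu]_(x in A) h x| <= \int[mu]_x `|h x|.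
Proof.
move=> mA; rewrite Rintegral_mkcond.
apply: (le_norm_Rintegral _ (integrable_norm ih) _).2.
  by apply/(measurable_restrict _ mA measurableT); rewrite setTI; exact: measurable_funTS.
by move=> x; rewrite patchE /=; case: ifP => _; rewrite ?normr0 ?normr_ge0 ?lexx.
Qed.

End signed_density.

(** * Total variation and Yatracos sets *)

Section total_variation_facts.
Context d (T : measurableType d) (R : realType).
Implicit Types P Q : probability T R.
Local Open Scope charge_scope.

Let rn P Q (r : probability T R) := 'd (charge_of_finite_measure r) '/d (sum_measure P Q).

Let rn_diff P Q x : R := fine (rn P Q P x) - fine (rn P Q Q x).

Let dom1 P Q : charge_of_finite_measure P `<< sum_measure P Q.
Proof.
apply/null_content_dominatesP => A mA A0; apply/eqP; rewrite eq_le measure_ge0 andbT.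
apply: (@le_trans _ _ (measure_add P Q A)); first by rewrite measure_addE leeDl.
by rewrite -[leRHS]A0.
Qed.

Let dom2 P Q : charge_of_finite_measure Q `<< sum_measure P Q.
Proof.
apply/null_content_dominatesP => A mA A0; apply/eqP; rewrite eq_le measure_ge0 andbT.
apply: (@le_trans _ _ (measure_add P Q A)); first by rewrite measure_addE leeDr.
by rewrite -[leRHS]A0.
Qed.

Let rnE P Q (r : probability T R) x : charge_of_finite_measure r `<< sum_measure P Q ->
  rn P Q r x = (fine (rn P Q r x))%:E.
Proof. by move=> dr; rewrite fineK// Radon_Nikodym_fin_num. Qed.

Let rn_int P Q (r : probability T R) : charge_of_finite_measure r `<< sum_measure P Q ->
  (sum_measure P Q).-integrable setT (EFin \o (fun x => fine (rn P Q r x))).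
Proof.
move=> dr; rewrite (_ : _ \o _ = rn P Q r); first exact: Radon_Nikodym_integrable.
by apply/funext => x /=; rewrite -rnE.
Qed.

Let rn_val P Q (r : probability T R) A : charge_of_finite_measure r `<< sum_measure P Q ->
  measurable A -> fine (r A) = \int[sum_measure P Q]_(x in A) fine (rn P Q r x).
Proof.
move=> dr mA; congr fine; rewrite [LHS](Radon_Nikodym_integral dr mA).
by apply: eq_integral => x _; exact: rnE.
Qed.

Let rn_diff_int P Q : (sum_measure P Q).-integrable setT (EFin \o rn_diff P Q).
Proof.
have i := integrableB measurableT (rn_int (r := P) (@dom1 P Q)) (rn_int (r := Q) (@dom2 P Q)).
by apply: eq_integrable i.
Qed.

Let rn_diff_val P Q A : measurable A ->
  fine (P A) - fine (Q A) = \int[sum_measure P Q]_(x in A) rn_diff P Q x.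
Proof.
move=> mA; rewrite (rn_val (r := P) (@dom1 P Q) mA) (rn_val (r := Q) (@dom2 P Q) mA) -RintegralB//.
- by apply: integrableS (rn_int (r := P) (@dom1 P Q)).
- by apply: integrableS (rn_int (r := Q) (@dom2 P Q)).
Qed.

Let tv_diff P Q : tv P Q = (2^-1 * \int[sum_measure P Q]_x `|rn_diff P Q x|)%:E.
Proof.
rewrite /tv EFinM (EFin_Rintegral (integrable_norm (rn_diff_int P Q))).
congr (_ * _)%E; apply: eq_integral => x _.
by rewrite [X in (X - _)%E](rnE (r := P) x (@dom1 P Q)) [X in (_ - X)%E](rnE (r := Q) x (@dom2 P Q)).
Qed.

Lemma norm_probB_le P Q A (c : R) : measurable A -> (tv P Q <= c%:E)%E ->
  `|fine (P A) - fine (Q A)| <= 2 * c.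
Proof.
move=> mA; rewrite tv_diff lee_fin => h; rewrite rn_diff_val//.
have := norm_Rintegral_set_le (rn_diff_int P Q) mA; lra.
Qed.

Let yatracos_setE P Q : yatracos_set P Q = [set x | 0 <= rn_diff P Q x].
Proof.
apply/seteqP; split=> x; rewrite /yatracos_set /rn_diff /= subr_ge0.
  by rewrite [X in (X <= _)%E](rnE (r := Q) x (@dom2 P Q)) [X in (_ <= X)%E](rnE (r := P) x (@dom1 P Q)).
by rewrite [X in (X <= _)%E](rnE (r := Q) x (@dom2 P Q)) [X in (_ <= X)%E](rnE (r := P) x (@dom1 P Q)).
Qed.

Lemma measurable_yatracos_set P Q : measurable (yatracos_set P Q).
Proof.
rewrite yatracos_setE -[X in measurable X]setTI.
have m : measurable_fun setT (rn_diff P Q).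
  by apply/measurable_EFinP; case/integrableP : (rn_diff_int P Q).
have := m measurableT `[0, +oo[%classic (measurable_itv _).
congr measurable; apply/seteqP; split=> x /=; rewrite in_itv/= andbT//.
Qed.

(** The Yatracos set is where the density difference is nonnegative, and that difference has
    integral zero, so half its L1 norm is attained on this set. *)
Lemma tv_yatracos P Q : tv P Q =
  (fine (P (yatracos_set P Q)) - fine (Q (yatracos_set P Q)))%:E.
Proof.
rewrite tv_diff (Rintegral_norm_split (rn_diff_int P Q)).
rewrite -yatracos_setE -(rn_diff_val P Q (measurable_yatracos_set P Q)).
rewrite -(rn_diff_val P Q measurableT).
by rewrite !probability_setT subrr subr0 mulrA mulVf ?mul1r.
Qed.

End total_variation_facts.

Lemma fine_prob_itv d (T : measurableType d) (R : realType) (P : probability T R) A :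
  measurable A -> 0 <= fine (P A) <= 1.
Proof.
move=> mA; rewrite fine_ge0//= -lee_fin fineK ?fin_num_measure//; exact: probability_le1.
Qed.

Section mixture_events.
Context {R : realType} (d : nat).
Implicit Types (p q : probability 'rV[R]_d R).

Let integrable_mixB p q : (lebesgue_row d).-integrable setT
  (EFin \o (fun x => mix_density p x - mix_density q x)).
Proof.
have i := integrableB measurableT (integrable_mix_density p) (integrable_mix_density q).
by apply: eq_integrable i.
Qed.

Lemma mix_lawB p q A : measurable A -> fine (mix_law p A) - fine (mix_law q A) =
  \int[lebesgue_row d]_(x in A) (mix_density p x - mix_density q x).
Proof.
move=> mA; rewrite RintegralB//.
- by apply: integrableS (integrable_mix_density p).
- by apply: integrableS (integrable_mix_density q).
Qed.

Lemma norm_mix_lawB_le p q A : measurable A ->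
  `|fine (mix_law p A) - fine (mix_law q A)| <= l1_dist p q.
Proof.
by move=> mA; rewrite mix_lawB//; exact: (norm_Rintegral_set_le (integrable_mixB p q) mA).
Qed.

Lemma l1_dist_le p q (c : R) :
  (forall A, measurable A -> fine (mix_law p A) - fine (mix_law q A) <= c) ->
  l1_dist p q <= 2 * c.
Proof.
move=> H; have mA : measurable [set x : 'rV[R]_d | 0 <= mix_density p x - mix_density q x].
  have m : measurable_fun setT (fun x : 'rV[R]_d => mix_density p x - mix_density q x).
    by apply: measurable_funB; exact: measurable_mix_density.
  rewrite -[X in measurable X]setTI.
  have := m measurableT `[0, +oo[%classic (measurable_itv _).
  by congr measurable; apply/seteqP; split=> x /=; rewrite in_itv/= andbT.
rewrite /l1_dist (Rintegral_norm_split (integrable_mixB p q)).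
rewrite -(mix_lawB p q mA) -(mix_lawB p q measurableT).
have : fine (mix_law p setT) - fine (mix_law q setT) = 0.
  by rewrite (probability_setT (mix_law p)) (probability_setT (mix_law q)) subrr.
by have := H _ mA; lra.
Qed.

End mixture_events.

Section yatracos.
Context {R : realType} (d : nat).
Implicit Types (p q : probability 'rV[R]_d R).

(** On any event the two mixtures differ from their centres by at most 2 eta each. The centres
    differ by at most twice their total variation, which is attained on a set of the class and is
    therefore at most 4 eta + e. The sum is 12 eta + 2 e, and the L1 distance is at most twice
    that. *)
Lemma yatracos_l1 (C : set (probability 'rV[R]_d R)) (eta e : R) N
    (Q : 'I_N -> probability 'rV[R]_d R) p q :
  tv_covering C eta Q -> C (mix_law p) -> C (mix_law q) ->
  (forall A, yatracos_class Q A -> `|fine (mix_law p A) - fine (mix_law q A)| <= e) ->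
  0 <= e -> l1_dist p q <= 24 * eta + 4 * e.
Proof.
move=> covQ Cp Cq He e0; have [i Pi] := covQ _ Cp; have [j Qj] := covQ _ Cq.
have -> : 24 * eta + 4 * e = 2 * (12 * eta + 2 * e) by ring.
apply: l1_dist_le => A mA.
have h1 := norm_probB_le mA Pi; have h2 := norm_probB_le mA Qj.
(* The class only compares distinct centres; with a common centre the two covering bounds
   suffice. *)
have [eij|nij] := eqVneq i j.
  move: h1 h2; rewrite -eij !ler_norml => /andP[_ h1] /andP[h2 _].
  have : 0 <= `|fine (mix_law p A) - fine (Q i A)| by [].
  have := norm_probB_le mA Pi; lra.
pose Y := yatracos_set (Q i) (Q j).
have mY : measurable Y by exact: measurable_yatracos_set.
have AY : yatracos_class Q Y by exists i, j.
have t : (tv (Q i) (Q j) <= (fine (Q i Y) - fine (Q j Y))%:E)%E by rewrite tv_yatracos.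
have h3 := norm_probB_le mA t.
have h4 := norm_probB_le mY Pi; have h5 := norm_probB_le mY Qj; have h6 := He _ AY.
move: h1 h2 h3 h4 h5 h6; rewrite !ler_norml.
move=> /andP[? ?] /andP[? ?] /andP[? ?] /andP[? ?] /andP[? ?] /andP[? ?]; lra.
Qed.

Lemma empiricalE n (X : n.-tuple 'rV[R]_d) A :
  fine (empirical R X A) = n%:R^-1 * \sum_(i < n) \1_A (tnth X i).
Proof.
rewrite /empirical (eq_bigr (fun i => (\1_A (tnth X i))%:E)); last first.
  by move=> i _; rewrite diracE indicE.
by rewrite sumEFin -EFinM.
Qed.

Lemma empirical_itv n (X : n.-tuple 'rV[R]_d) A : (0 < n)%N ->
  0 <= fine (empirical R X A) <= 1.
Proof.
move=> n0; rewrite empiricalE mulr_ge0 ?invr_ge0 ?sumr_ge0//=.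
rewrite mulrC ler_pdivrMr ?ltr0n// mul1r.
have -> : n%:R = \sum_(i < n) 1 :> R by rewrite sumr_const card_ord.
apply: ler_sum => i _.
by rewrite indicE; case: (_ \in _).
Qed.

Lemma dist_class_le (T : Type) (AA : set (set T)) (P1 P2 : set T -> \bar R) (c : R) :
  0 <= c -> (forall A, AA A -> `|fine (P1 A) - fine (P2 A)| <= c) ->
  dist_class AA P1 P2 <= c.
Proof.
move=> c0 H; rewrite /dist_class; set S := [set _ | _ in _].
(* With fewer than two centres the class is empty and [sup] takes its default value 0. *)
have [S0|S0] := pselect (S !=set0).
  by apply: ge_sup => // _ [A AA_A <-]; exact: H.
by rewrite sup_out// => -[].
Qed.

Lemma le_dist_class (T : Type) (AA : set (set T)) (P1 P2 : set T -> \bar R) (c : R) A :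
  (forall A, AA A -> `|fine (P1 A) - fine (P2 A)| <= c) -> AA A ->
  `|fine (P1 A) - fine (P2 A)| <= dist_class AA P1 P2.
Proof.
move=> H AA_A; apply: ub_le_sup; last by exists A.
by exists c => _ [A' AA_A' <-]; exact: H.
Qed.

Lemma norm_contaminateB_le (eps : {i01 R}) (P Q : probability 'rV[R]_d R) A :
  measurable A -> `|fine (P A) - fine (contaminate eps P Q A)| <= eps%:num.
Proof.
move=> mA; have /andP[p0 p1] := fine_prob_itv P mA; have /andP[q0 q1] := fine_prob_itv Q mA.
have e0 : 0 <= eps%:num by [].
have -> : fine (contaminate eps P Q A) = (1 - eps%:num) * fine (P A) + eps%:num * fine (Q A).
  rewrite /contaminate measure_addE /= /mscale/= -[P A]fineK ?fin_num_measure//.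
  by rewrite -[Q A]fineK ?fin_num_measure.
have -> : fine (P A) - ((1 - eps%:num) * fine (P A) + eps%:num * fine (Q A)) =
  eps%:num * (fine (P A) - fine (Q A)) by ring.
rewrite normrM ger0_norm// ler_piMr// ler_norml; lra.
Qed.

(** On the class, the true mixture is within eps of the sampling law and hence within eps + h of the
    empirical measure; by minimality so is the estimate. The two mixtures thus differ by at most 2
    (eps + h) there. *)
Lemma yatracos_estimator_l1 (C : set (probability 'rV[R]_d R)) (eta h : R) N
    (Q : 'I_N -> probability 'rV[R]_d R) p q (eps : {i01 R}) Q0 n
    (X : n.-tuple 'rV[R]_d) :
  (0 < n)%N -> tv_covering C eta Q -> C (mix_law p) -> C (mix_law q) ->
  dist_class (yatracos_class Q) (mix_law q) (empirical R X) <=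
    dist_class (yatracos_class Q) (mix_law p) (empirical R X) ->
  0 <= h -> (forall A, yatracos_class Q A ->
    `|fine (contaminate eps (mix_law p) Q0 A) - fine (empirical R X A)| <= h) ->
  l1_dist p q <= 24 * eta + 8 * (eps%:num + h).
Proof.
move=> n0 covQ Cp Cq argmin h0 Hh.
have mAA A : yatracos_class Q A -> measurable A.
  by move=> [i [j [_ ->]]]; exact: measurable_yatracos_set.
have e0 : 0 <= eps%:num + h by rewrite addr_ge0.
have HP A : yatracos_class Q A ->
    `|fine (mix_law p A) - fine (empirical R X A)| <= eps%:num + h.
  move=> AA; apply: le_trans (ler_distD (fine (contaminate eps (mix_law p) Q0 A)) _ _) _.
  by apply: lerD; [exact: norm_contaminateB_le (mAA _ AA)|exact: Hh].
have HQ A : yatracos_class Q A ->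
    `|fine (mix_law q A) - fine (empirical R X A)| <= eps%:num + h.
  move=> AA; apply: (@le_trans _ _ (dist_class (yatracos_class Q) (mix_law q) (empirical R X))).
    apply: (@le_dist_class _ _ _ _ 1) => // A' AA'.
    have /andP[? ?] := fine_prob_itv (mix_law q) (mAA _ AA').
    have /andP[? ?] := empirical_itv X A' n0; rewrite ler_norml; lra.
  by apply: (le_trans argmin); exact: dist_class_le.
have -> : 24 * eta + 8 * (eps%:num + h) = 24 * eta + 4 * (2 * (eps%:num + h)) by ring.
apply: (yatracos_l1 covQ) => // [A AA|]; last by rewrite mulr_ge0.
have := HP _ AA; have := HQ _ AA; rewrite !ler_norml.
move=> /andP[? ?] /andP[? ?]; lra.
Qed.

End yatracos.

(** * Deviations of the empirical measure *)

(** Multiply by exp(-y), which is at least (1 - y/2)^2: the claim reduces to (1 + y + 2 y^2) (1 -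
    y/2)^2 - 1 = y^2 (1 - y) (5 - 2 y) / 4 >= 0. *)
Lemma expR_le_quad (R : realType) (y : R) : `|y| <= 1 -> expR y <= 1 + y + 2 * y ^+ 2.
Proof.
rewrite ler_norml => /andP[y1 y2]; set z := expR (- (y / 2)).
have z1 : 1 - y / 2 <= z by exact: expR_ge1Dx.
have zE : expR y * z ^+ 2 = 1.
  by rewrite expr2 /z -!expRD -[RHS]expR0; congr expR; field.
have z0 : 0 < z ^+ 2 by rewrite exprn_gt0// expR_gt0.
rewrite -(ler_pM2r z0) zE.
have : (1 - y / 2) ^+ 2 <= z ^+ 2 by rewrite lerXn2r// nnegrE; lra.
have q0 : 0 <= 1 + y + 2 * y ^+ 2 by have := sqr_ge0 (y + 1 / 4); lra.
move=> h; apply: le_trans (ler_wpM2l q0 h).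
have : 0 <= y ^+ 2 * ((1 - y) * (5 - 2 * y)).
  by apply: mulr_ge0; [exact: sqr_ge0|apply: mulr_ge0; lra].
lra.
Qed.

Section concentration.
Context d (T : measurableType d) (R : realType).
Variable P : probability T R.

Let centered (A : set T) (x : T) : R := \1_A x - fine (P A).

Let measurable_centered A : measurable A -> measurable_fun setT (centered A).
Proof. by move=> mA; apply: measurable_funB => //; exact: measurable_indic. Qed.

Let norm_centered A x : measurable A -> `|centered A x| <= 1.
Proof.
move=> mA; have /andP[p0 p1] := fine_prob_itv P mA.
by rewrite /centered indicE; case: (x \in A); rewrite ler_norml /=; lra.
Qed.

Let bddm_centered A : measurable A -> bddm (centered A).
Proof.
by move=> mA; split; [exact: measurable_centered|exists 1 => x; exact: norm_centered].
Qed.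

Let Rintegral_centered A : measurable A -> \int[P]_x centered A x = 0.
Proof.
move=> mA; have bi : bddm (fun x => \1_A x : R).
  split; first exact: measurable_indic.
  by exists 1 => x; rewrite indicE; case: (_ \in _); rewrite ?normr0 ?normr1.
rewrite RintegralB//; [|exact: bddm_int bi|exact: bddm_int (bddm_cst _ _)].
have -> : \int[P]_x \1_A x = fine (P A) by rewrite /Rintegral integral_indic// setIT.
have -> : \int[P]_x fine (P A) = fine (P A) * fine (P setT) by exact: Rintegral_cst.
by rewrite probability_setT mulr1 subrr.
Qed.

Let mgf_le A (l : R) : measurable A -> `|l| <= 1 ->
  \int[P]_x expR (l * centered A x) <= expR (2 * l ^+ 2).
Proof.
move=> mA l1; have bc := bddm_centered mA.
apply: (@le_trans _ _ (\int[P]_x (1 + 2 * l ^+ 2 + l * centered A x))).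
  apply: le_Rintegral => //.
  - by apply: bddm_int; apply: bddm_expR; exact: bddmZ.
  - by apply: bddm_int; apply: bddmD; [exact: bddm_cst|exact: bddmZ].
  move=> x _; have c1 := norm_centered x mA.
  have lc : `|l * centered A x| <= 1 by rewrite normrM mulr_ile1.
  apply: (le_trans (expR_le_quad lc)).
  have : (l * centered A x) ^+ 2 <= l ^+ 2.
    rewrite exprMn ler_piMr ?sqr_ge0// -real_normK ?num_real//.
    by rewrite expr_le1.
  lra.
rewrite RintegralD//; [|exact: bddm_int (bddm_cst _ _)|by apply: bddm_int; exact: bddmZ].
rewrite RintegralZl//; last exact: bddm_int.
rewrite Rintegral_centered// mulr0 addr0.
have -> : \int[P]_x (1 + 2 * l ^+ 2) = (1 + 2 * l ^+ 2) * fine (P setT) by exact: Rintegral_cst.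
by rewrite probability_setT mulr1; exact: expR_ge1Dx.
Qed.

Let expdev n A (l : R) (X : n.-tuple T) : R := \prod_(i < n) expR (l * centered A (tnth X i)).

Let measurable_expdev n A l : measurable A -> measurable_fun setT (@expdev n A l).
Proof.
move=> mA; apply: measurable_prod => i _; apply: measurableT_comp => //.
apply: measurable_funM => //; apply: (measurableT_comp (measurable_centered mA)).
exact: measurable_tnth.
Qed.

Let integral_expdev n A (l : R) : measurable A -> `|l| <= 1 ->
  (\int[iid_law P n]_X (expdev A l X)%:E <= (expR (n%:R * (2 * l ^+ 2)))%:E)%E.
Proof.
move=> mA l1; set m := \int[P]_x expR (l * centered A x).
have be : bddm (fun x => expR (l * centered A x)).
  by apply: bddm_expR; apply: bddmZ; exact: bddm_centered.
have ie := bddm_int P be.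
have m0 : 0 < m.
  apply: (@lt_le_trans _ _ (expR (- 1))); first exact: expR_gt0.
  have -> : expR (- 1) = \int[P]_x (expR (- 1) : R).
    have -> : \int[P]_x (expR (- 1)) = expR (- 1) * fine (P setT) by exact: Rintegral_cst.
    by rewrite probability_setT mulr1.
  apply: le_Rintegral => //; first exact: bddm_int (bddm_cst _ _).
  move=> x _; rewrite ler_expR.
  have : `|l * centered A x| <= 1 by rewrite normrM mulr_ile1// norm_centered.
  by rewrite ler_norml => /andP[].
(* Dividing every factor by its mean [m] makes each integrate to one, which is the form of
   [integral_prod_meas1]. *)
have one : (\int[iid_law P n]_X (\prod_(i < n) (m^-1 * expR (l * centered A (tnth X i))))%:E = 1)%E.
  apply: (@integral_prod_meas1 _ _ _ P n (fun _ x => m^-1 * expR (l * centered A x))) => //.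
  - by move=> i; exact: (bddmZ m^-1 be).1.
  - by move=> i x; rewrite mulr_ge0 ?expR_ge0// invr_ge0 ltW.
  move=> i; rewrite -EFin_Rintegral; last exact: (integrableZl measurableT m^-1 ie).
  by rewrite (RintegralZl m^-1 measurableT ie) mulVf// gt_eqF.
have E X : expdev A l X = m ^+ n * \prod_(i < n) (m^-1 * expR (l * centered A (tnth X i))).
  rewrite big_split/= prodr_const card_ord mulrA -exprMn divff ?gt_eqF//.
  by rewrite expr1n mul1r.
under eq_integral do rewrite E EFinM.
have mp : measurable_fun setT (fun X : n.-tuple T =>
    \prod_(i < n) (m^-1 * expR (l * centered A (tnth X i)))).
  apply: measurable_prod => i _; apply: measurable_funM => //; apply: measurableT_comp => //.
  apply: measurable_funM => //; apply: (measurableT_comp (measurable_centered mA)).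
  exact: measurable_tnth.
rewrite ge0_integralZl//; last 3 first.
- exact/measurable_EFinP.
- by move=> X _; rewrite lee_fin prodr_ge0// => i _; rewrite mulr_ge0 ?expR_ge0// invr_ge0 ltW.
- by rewrite lee_fin exprn_ge0// ltW.
rewrite one mule1 lee_fin expRM_natl lerXn2r ?nnegrE ?expR_ge0 ?(ltW m0)//.
exact: mgf_le.
Qed.

(** A pointwise form of Chernoff's bound. If the deviation u exceeds t in absolute value, then u^2
    <= 1 <= exp(n t (|u| - t) / 4), which is one of the two exponentials according to the sign of
    u. *)
Let sqr_dev_le n A (t : R) (X : n.-tuple T) : (0 < n)%N -> measurable A -> 0 < t ->
  (fine (P A) - n%:R^-1 * \sum_(i < n) \1_A (tnth X i)) ^+ 2 <=
  t ^+ 2 + expR (- (n%:R * t ^+ 2 / 4)) * (expdev A (t / 4) X + expdev A (- (t / 4)) X).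
Proof.
move=> n0 mA t0; set S := \sum_(i < n) _; have nR : 0 < n%:R :> R by rewrite ltr0n.
pose u := n%:R^-1 * S - fine (P A).
have ED l : expdev A l X = expR (l * (n%:R * u)).
  rewrite /expdev -expR_sum -mulr_sumr; congr (expR (_ * _)).
  rewrite sumrB sumr_const card_ord /u mulrBr mulVKf ?gt_eqF//.
  by rewrite mulr_natl.
have S0 : 0 <= S by rewrite sumr_ge0.
have S1 : S <= n%:R.
  have -> : n%:R = \sum_(i < n) 1 :> R by rewrite sumr_const card_ord.
  by apply: ler_sum => i _; rewrite indicE; case: (_ \in _).
have s1 : 0 <= n%:R^-1 * S <= 1.
  rewrite mulr_ge0 ?invr_ge0 ?(ltW nR)//=.
  by rewrite mulrC ler_pdivrMr// mul1r.
have /andP[p0 p1] := fine_prob_itv P mA.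
have u1 : `|u| <= 1 by move: s1; rewrite ler_norml /u => /andP[? ?]; lra.
have -> : (fine (P A) - n%:R^-1 * S) ^+ 2 = u ^+ 2 by rewrite /u; ring.
rewrite !ED; clearbody u; clear S S0 S1 s1 ED.
case: (leP `|u| t) => ut.
  rewrite -[leLHS]addr0 lerD//.
  by rewrite -real_normK ?num_real// lerXn2r ?nnegrE// ltW.
apply: (@le_trans _ _ 1); first by rewrite -real_normK ?num_real// expr_le1.
rewrite -[leLHS]add0r lerD ?sqr_ge0// mulrDr -!expRD.
have key (a : R) : t <= a -> 1 <= expR (- (n%:R * t ^+ 2 / 4) + t / 4 * (n%:R * a)).
  move=> ta; rewrite -[leLHS]expR0 ler_expR.
  have : 0 <= n%:R * t * (a - t) by rewrite mulr_ge0 ?subr_ge0// mulr_ge0// ltW.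
  by move=> h; rewrite (_ : _ + _ = n%:R * t * (a - t) / 4) ?divr_ge0//; field.
move: ut; case: (leP 0 u) => u0.
  rewrite ger0_norm// => /ltW/key h; apply: (le_trans h).
  by rewrite lerDl expR_ge0.
rewrite ltr0_norm// => /ltW/key h; apply: (le_trans h).
rewrite -[leLHS]add0r lerD ?expR_ge0// le_eqVlt; apply/orP; left; apply/eqP.
by congr expR; ring.
Qed.

(** One measurable majorant for all events at once, as the upper expectation needs. The pointwise
    bounds are summed over the events; integrating turns the exponent - n t^2 / 4 into - n t^2 / 4 +
    n t^2 / 8. *)
Lemma empirical_process_bound n (I : finType) (A : I -> set T) (t : R) :
  (0 < n)%N -> (forall k, measurable (A k)) -> 0 < t ->
  exists H : n.-tuple T -> R,
    [/\ measurable_fun setT H, forall X, 0 <= H X,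
        (\int[iid_law P n]_X (H X)%:E <=
          (t ^+ 2 + 2 * #|I|%:R * expR (- (n%:R * t ^+ 2 / 8)))%:E)%E &
        forall X k,
          (fine (P (A k)) - n%:R^-1 * \sum_(i < n) \1_(A k) (tnth X i)) ^+ 2 <= H X].
Proof.
move=> n0 mA t0; have nR : 0 < n%:R :> R by rewrite ltr0n.
have fin1 (c : R) : (\int[iid_law P n]_X (cst c%:E X) = c%:E)%E.
  rewrite integral_cst//; have PT := probability_setT (iid_law P n).
  exact: (etrans (congr1 (mule c%:E) PT) (mule1 _)).
(* The exponential moment bound needs t / 4 <= 1. For larger t the constant t^2 is already a
   majorant, since deviations are at most 1. *)
case: (leP t 4) => t4; last first.
  exists (cst (t ^+ 2)); split => //.
  - by move=> X; rewrite /= sqr_ge0.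
  - by rewrite fin1 lee_fin lerDl !mulr_ge0 ?expR_ge0.
  move=> X k; have /andP[p0 p1] := fine_prob_itv P (mA k).
  have s0 : 0 <= n%:R^-1 * \sum_(i < n) \1_(A k) (tnth X i) :> R.
    by rewrite mulr_ge0 ?invr_ge0 ?sumr_ge0 ?(ltW nR).
  have s1 : n%:R^-1 * \sum_(i < n) \1_(A k) (tnth X i) <= 1 :> R.
    rewrite mulrC ler_pdivrMr// mul1r.
    have -> : n%:R = \sum_(i < n) 1 :> R by rewrite sumr_const card_ord.
    by apply: ler_sum => i _; rewrite indicE; case: (_ \in _).
  move: s0 s1; move: (_ * _) => s s0 s1.
  rewrite -real_normK ?num_real// lerXn2r ?nnegrE ?(ltW t0)// ler_norml; lra.
pose c := expR (- (n%:R * t ^+ 2 / 4)).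
pose D k X := c * (@expdev n (A k) (t / 4) X + expdev (A k) (- (t / 4)) X).
have D0 k X : 0 <= D k X.
  by rewrite mulr_ge0 ?expR_ge0// addr_ge0// prodr_ge0// => i _; exact: expR_ge0.
have mD k : measurable_fun setT (D k).
  by apply: measurable_funM => //; apply: measurable_funD; exact: measurable_expdev.
have iD k : (\int[iid_law P n]_X (D k X)%:E <= (2 * expR (- (n%:R * t ^+ 2 / 8)))%:E)%E.
  have l1 : `|t / 4| <= 1 by rewrite ger0_norm ?divr_ge0 ?(ltW t0)//; lra.
  have l2 : `|- (t / 4)| <= 1 by rewrite normrN.
  have h1 := integral_expdev n (mA k) l1; have h2 := integral_expdev n (mA k) l2.
  under eq_integral do rewrite EFinM EFinD.
  have me l : measurable_fun setT (EFin \o @expdev n (A k) l).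
    by apply/measurable_EFinP; exact: measurable_expdev.
  have pe l (X : n.-tuple T) : (0 <= (expdev (A k) l X)%:E)%E.
    by rewrite lee_fin prodr_ge0// => i _; exact: expR_ge0.
  rewrite ge0_integralZl//; last 3 first.
  - by apply: emeasurable_funD; exact: me.
  - by move=> X _; rewrite adde_ge0.
  - by rewrite lee_fin expR_ge0.
  rewrite ge0_integralD//; [|exact: me|exact: me].
  apply: (@le_trans _ _ (c%:E * ((expR (n%:R * (2 * (t / 4) ^+ 2)))%:E +
    (expR (n%:R * (2 * (- (t / 4)) ^+ 2)))%:E))%E).
    by rewrite lee_wpmul2l ?lee_fin ?expR_ge0// leeD.
  rewrite -EFinD -EFinM lee_fin sqrrN -mulr2n -[_ *+ 2]mulr_natl mulrCA -expRD.
  rewrite le_eqVlt; apply/orP; left; apply/eqP; by congr (_ * expR _); field.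
exists (fun X => t ^+ 2 + \sum_k D k X); split.
- by apply: measurable_funD => //; exact: measurable_sum.
- by move=> X; rewrite addr_ge0 ?sqr_ge0// sumr_ge0.
- have mS : measurable_fun setT (fun X => (\sum_k D k X)%:E).
    by apply/measurable_EFinP; exact: measurable_sum.
  have pS (X : n.-tuple T) : setT X -> (0 <= (\sum_k D k X)%:E)%E.
    by move=> _; rewrite lee_fin sumr_ge0.
  have pt (X : n.-tuple T) : setT X -> (0 <= cst (t ^+ 2)%:E X)%E.
    by move=> _; rewrite lee_fin sqr_ge0.
  under eq_integral do rewrite EFinD.
  rewrite (ge0_integralD (iid_law P n) measurableT pt (measurable_cst _) pS mS) fin1.
  rewrite EFinD leeD2l//; under eq_integral do rewrite -sumEFin.
  have mDE k : measurable_fun setT (fun X => (D k X)%:E) by exact/measurable_EFinP.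
  rewrite (ge0_integral_sum (iid_law P n) measurableT mDE) => [|k X _]; last by rewrite lee_fin.
  apply: (@le_trans _ _ (\sum_(k : I) (2 * expR (- (n%:R * t ^+ 2 / 8)))%:E)%E).
    by apply: lee_sum => k _; exact: iD.
  rewrite sumEFin lee_fin sumr_const -mulr_natl.
  by rewrite le_eqVlt; apply/orP; left; apply/eqP; ring.
move=> X k; apply: (le_trans (sqr_dev_le X n0 (mA k) t0)).
by rewrite lerD2l (bigD1 k)//= lerDl sumr_ge0.
Qed.

End concentration.

(** * Covering numbers *)

Section moment_covering.
Context {R : realType} (d : nat) (M : R).
Hypothesis M0 : 0 <= M.
Implicit Types (p q : probability 'rV[R]_d R).
Local Notation B := (sqradius d M).

Definition covering_cst : R := gnorm (R := R) d ^+ 2 * smooth_cst R d * gc d (1 / 2) ^+ 2.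

Lemma covering_cst_gt0 : 0 < covering_cst.
Proof.
apply: mulr_gt0; last by rewrite exprn_gt0// gc_gt0// divr_gt0.
by apply: mulr_gt0; [rewrite exprn_gt0// gnorm_gt0|exact: smooth_cst_gt0].
Qed.

Lemma l1_dist_ge0 p q : 0 <= l1_dist p q.
Proof. exact: Rintegral_ge0. Qed.

(** The square root of the pointwise bound [density_gap] is still Gaussian in x, hence
    integrable. *)
Lemma l1_dist_sqr_le p q : carried M p -> carried M q ->
  l1_dist p q ^+ 2 <= covering_cst * gap M p q (7 / 5).
Proof.
move=> cp cq; have g0 : 0 <= gap M p q (7 / 5) by apply: (gap_ge0 M0); rewrite divr_ge0.
have c0 : 0 <= gnorm (R := R) d ^+ 2 * smooth_cst R d.
  by apply: mulr_ge0; [exact: sqr_ge0|exact: ltW (smooth_cst_gt0 _ _)].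
pose c := gnorm (R := R) d ^+ 2 * smooth_cst R d * gap M p q (7 / 5).
have cc : 0 <= c by exact: mulr_ge0 c0 g0.
have p2 : 0 < 1 / 2 :> R by rewrite divr_gt0.
have i2 := integrable_gk (0 : 'rV[R]_d) p2.
have ik : (lebesgue_row d).-integrable setT (EFin \o (fun x => Num.sqrt c * gk (1 / 2) 0 x)).
  exact: (integrableZl measurableT (Num.sqrt c) i2).
have mD : measurable_fun setT (fun x : 'rV[R]_d => `|mix_density p x - mix_density q x|).
  by apply: measurableT_comp => //; apply: measurable_funB; exact: measurable_mix_density.
have le x : `| `|mix_density p x - mix_density q x| | <= Num.sqrt c * gk (1 / 2) 0 x.
  rewrite normr_id -(@ler_sqr _ `|_|) ?nnegrE ?mulr_ge0 ?sqrtr_ge0 ?gk_ge0//.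
  rewrite real_normK ?num_real//.
  have -> : (Num.sqrt c * gk (1 / 2) 0 x) ^+ 2 = c * gk 1 0 x.
    by rewrite (@sqr_mul_gk _ _ _ 1) ?sqr_sqrtr//; field.
  apply: (le_trans (density_gap M0 x cp cq)); rewrite le_eqVlt; apply/orP; left.
  by apply/eqP; rewrite /c; move: (gap M p q _) (gk _ _ _) => a b; ring.
have [_ H] := le_norm_Rintegral mD ik le.
have L : l1_dist p q <= Num.sqrt c * gc d (1 / 2).
  by apply: (le_trans (ler_norm _)); rewrite (le_trans H)// (RintegralZl _ measurableT i2) Rintegral_gk.
have E : (Num.sqrt c * gc d (1 / 2)) ^+ 2 = covering_cst * gap M p q (7 / 5).
  by rewrite exprMn sqr_sqrtr// /c /covering_cst; ring.
by rewrite -E lerXn2r// nnegrE ?l1_dist_ge0// (le_trans _ L)// l1_dist_ge0.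
Qed.

Definition tilted_moment p j (w : {ffun 'I_j -> 'I_d}) : R :=
  \int[p]_t (gk (2 / 5) (clip M t) 0 * monomial w (clip M t)).

(** Below degree [k] the energies are sums of squared moment differences; the tail is bounded by
    compactness alone. *)
Lemma gap_moments p q v k : 7 / 5 <= v ->
  gap M p q (7 / 5) <=
    \sum_(0 <= j < k) (7 / 5) ^+ j / j`!%:R *
      (\sum_(w : {ffun 'I_j -> 'I_d}) (tilted_moment p w - tilted_moment q w) ^+ 2) +
    (7 / 5 / v) ^+ k * (4 * expR (v * B)).
Proof.
move=> v75; have mc2 : measurable_fun setT (fun z : bool * 'rV[R]_d => clip M z.2).
  by apply: measurableT_comp => //; exact: measurable_clip.
have c2B (z : bool * 'rV[R]_d) : sq (clip M z.2) <= B by exact: sq_clip.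
have bt : bddm (@pair_weight R d M) by exact: (bddm_tilt mc2 (bddm_sgn _ _)).
have u0 : 0 < 7 / 5 :> R by rewrite divr_gt0.
have v0 : 0 <= v by rewrite (le_trans _ v75)// ltW.
apply: (le_trans (exp_energy_split (pair_measure p q) mc2 c2B bt k u0 v75)).
apply: lerD; last first.
  rewrite ler_wpM2l ?exprn_ge0 ?divr_ge0//.
  apply: (le_trans (exp_energy_le (c := 1) (pair_measure p q) mc2 c2B bt v0 _)) => [z|].
    by rewrite normrM norm_sgn mul1r ger0_norm ?gk_ge0// gk_le1.
  by rewrite pair_measureT expr1n mul1r mulrC -natrX.
rewrite le_eqVlt; apply/orP; left; apply/eqP; apply: eq_bigr => j _; congr (_ * _).
rewrite (energy_expn (pair_measure p q) mc2 c2B j bt); apply: eq_bigr => w _; congr (_ ^+ 2).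
have bw : bddm (fun t => gk (2 / 5) (clip M t) 0 * monomial w (clip M t)).
  apply: bddmM; first by apply: (bddm_gk (@measurable_clip R d M)); rewrite divr_ge0.
  exact: (bddm_monomial (@measurable_clip R d M) (sq_clip M0)).
rewrite /tilted_moment -(Rintegral_pair_sgn p q bw); apply: eq_Rintegral => z _.
by rewrite /pair_weight /tilt mulrA.
Qed.

Lemma norm_tilted_moment_le p j (w : {ffun 'I_j -> 'I_d}) :
  `|tilted_moment p w| <= Num.max 1 M ^+ j.
Proof.
have -> : Num.max 1 M ^+ j = Num.max 1 M ^+ j * fine (p setT).
  by rewrite probability_setT mulr1.
apply: norm_Rintegral_le; first exact: fin_measureT.
  apply: measurable_funM; first by apply: measurable_gk => //; exact: measurable_clip.
  exact: (bddm_monomial (@measurable_clip R d M) (sq_clip M0) w).1.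
move=> t; rewrite normrM (ger0_norm (gk_ge0 _ _ _)) -[leRHS]mul1r.
apply: ler_pM; rewrite ?gk_ge0 ?gk_le1 ?divr_ge0//.
rewrite /monomial normr_prod -[in leRHS](card_ord j) -prodr_const.
apply: ler_prod => i _; rewrite normr_ge0/=.
have /andP[h1 h2] := clip_cube M0 t (w i).
by rewrite le_max; apply/orP; right; rewrite ler_norml h1 h2.
Qed.

Variables (k : nat) (h : R).
Hypothesis h0 : 0 < h.

Definition word := {j : 'I_k & {ffun 'I_j -> 'I_d}}.

Let Mk : R := Num.max 1 M ^+ k.

Definition grid_size : nat := (Num.trunc (2 * Mk / h)).+1.

Let cell (x : R) : 'I_grid_size := inord (Num.trunc ((x + Mk) / h)).

Let cell_close x y : `|x| <= Mk -> `|y| <= Mk -> cell x = cell y -> `|x - y| <= h.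
Proof.
have bnd z : `|z| <= Mk -> 0 <= (z + Mk) / h <= 2 * Mk / h.
  rewrite ler_norml => /andP[z1 z2]; rewrite divr_ge0 ?(ltW h0)//=; last by lra.
  by rewrite ler_pM2r ?invr_gt0//; lra.
have lt z : `|z| <= Mk -> (Num.trunc ((z + Mk) / h) < grid_size)%N.
  by move=> /bnd /andP[z1 z2]; rewrite ltnS le_truncn.
move=> xM yM /(congr1 val); rewrite /= !inordK ?lt// => e.
have /andP[x0 _] := bnd x xM; have /andP[y0 _] := bnd y yM.
have /andP[x1 x2] := truncn_itv x0; have /andP[y1 y2] := truncn_itv y0.
rewrite e in x1 x2.
have : `|(x + Mk) / h - (y + Mk) / h| <= 1.
  move: x1 x2 y1 y2; rewrite -!natr1 => x1 x2 y1 y2; rewrite ler_norml; lra.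
rewrite -mulrBl (_ : x + Mk - (y + Mk) = x - y); last by ring.
by rewrite normrM normfV (gtr0_norm h0) ler_pdivrMr// mul1r.
Qed.

Let signature p : {ffun word -> 'I_grid_size} :=
  [ffun w : word => cell (tilted_moment p (tagged w))].

(** Equal cells make all tilted moments of degree below [k] agree up to [h]. There are d^j words of
    length j, so the head sums to at most exp(7/5 d) h^2. *)
Let signature_l1 p q v : carried M p -> carried M q -> 7 / 5 <= v ->
  signature p = signature q ->
  l1_dist p q ^+ 2 <= covering_cst *
    (expR (7 / 5 * d%:R) * h ^+ 2 + (7 / 5 / v) ^+ k * (4 * expR (v * B))).
Proof.
move=> cp cq v75 sE; apply: (le_trans (l1_dist_sqr_le cp cq)).
rewrite ler_wpM2l ?(ltW covering_cst_gt0)//; apply: (le_trans (gap_moments p q k v75)).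
rewrite lerD2r.
have close j (w : {ffun 'I_j -> 'I_d}) : (j < k)%N ->
    (tilted_moment p w - tilted_moment q w) ^+ 2 <= h ^+ 2.
  move=> jk; rewrite -real_normK ?num_real// lerXn2r ?nnegrE ?(ltW h0)//.
  have Mj r : `|tilted_moment r w| <= Mk.
    apply: (le_trans (norm_tilted_moment_le r w)).
    by rewrite ler_weXn2l ?le_max ?lexx// ltnW.
  apply: cell_close => //.
  have := congr1 (fun s : {ffun word -> 'I_grid_size} =>
    s (Tagged (fun j : 'I_k => {ffun 'I_j -> 'I_d}) (i := Ordinal jk) w)) sE.
  by rewrite !ffunE.
apply: (@le_trans _ _ (\sum_(0 <= j < k) (7 / 5 * d%:R) ^+ j / j`!%:R * h ^+ 2)).
  rewrite big_nat_cond [leRHS]big_nat_cond; apply: ler_sum => j /andP[/andP[_ jk] _].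
  rewrite [(7 / 5 * d%:R) ^+ j]exprMn [X in _ <= X * _]mulrAC -[leRHS]mulrA.
  rewrite ler_wpM2l ?divr_ge0 ?exprn_ge0//.
  apply: (@le_trans _ _ (\sum_(w : {ffun 'I_j -> 'I_d}) h ^+ 2)).
    by apply: ler_sum => w _; exact: close.
  by rewrite sumr_const card_ffun !card_ord -[leLHS]mulr_natl natrX.
rewrite -mulr_suml ler_wpM2r ?sqr_ge0//.
have b0 : 0 <= 7 / 5 * d%:R :> R by rewrite mulr_ge0// divr_ge0.
have := expR_tail k (lexx `|7 / 5 * d%:R : R|); rewrite (ger0_norm b0) => H.
have := le_trans (normr_ge0 _) H; rewrite subr_ge0; apply: le_trans.
by rewrite seriesEnat /exp_coeff/=.
Qed.

(* Centers are chosen one per realized vector of discretized moments. *)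
Lemma small_covering eta v : 7 / 5 <= v -> 0 <= eta ->
  covering_cst * (expR (7 / 5 * d%:R) * h ^+ 2 + (7 / 5 / v) ^+ k * (4 * expR (v * B)))
    <= eta ^+ 2 ->
  exists Q : 'I_(grid_size ^ #|{: word}|) -> probability 'rV[R]_d R,
    tv_covering (mixture_class M) eta Q.
Proof.
move=> v75 eta0 Heta.
pose good s p := msupport p `<=` cube M /\ signature p = s.
pose center s : probability 'rV[R]_d R :=
  if pselect (exists p, good s p) is left e then mix_law (sval (cid e))
  else mix_law \d_(0 : 'rV[R]_d).
have cardS : #|{ffun word -> 'I_grid_size}| = (grid_size ^ #|{: word}|)%N.
  by rewrite card_ffun card_ord.
exists (fun i => center (enum_val (cast_ord (esym cardS) i))) => P [p sp PE].
exists (cast_ord cardS (enum_rank (signature p))); rewrite cast_ordK enum_rankK /center.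
case: pselect => [e|ne]; last by exfalso; apply: ne; exists p.
case: cid => q [sq sE] /=; rewrite tv_yatracos lee_fin PE.
apply: (le_trans (ler_norm _)).
apply: (le_trans (norm_mix_lawB_le p q (measurable_yatracos_set _ _))).
rewrite -(@ler_sqr _ (l1_dist p q)) ?nnegrE ?l1_dist_ge0//.
apply: le_trans Heta; apply: signature_l1 => //; exact: msupport_carried.
Qed.

Lemma card_word : #|{: word}| = (\sum_(0 <= j < k) d ^ j)%N.
Proof.
rewrite card_tagged sumnE big_map big_enum /= big_mkord; apply: eq_bigr => j _.
by rewrite card_ffun !card_ord.
Qed.

End moment_covering.

(** * Rates *)

Section slow_growth.
Context {R : realType}.
Implicit Types x y c : R.

(* [eps^(2 (1 - (2 + delta) / loglog))] is [eps^2 * expR ((4 + 2 delta) * slow (ln eps^-1))]. *)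
Definition slow x : R := x / ln (Num.max x (expR 1)).

(** The power 4/5 of max(x, e): its square dominates x, while any multiple of it is absorbed by
    [slow x]. *)
Definition pow45 x : R := expR (4 / 5 * ln (Num.max x (expR 1))).

Lemma ln_max_ge1 x : 1 <= ln (Num.max x (expR 1)).
Proof. by rewrite -[leLHS](@expRK R) ler_ln ?posrE ?lt_max ?expR_gt0 ?orbT// le_max lexx orbT. Qed.

Lemma expR_ln_max x : expR (ln (Num.max x (expR 1))) = Num.max x (expR 1).
Proof. by rewrite lnK// posrE lt_max expR_gt0 orbT. Qed.

Lemma slow_ge0 x : 0 <= x -> 0 <= slow x.
Proof. by move=> x0; rewrite divr_ge0// (le_trans _ (ln_max_ge1 x)). Qed.

Lemma slow_le x : 0 <= x -> slow x <= x.
Proof.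
move=> x0; rewrite ler_pdivrMr ?(lt_le_trans _ (ln_max_ge1 x))//.
by rewrite ler_peMr// ln_max_ge1.
Qed.

Lemma expR_slow_mono y z : 1 <= y -> y <= z -> expR y / y <= expR z / z.
Proof.
move=> y1 yz; have y0 : 0 < y by rewrite (lt_le_trans _ y1).
have z0 : 0 < z by rewrite (lt_le_trans _ yz).
rewrite ler_pdivrMr// mulrAC ler_pdivlMr//.
have -> : expR z = expR y * expR (z - y) by rewrite -expRD; congr expR; ring.
rewrite -mulrA ler_wpM2l ?expR_ge0//.
have h := expR_ge1Dx (z - y).
have : (1 + (z - y)) * y <= expR (z - y) * y by rewrite ler_wpM2r// ltW.
apply: le_trans; have : 0 <= (z - y) * (y - 1) by rewrite mulr_ge0 ?subr_ge0.
lra.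
Qed.

(** The function is linear up to e, and past e it is x / ln x, which increases there. *)
Lemma slow_mono x y : 0 <= x -> x <= y -> slow x <= slow y.
Proof.
move=> x0 xy; have e0 : 0 < expR 1 :> R by exact: expR_gt0.
have sl z : expR 1 <= z -> slow z = expR (ln z) / ln z.
  by move=> ez; rewrite /slow (max_idPl ez) lnK// posrE (lt_le_trans e0).
have ss z : z <= expR 1 -> slow z = z.
  by move=> ez; rewrite /slow (max_idPr ez) expRK divr1.
case: (leP y (expR 1)) => ye; first by rewrite !ss// (le_trans xy).
have ly : 1 <= ln y by rewrite -[leLHS](@expRK R) ler_ln ?posrE ?(ltW ye)// (lt_trans e0).
case: (leP x (expR 1)) => xe; last first.
  rewrite !sl ?(ltW xe) ?(ltW ye)//; apply: expR_slow_mono; last first.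
    by rewrite ler_ln ?posrE ?(lt_trans e0).
  by rewrite -[leLHS](@expRK R) ler_ln ?posrE ?(ltW xe)// (lt_trans e0).
rewrite ss// (le_trans xe)// sl ?(ltW ye)//.
by have := expR_slow_mono (lexx 1) ly; rewrite divr1.
Qed.

Lemma pow45_ge1 x : 1 <= pow45 x.
Proof.
rewrite -[leLHS]expR0 ler_expR mulr_ge0 ?divr_ge0//.
by rewrite (le_trans _ (ln_max_ge1 x)).
Qed.

(** With y = ln x the claim is C y <= c exp(y / 5). As exp(y / 5) >= y^2 / 100, it holds from y =
    100 C / c on; before that point [pow45] is at most exp(80 C / c). *)
Lemma slow_absorb C c : 0 < C -> 0 < c ->
  exists K, forall x, 0 <= x -> C * pow45 x <= c * slow x + K.
Proof.
move=> C0 c0; exists (C * expR (80 * C / c) + C * expR 1) => x x0.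
have s0 := slow_ge0 x0.
have cs0 : 0 <= c * slow x by rewrite mulr_ge0// ltW.
have K1 : 0 <= C * expR (80 * C / c) by rewrite mulr_ge0 ?expR_ge0 ?ltW.
have K2 : 0 <= C * expR 1 by rewrite mulr_ge0 ?expR_ge0 ?ltW.
case: (leP x (expR 1)) => xe.
  have -> : pow45 x = expR (4 / 5) by rewrite /pow45 (max_idPr xe) expRK mulr1.
  have : C * expR (4 / 5) <= C * expR 1 by rewrite ler_pM2l// ler_expR; lra.
  lra.
set y := ln (Num.max x (expR 1)); have y1 : 1 <= y := ln_max_ge1 x.
have y0 : 0 < y by rewrite (lt_le_trans _ y1).
have xE : x = expR y by rewrite /y expR_ln_max (max_idPl (ltW xe)).
case: (leP (100 * C / c) y) => yC; last first.
  have : C * pow45 x <= C * expR (80 * C / c).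
    rewrite ler_pM2l// ler_expR -/y.
    have -> : 80 * C / c = 4 / 5 * (100 * C / c) by field; rewrite gt_eqF.
    by rewrite ler_pM2l ?divr_gt0// ltW.
  lra.
have e5 : y ^+ 2 / 100 <= expR (y / 5).
  have -> : y / 5 = y / 10 + y / 10 by field.
  rewrite expRD (_ : y ^+ 2 / 100 = (y / 10) * (y / 10)); last by field.
  have := expR_ge1Dx (y / 10) => h.
  by apply: ler_pM; rewrite ?divr_ge0 ?(ltW y0)//; lra.
suff : C * pow45 x <= c * slow x by lra.
rewrite /slow -/y mulrA ler_pdivlMr// xE.
have -> : pow45 (expR y) = expR (4 / 5 * y) by rewrite -xE.
have -> : expR y = expR (4 / 5 * y) * expR (y / 5) by rewrite -expRD; congr expR; field.
rewrite (_ : C * _ * y = expR (4 / 5 * y) * (C * y)); last by ring.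
rewrite [leRHS]mulrCA ler_wpM2l ?expR_ge0//.
apply: (@le_trans _ _ (c * (y ^+ 2 / 100))); last by rewrite ler_wpM2l// ltW.
rewrite ler_pdivrMr// in yC; have : 0 <= y * (y * c - 100 * C) by rewrite mulr_ge0 ?subr_ge0// ltW.
lra.
Qed.

Lemma ln4_le : ln 4 <= 3 / 2 :> R.
Proof.
rewrite -ler_expR lnK ?posrE//.
have -> : 3 / 2 = 12%:R * (1 / 8) :> R by field.
rewrite expRM_natl; apply: (@le_trans _ _ ((9 / 8) ^+ 12)).
  by rewrite !exprS expr0; lra.
rewrite lerXn2r ?nnegrE ?expR_ge0 ?divr_ge0//.
by have := expR_ge1Dx (1 / 8 : R); lra.
Qed.

End slow_growth.

(** * Regret with tuned parameters *)

Section regret_slow.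
Context {R : realType} (d : nat) (M : R).
Hypothesis M0 : 0 <= M.

Let arith_k (k S l : R) : k <= 5 / 2 * S + 1 -> 0 <= l -> l <= 3 / 2 -> 0 <= S ->
  k * l <= 15 / 4 * S + l.
Proof.
move=> kS l0 l1 S0; have := ler_wpM2r l0 kS.
have : 0 <= S * (3 / 2 - l) by rewrite mulr_ge0// subr_ge0.
by lra.
Qed.

Let arith_sum (rho g x1 x2 a W l : R) : g <= x1 + x2 -> x1 <= 4 * a * W * l ->
  x2 <= 4 * W * rho -> rho <= W * rho -> 0 <= W * rho -> 0 <= W * l ->
  0 <= a * (W * rho) -> rho + g <= (1 + (4 * a + 4)) * W * (rho + l).
Proof. by lra. Qed.

Let arith_exp (a b B P S K : R) : (b * 6 + 8 / 5 * B + 1) * P <= 1 / 4 * S + K ->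
  0 <= P -> a * P <= b * P -> a * (6 * P) + (15 / 4 * S + 8 / 5 * P * B) <= K + 4 * S.
Proof. by lra. Qed.

Lemma regret_slow : exists2 C : R, 0 < C &
  forall (p q : probability 'rV[R]_d R) (rho : R), carried M p -> carried M q ->
  0 < rho -> rho <= 1 ->
  (regret p (mix_density q) rho <=
    (C * expR (4 * slow (2^-1 * ln rho^-1)) * (rho + l1_dist p q ^+ 2))%:E)%E.
Proof.
set B := sqradius d M; have B0 : 0 <= B := sqradius_ge0 d M.
have rc0 : 0 <= regret_cst d M.
  apply: addr_ge0; apply: mulr_ge0.
  - by apply: mulr_ge0; [exact: near_cst_ge0|exact: expR_ge0].
  - by apply: exprn_ge0; exact: sqrtr_ge0.
  - exact: far_cst_ge0.
  - by apply: ltW; apply: gc_gt0; rewrite divr_gt0.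
pose kap := `|regret_exp d M|.
pose D := kap * 6 + 8 / 5 * B + 1.
have D0 : 0 < D.
  by apply: ltr_wpDl => //; apply: addr_ge0; apply: mulr_ge0; rewrite ?divr_ge0 ?normr_ge0.
have c14 : 0 < 1 / 4 :> R by rewrite divr_gt0.
have [K HK] := slow_absorb D0 c14.
have lc0 : 0 <= @l1_cst R d by rewrite ltW// l1_cst_gt0.
pose E := 1 + (4 * @l1_cst R d + 4).
have E0 : 0 < E by rewrite /E; lra.
exists ((regret_cst d M + 1) * E * expR K).
  by rewrite !mulr_gt0 ?expR_gt0// ltr_wpDl.
move=> p q rho cp cq rho0 rho1.
set L := 2^-1 * ln rho^-1; have L0 : 0 <= L.
  by rewrite mulr_ge0 ?invr_ge0// ln_ge0// invf_ge1.
have rhoE : rho = expR (- (2 * L)).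
  by rewrite /L mulrA divff// mul1r lnV ?posrE// opprK lnK ?posrE.
set y := ln (Num.max L (expR 1)); have y1 : 1 <= y := ln_max_ge1 L.
have y0 : 0 < y by rewrite (lt_le_trans _ y1).
set P := pow45 L; have P1 : 1 <= P := pow45_ge1 L.
have P0 : 0 < P by rewrite (lt_le_trans _ P1).
set S := slow L; have S0 : 0 <= S := slow_ge0 L0.
(* As P^2 >= L, r^2 / 16 = 9/4 P^2 exceeds 2 L = ln rho^-1, the tail condition; and 8/5 / v is
   exactly P^-1. *)
pose r := 6 * P; pose v := 8 / 5 * P.
have r1 : 1 <= r by rewrite /r; lra.
have v85 : 8 / 5 <= v by rewrite /v ler_peMr.
have LP : L <= P ^+ 2.
  rewrite /P /pow45 -expRM_natl -/y; apply: (@le_trans _ _ (expR y)).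
    by rewrite /y expR_ln_max le_max lexx.
  by rewrite ler_expR; lra.
have r_rho : expR (- (r ^+ 2 / 16)) <= rho.
  by rewrite rhoE ler_expR /r exprMn; lra.
apply: (le_trans (regret_bound M0 cp cq rho0 r1 r_rho)); rewrite lee_fin.
(* P^-1 = exp(- 4/5 y) and L = S y, so k >= 5/2 S gives P^-k <= exp(- 2 L) = rho. *)
pose k := (Num.trunc (5 / 2 * S)).+1.
have s52 : 0 <= 5 / 2 * S by rewrite mulr_ge0// divr_ge0.
have /andP[k1 k2] := truncn_itv s52.
have kS : k%:R <= 5 / 2 * S + 1 by rewrite /k -natr1 lerD2r.
have lS : L = S * y by rewrite /S /slow -/y divfK// gt_eqF.
have pv : (8 / 5 / v) ^+ k <= rho.
  have -> : 8 / 5 / v = expR (- (4 / 5 * y)).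
    by rewrite /v invfM mulrA divff ?mul1r ?expRN// gt_eqF// divr_gt0.
  rewrite -expRM_natl rhoE ler_expR mulrN lerN2 lS.
  have := ltW k2; rewrite -/k => h.
  have : 0 <= (k%:R - 5 / 2 * S) * y by rewrite mulr_ge0 ?subr_ge0// ltW.
  lra.
have p4 : 4 ^+ k <= 4 * expR (15 / 4 * S).
  have -> : 4 ^+ k = expR (k%:R * ln 4) :> R by rewrite expRM_natl lnK// posrE.
  apply: (@le_trans _ _ (expR (15 / 4 * S + ln 4))); last first.
    by rewrite expRD lnK ?posrE// mulrC.
  by rewrite ler_expR; apply: arith_k (@ln4_le R) S0 => //; rewrite ln_ge0// ler1n.
have G := gap_bound M0 k cp cq v85.
set l2 := l1_dist p q ^+ 2; have l20 : 0 <= l2 by exact: sqr_ge0.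
have ev1 : 1 <= expR (v * B).
  by rewrite -[leLHS]expR0 ler_expR mulr_ge0// mulr_ge0 ?divr_ge0 ?ltW.
have e15 : 1 <= expR (15 / 4 * S) by rewrite -[leLHS]expR0 ler_expR mulr_ge0// divr_ge0.
set W := expR (15 / 4 * S) * expR (v * B).
have W1 : 1 <= W by rewrite -[leLHS]mulr1 ler_pM.
have rG : rho + gap M p q (8 / 5) <= E * W * (rho + l2).
  have A1 : 4 ^+ k * (@l1_cst R d * l2) <= 4 * @l1_cst R d * W * l2.
    have -> : 4 * @l1_cst R d * W * l2 = (4 * W) * (@l1_cst R d * l2) by ring.
    apply: ler_wpM2r; first exact: mulr_ge0 lc0 l20.
    by apply: le_trans p4 _; rewrite ler_pM2l// ler_peMr ?expR_ge0.
  have A2 : (8 / 5 / v) ^+ k * (4 * expR (v * B)) <= 4 * W * rho.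
    have -> : 4 * W * rho = rho * (4 * W) by ring.
    have v0 : 0 <= v by rewrite mulr_ge0 ?divr_ge0 ?(ltW P0).
    apply: ler_pM => //; first by rewrite exprn_ge0// divr_ge0// divr_ge0.
    by rewrite ler_pM2l// ler_peMl ?expR_ge0.
  have A3 : rho <= W * rho by rewrite ler_peMl// ltW.
  have rW : 0 <= W * rho by rewrite (le_trans _ A3)// ltW.
  have lW : 0 <= W * l2 by rewrite mulr_ge0// (le_trans _ W1).
  have lW2 : 0 <= @l1_cst R d * (W * rho) by rewrite mulr_ge0.
  exact: (arith_sum G A1 A2).
have W0 : 0 <= W by rewrite (le_trans _ W1).
have rl : 0 <= rho + l2 by rewrite addr_ge0// ltW.
have EX : expR (regret_exp d M * r) * W <= expR K * expR (4 * S).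
  rewrite /W -!expRD ler_expR; apply: (arith_exp (HK L L0) (ltW P0)).
  by rewrite ler_wpM2r ?ler_norm// ltW.
apply: (@le_trans _ _ (regret_cst d M * expR (regret_exp d M * r) * (E * W * (rho + l2)))).
  by rewrite ler_wpM2l// mulr_ge0 ?expR_ge0.
apply: (@le_trans _ _ ((regret_cst d M * E) * (expR K * expR (4 * S)) * (rho + l2))).
  rewrite (_ : _ * (E * W * _) = (regret_cst d M * E) * (expR (regret_exp d M * r) * W) * (rho + l2)); last by ring.
  by rewrite ler_wpM2r// ler_wpM2l// mulr_ge0// ltW.
rewrite -/S !mulrA ler_wpM2r// ler_wpM2r ?expR_ge0// ler_wpM2r ?expR_ge0//.
by rewrite ler_wpM2r ?(ltW E0)// lerDl.
Qed.

End regret_slow.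

(** Powers of 1 + x are exponentials of a multiple of ln x, which is of lower order than
    [pow45 x]. *)
Lemma poly_slow (R : realType) (m : nat) : exists2 C : R, 0 < C &
  forall x, 0 <= x -> (1 + x) ^+ m <= C * expR (slow x).
Proof.
have D0 : 0 < 5 / 4 * m%:R + 1 :> R by rewrite ltr_wpDl// mulr_ge0// divr_ge0.
have [K HK] := slow_absorb D0 ltr01.
exists (2 ^+ m * expR K); first by rewrite mulr_gt0 ?exprn_gt0 ?expR_gt0.
move=> x x0; set y := ln (Num.max x (expR 1)).
have y1 : 1 <= y := ln_max_ge1 x.
have xy : 1 + x <= 2 * expR y.
  have : x <= expR y by rewrite expR_ln_max le_max lexx.
  have := expR_ge1Dx y; lra.
apply: (@le_trans _ _ ((2 * expR y) ^+ m)).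
  by rewrite lerXn2r ?nnegrE// ?mulr_ge0 ?expR_ge0 ?addr_ge0.
rewrite exprMn -mulrA ler_wpM2l ?exprn_ge0// -expRM_natl -expRD ler_expR.
have P0 : 0 <= pow45 x by rewrite (le_trans _ (pow45_ge1 x)).
have Py : 4 / 5 * y <= pow45 x.
  have := expR_ge1Dx (4 / 5 * y); rewrite /pow45 -/y; lra.
have := HK x x0; rewrite mul1r => h; rewrite addrC; apply: le_trans h.
rewrite mulrDl mul1r -[leLHS]addr0 lerD//.
have : m%:R * (4 / 5 * y) <= m%:R * pow45 x by rewrite ler_wpM2l.
by lra.
Qed.

(** * Logarithm of the covering number *)

Section covering_number.
Context {R : realType} (d : nat) (M c : R).
Hypotheses (d1 : (1 <= d)%N) (M0 : 0 <= M) (c0 : 0 < c).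
Local Notation B := (sqradius d M).
Local Notation Cc := (covering_cst (R := R) d).

Let Cc0 : 0 < Cc. Proof. exact: covering_cst_gt0. Qed.

(** The grid step will be h0 / sqrt n; this value makes the discretization error exactly half of the
    budget c^2 / n. *)
Let h0 : R := c / Num.sqrt (2 * Cc * expR (7 / 5 * d%:R)).

Let A0 : 0 < 2 * Cc * expR (7 / 5 * d%:R).
Proof. by rewrite mulr_gt0 ?expR_gt0// mulr_gt0. Qed.

Let h0_gt0 : 0 < h0.
Proof. by rewrite divr_gt0// sqrtr_gt0. Qed.

Let h0E : Cc * (expR (7 / 5 * d%:R) * h0 ^+ 2) = c ^+ 2 / 2.
Proof.
rewrite /h0 expr_div_n sqr_sqrtr ?(ltW A0)//; field.
by rewrite !gt_eqF ?expR_gt0.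
Qed.

Let word_le k : (#|{: word d k}|%:R : R) <= (2 * d%:R) ^+ k.
Proof.
rewrite card_word natr_sum; apply: (@le_trans _ _ (\sum_(0 <= j < k) d%:R ^+ k)).
  rewrite big_nat_cond [leRHS]big_nat_cond; apply: ler_sum => j /andP[/andP[_ jk] _].
  by rewrite natrX ler_weXn2l ?ler1n// ltnW.
rewrite sumr_const_nat subn0 -[leLHS]mulr_natl exprMn ler_wpM2r ?exprn_ge0//.
by rewrite -natrX ler_nat ltnW// ltn_expl.
Qed.

Let word_gt0 k : (0 < k)%N -> (0 < #|{: word d k}|)%N.
Proof. by case: k => // k _; rewrite card_word big_nat_recl. Qed.

Let grid_le k (h : R) : 0 < h ->
  2 * (grid_size M k h)%:R <= 2 * Num.max 1 M ^+ k * (2 / h + 1).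
Proof.
move=> hp; have M1 : 1 <= Num.max 1 M ^+ k by rewrite exprn_ege1// le_max lexx.
have g0 : 0 <= 2 * Num.max 1 M ^+ k / h by rewrite divr_ge0 ?(ltW hp)// mulr_ge0// (le_trans _ M1).
have /andP[t1 _] := truncn_itv g0.
rewrite -mulrA ler_pM2l// /grid_size -natr1 mulrDr mulr1.
have -> : Num.max 1 M ^+ k * (2 / h) = 2 * Num.max 1 M ^+ k / h by ring.
by rewrite lerD.
Qed.

Let arith_exponent (S l y k k1 k0 : R) : l = S * y -> 5 / 2 * S <= k1 -> 1 <= y ->
  0 <= k0 -> k = k1 + k0 -> - (k * (4 / 5 * y)) <= - (2 * l) - 4 / 5 * k0.
Proof.
move=> -> k1S y1 k00 ->.
have : 0 <= (k1 - 5 / 2 * S) * y by rewrite mulr_ge0 ?subr_ge0// (le_trans _ y1).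
have : 0 <= k0 * (y - 1) by rewrite mulr_ge0// subr_ge0.
by lra.
Qed.

Let arith_log (k S l k0 a g s : R) : k <= 5 / 2 * S + 1 + k0 -> S <= l -> 0 <= a -> 0 <= g ->
  0 <= s -> 0 <= l -> 0 <= k0 ->
  s + k * a + (g + l / 2) <= (s + a * (5 / 2 + 1 + k0) + g + 1) * (1 + l).
Proof.
move=> kS Sl a0 g0 s0 l0 k00.
have k3 : k <= 5 / 2 * l + 1 + k0 by lra.
have : k * a <= (5 / 2 * l + 1 + k0) * a by rewrite ler_wpM2r.
have : 0 <= a * k0 * l by rewrite !mulr_ge0.
have : 0 <= a * l by rewrite mulr_ge0.
have : 0 <= s * l by rewrite mulr_ge0.
have : 0 <= g * l by rewrite mulr_ge0.
by lra.
Qed.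

(** There are at most (2 d)^k words with k close to 5/2 [slow (ln n)], whence the first summand; the
    1 absorbs the logarithm of the grid size, which is of order 1 + ln n. *)
Definition covering_exp : R := 5 / 2 * ln (2 * d%:R) + 1.

(** The logarithm of the number of cells is the number of words times the logarithm of the grid
    size. With N + 1 it is nonnegative for every N, and it transfers to any smaller covering. *)
Lemma covering_log : exists2 C : R, 0 < C &
  forall (n : nat) (eta : R), (2 <= n)%N -> c / Num.sqrt n%:R <= eta ->
  exists N (Q : 'I_N -> probability 'rV[R]_d R),
    tv_covering (mixture_class M) eta Q /\
    ln (N%:R + 1) <= C * expR (covering_exp * slow (ln n%:R)).
Proof.
have B0 : 0 <= B := sqradius_ge0 d M.
have D0 : 0 < 7 / 5 * B + 1 by rewrite ltr_wpDl// mulr_ge0// divr_ge0.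
have [K HK] := slow_absorb D0 ltr01.
have [C1 C10 HC1] := @poly_slow R 1.
pose z := K + ln (8 * Cc / c ^+ 2).
(* Extra degrees that beat the constant [z]: each contributes at least 4/5 to the exponent because y
   >= 1. *)
pose k0 := (Num.trunc (5 / 4 * `|z|)).+1.
have k0z : z <= 4 / 5 * k0%:R.
  have z0 : 0 <= 5 / 4 * `|z| by rewrite mulr_ge0// divr_ge0.
  have /andP[_ h] := truncn_itv z0; have := ler_norm z.
  by move: (ltW h); rewrite -/k0; lra.
have d0 : 1 <= 2 * d%:R :> R.
  by have : 1 <= d%:R :> R by [rewrite ler1n]; lra.
pose ld := ln (2 * d%:R : R); have ld0 : 0 <= ld by rewrite ln_ge0.
pose lM := ln (Num.max 1 M); have lM0 : 0 <= lM by rewrite ln_ge0// le_max lexx.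
pose lg := ln (2 / h0 + 1).
have g1 : 1 <= 2 / h0 + 1 by rewrite lerDr divr_ge0// ltW.
have lg0 : 0 <= lg by rewrite ln_ge0.
have l20 : 0 <= ln 2 :> R by rewrite ln_ge0// ler1n.
pose C2 := ln 2 + lM * (5 / 2 + 1 + k0%:R) + lg + 1.
have C20 : 0 < C2.
  rewrite ltr_wpDl// addr_ge0// addr_ge0// mulr_ge0// addr_ge0//.
exists (expR ((1 + k0%:R) * ld) * C2 * C1); first by rewrite !mulr_gt0 ?expR_gt0.
move=> n eta n2 Heta; set l := ln n%:R.
have n0 : 0 < n%:R :> R by rewrite ltr0n (leq_trans _ n2).
have l0 : 0 <= l by rewrite ln_ge0// ler1n (leq_trans _ n2).
have nE : n%:R = expR l by rewrite /l lnK.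
set y := ln (Num.max l (expR 1)); have y1 : 1 <= y := ln_max_ge1 l.
set P := pow45 l; have P1 : 1 <= P := pow45_ge1 l.
have P0 : 0 < P by rewrite (lt_le_trans _ P1).
set S := slow l; have S0 : 0 <= S := slow_ge0 l0.
have Sl : S <= l := slow_le l0.
have lS : l = S * y by rewrite /S /slow -/y divfK// gt_eqF// (lt_le_trans _ y1).
pose v := 7 / 5 * P.
have v75 : 7 / 5 <= v by rewrite /v ler_peMr.
pose k1 := (Num.trunc (5 / 2 * S)).+1; pose k := (k1 + k0)%N.
have s52 : 0 <= 5 / 2 * S by rewrite mulr_ge0// divr_ge0.
have /andP[t1 t2] := truncn_itv s52.
have k1S : 5 / 2 * S <= k1%:R by exact: ltW t2.
have kS : k%:R <= 5 / 2 * S + 1 + k0%:R by rewrite /k natrD lerD2r /k1 -natr1 lerD2r.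
pose h := h0 * expR (- (l / 2)).
have hp : 0 < h by rewrite mulr_gt0// expR_gt0.
have hE : h ^+ 2 = h0 ^+ 2 * expR (- l).
  by rewrite /h exprMn -expRM_natl; congr (_ * expR _); field.
have term1 : Cc * (expR (7 / 5 * d%:R) * h ^+ 2) = c ^+ 2 / 2 * expR (- l).
  by rewrite hE mulrA mulrA -[X in X * expR (- l)]mulrA h0E.
(* The other half of the budget: the ratio to the power k is at most exp(- 2 l - z), the compactness
   factor at most exp(l + K), and [z] collects K and the constants. *)
have term2 : Cc * ((7 / 5 / v) ^+ k * (4 * expR (v * B))) <= c ^+ 2 / 2 * expR (- l).
  have -> : 7 / 5 / v = expR (- (4 / 5 * y)).
    by rewrite /v invfM mulrA divff ?mul1r ?expRN// gt_eqF// divr_gt0.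
  rewrite -expRM_natl mulrN.
  have E1 : expR (- (k%:R * (4 / 5 * y))) <= expR (- (2 * l) - z).
    rewrite ler_expR; apply: (@le_trans _ _ (- (2 * l) - 4 / 5 * k0%:R)).
      by apply: (arith_exponent lS k1S y1); rewrite ?natrD.
    by rewrite lerD2l lerN2.
  have E2 : expR (v * B) <= expR (l + K).
    rewrite ler_expR /v; have := HK l l0; rewrite -/P -/S mul1r => HKl.
    apply: (@le_trans _ _ (S + K)); last by rewrite lerD2r.
    apply: le_trans HKl; have -> : (7 / 5 * B + 1) * P = 7 / 5 * P * B + P by ring.
    by rewrite lerDl ltW.
  have E3 : expR (- (2 * l) - z) * expR (l + K) = c ^+ 2 / (8 * Cc) * expR (- l).
    rewrite -expRD; have -> : - (2 * l) - z + (l + K) = - ln (8 * Cc / c ^+ 2) + - l.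
      by rewrite /z; ring.
    by rewrite expRD expRN lnK ?invf_div// posrE divr_gt0 ?exprn_gt0// mulr_gt0.
  have E4 : expR (- (k%:R * (4 / 5 * y))) * expR (v * B) <= c ^+ 2 / (8 * Cc) * expR (- l).
    by rewrite -E3; apply: ler_pM; rewrite ?expR_ge0.
  have -> : c ^+ 2 / 2 * expR (- l) = Cc * 4 * (c ^+ 2 / (8 * Cc) * expR (- l)).
    by field; rewrite gt_eqF.
  rewrite (_ : Cc * (_ * (4 * _)) = Cc * 4 *
    (expR (- (k%:R * (4 / 5 * y))) * expR (v * B))); last by ring.
  by rewrite ler_wpM2l// mulr_ge0// ltW.
have sn : 0 < Num.sqrt n%:R :> R by rewrite sqrtr_gt0.
have eta0 : 0 <= eta by rewrite (le_trans _ Heta)// divr_ge0 ?ltW.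
have budget : Cc * (expR (7 / 5 * d%:R) * h ^+ 2 + (7 / 5 / v) ^+ k * (4 * expR (v * B)))
    <= eta ^+ 2.
  rewrite mulrDr term1; apply: (@le_trans _ _ (c ^+ 2 * expR (- l))).
    by rewrite [leRHS](_ : _ = c ^+ 2 / 2 * expR (- l) + c ^+ 2 / 2 * expR (- l));
      [rewrite lerD2l | field].
  have -> : c ^+ 2 * expR (- l) = (c / Num.sqrt n%:R) ^+ 2.
    by rewrite expr_div_n sqr_sqrtr ?(ltW n0)// expRN -nE.
  by rewrite lerXn2r ?nnegrE// divr_ge0// ltW.
have [Q covQ] := small_covering M0 hp v75 eta0 budget.
exists (grid_size M k h ^ #|{: word d k}|)%N, Q; split=> //.
have k_gt0 : (0 < k)%N by rewrite addn_gt0.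
set W := #|{: word d k}|; have W0 : (0 < W)%N by exact: word_gt0.
set G := grid_size M k h.
have G0 : 0 < (2 * G)%:R :> R by rewrite ltr0n.
(* The added 1 is absorbed by doubling the grid size. *)
have N1 : (G ^ W)%:R + 1 <= (2 * G)%:R ^+ W :> R.
  rewrite natr1 -natrX ler_nat expnMn -[(2 ^ W)%N](@prednK _) ?expn_gt0//.
  rewrite mulSn -addn1 leq_add2l muln_gt0 expn_gt0 andbT.
  by rewrite -ltnS prednK ?expn_gt0// -[X in (X < _)%N](expn0 2) ltn_exp2l.
apply: (@le_trans _ _ (W%:R * ln (2 * G)%:R)).
  by rewrite mulr_natl -lnXn// ler_ln ?posrE ?exprn_gt0 ?ltr_wpDl.
have lnG : ln (2 * G)%:R <= C2 * (1 + l).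
  have gl : (2 * G)%:R <= expR (ln 2 + k%:R * lM + (lg + l / 2)) :> R.
    rewrite natrM; apply: (le_trans (grid_le k hp)).
    rewrite !expRD lnK ?posrE// expRM_natl lnK ?posrE ?lt_max ?ltr01//.
    rewrite ler_wpM2l ?mulr_ge0 ?exprn_ge0 ?le_max ?ler01//.
    rewrite lnK ?posrE ?(lt_le_trans ltr01 g1)//.
    have -> : 2 / h = 2 / h0 * expR (l / 2).
      by rewrite /h invfM expRN invrK mulrA.
    rewrite [leRHS]mulrDl mul1r lerD2l -[leLHS]expR0 ler_expR divr_ge0//.
  apply: (@le_trans _ _ (ln 2 + k%:R * lM + (lg + l / 2))).
    by rewrite -ler_expR lnK ?posrE.
  exact: arith_log kS Sl lM0 lg0 l20 l0 _.
have lnG0 : 0 <= ln (2 * G)%:R :> R by rewrite ln_ge0// ler1n muln_gt0.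
apply: (@le_trans _ _ ((2 * d%:R) ^+ k * (C2 * (C1 * expR S)))).
  apply: ler_pM => //; first exact: word_le.
  apply: (le_trans lnG); rewrite ler_pM2l//.
  by have := HC1 l l0; rewrite expr1.
have dk : (2 * d%:R) ^+ k <= expR ((1 + k0%:R) * ld) * expR (5 / 2 * ld * S) :> R.
  have -> : (2 * d%:R) ^+ k = expR (k%:R * ld) :> R.
    by rewrite expRM_natl lnK// posrE (lt_le_trans ltr01 d0).
  rewrite -expRD ler_expR (_ : _ + _ = (5 / 2 * S + 1 + k0%:R) * ld); last by ring.
  by rewrite ler_wpM2r.
have -> : expR ((1 + k0%:R) * ld) * C2 * C1 * expR (covering_exp * S) =
    expR ((1 + k0%:R) * ld) * expR (5 / 2 * ld * S) * (C2 * (C1 * expR S)).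
  have -> : expR (covering_exp * S) = expR (5 / 2 * ld * S) * expR S.
    by rewrite -expRD; congr expR; rewrite /covering_exp -/ld; ring.
  by ring.
by rewrite ler_wpM2r// mulr_ge0 ?(ltW C20)// mulr_ge0 ?expR_ge0 ?(ltW C10).
Qed.

End covering_number.

(** * Rates in the contamination level and the sample size *)

Section rates.
Context {R : realType}.

(** The function o_d(1): the 4 pays for the loss between L1 distance and regret, [covering_exp] for
    the covering numbers. *)
Definition rate_offset (d n : nat) : R :=
  (4 + covering_exp (R := R) d) / ln (Num.max (ln n%:R) (expR 1)).

Lemma covering_exp_ge1 d : 1 <= covering_exp (R := R) d.
Proof.
rewrite /covering_exp lerDr mulr_ge0 ?divr_ge0//.
case: d => [|d]; first by rewrite mulr0 ln0.
by rewrite ln_ge0//; have : 1 <= d.+1%:R :> R by [rewrite ler1n]; lra.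
Qed.

Lemma rate_offset_gt0 d n : 0 < rate_offset d n.
Proof.
rewrite divr_gt0 ?(lt_le_trans _ (ln_max_ge1 _))//.
by have := covering_exp_ge1 d; lra.
Qed.

Lemma rate_offset_cvg0 d : rate_offset d n @[n --> \oo] --> (0 : R).
Proof.
apply/cvgrPdist_le => e e0; pose K := 4 + covering_exp (R := R) d.
have K0 : 0 < K by have := covering_exp_ge1 d; rewrite /K; lra.
near=> n; rewrite sub0r normrN gtr0_norm ?rate_offset_gt0//.
rewrite /rate_offset -/K ler_pdivrMr ?(lt_le_trans _ (ln_max_ge1 _))//.
rewrite -ler_pdivrMl// mulrC -ler_expR expR_ln_max le_max; apply/orP; left.
have n0 : (0 < n)%N by near: n; exists 1%N.
rewrite -ler_expR (lnK (x := n%:R)) ?posrE ?ltr0n//.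
near: n; exists (Num.trunc (expR (expR (K / e)))).+1 => // n /=.
move=> h; rewrite (le_trans (ltW (truncnS_gt _)))// ler_nat//.
Unshelve. all: by end_near. Qed.

Lemma powR_rate_offset d n : (0 < n)%N ->
  (n%:R `^ (1 - rate_offset d n))^-1 =
  expR ((4 + covering_exp (R := R) d) * slow (ln n%:R)) * expR (- ln n%:R).
Proof.
move=> n0; rewrite /powR pnatr_eq0 -[(n == 0)%N]negbK -lt0n n0 /= -expRN -expRD.
by congr expR; rewrite /rate_offset /slow; ring.
Qed.

Lemma powR_eps_rate (eps delta : R) : 0 < eps -> eps <= 1 -> 0 <= delta ->
  expR (4 * slow (ln eps^-1)) * eps ^+ 2 <=
  eps `^ (2 * (1 - (2 + delta) / ln (Num.max (ln eps^-1) (expR 1)))).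
Proof.
move=> e0 e1 de0; rewrite /powR gt_eqF//.
have -> : ln eps = - ln eps^-1 by rewrite lnV ?posrE// opprK.
have l0 : 0 <= ln eps^-1 by rewrite ln_ge0// invf_ge1.
have -> : eps ^+ 2 = expR (- (2 * ln eps^-1)).
  by rewrite -mulrN expRM_natl lnV ?posrE// opprK lnK.
rewrite -expRD ler_expR; have s0 := slow_ge0 l0.
have -> : 2 * (1 - (2 + delta) / ln (Num.max (ln eps^-1) (expR 1))) * - ln eps^-1 =
    - (2 * ln eps^-1) + 2 * (2 + delta) * slow (ln eps^-1).
  by rewrite /slow; ring.
rewrite addrC lerD2l ler_wpM2r//; lra.
Qed.

Lemma covering_radius_sqr d n : (1 <= n)%N ->
  covering_radius R d n ^+ 2 = ln n%:R ^+ d * expR (- ln n%:R).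
Proof.
move=> n1; have n0 : 0 < n%:R :> R by rewrite ltr0n.
have l0 : 0 <= ln n%:R :> R by rewrite ln_ge0// ler1n.
rewrite /covering_radius expr_div_n sqr_sqrtr ?ler0n// expRN lnK//.
have -> : (ln n%:R `^ (d%:R / 2)) ^+ 2 = ln n%:R ^+ d :> R.
  by rewrite -powR_mulrn ?powR_ge0// -powRrM divfK ?powR_mulrn.
by [].
Qed.

(** For n >= 2 the logarithmic factor is bounded below, giving the form eta >= c / sqrt n of
    [covering_log]. *)
Lemma covering_radius_ge d n : (2 <= n)%N ->
  ln 2 `^ (d%:R / 2) / Num.sqrt n%:R <= covering_radius R d n.
Proof.
move=> n2; rewrite /covering_radius ler_wpM2r ?invr_ge0 ?sqrtr_ge0//.
have l2 : 0 <= ln 2 :> R by rewrite ln_ge0// ler1n.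
have n0 : 0 < n%:R :> R by rewrite ltr0n (leq_trans _ n2).
rewrite ge0_ler_powR ?divr_ge0 ?nnegrE//; first by rewrite ln_ge0// ler1n (leq_trans _ n2).
by rewrite ler_ln ?posrE// ler_nat.
Qed.

End rates.

(** * Expected regret and balance of the terms *)

Section expected_regret_bound.
Context {R : realType} (d : nat) (M : R).
Hypothesis M0 : 0 <= M.

Let sqr3 (a b c : R) : (24 * a + 8 * (b + c)) ^+ 2 <= 3 * (24 * a) ^+ 2 + 3 * (8 * b) ^+ 2 + 3 * 8 ^+ 2 * c ^+ 2.
Proof.
have := sqr_ge0 (24 * a - 8 * b); have := sqr_ge0 (24 * a - 8 * c).
by have := sqr_ge0 (b - c); lra.
Qed.

(** The L1 bound of the estimator holds for every sample with deviation sqrt(H), and H is measurable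
    with a bounded integral. The regret thus has a measurable majorant, whose integral bounds the
    upper expectation. Events are indexed by all N^2 pairs of centres. *)
Lemma expected_regret_le (A : R) (n : nat) (eps : {i01 R}) (eta t rho : R) N
    (Q : 'I_N -> probability 'rV[R]_d R) (fhat : n.-tuple 'rV[R]_d -> 'rV[R]_d -> R)
    (p Q0 : probability 'rV[R]_d R) :
  (0 < n)%N -> 0 <= A -> 0 <= rho -> 0 < t -> msupport p `<=` cube M ->
  tv_covering (mixture_class M) eta Q ->
  (forall X, exists2 q, [/\ msupport q `<=` cube M & fhat X = mix_density q] &
    forall P', mixture_class M P' ->
      dist_class (yatracos_class Q) (mix_law q) (empirical R X) <=
      dist_class (yatracos_class Q) P' (empirical R X)) ->
  (forall q, carried M q ->
    (regret p (mix_density q) rho <= (A * (rho + l1_dist p q ^+ 2))%:E)%E) ->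
  (expected_regret fhat eps rho p Q0 <=
    (A * (rho + 3 * (24 * eta) ^+ 2 + 3 * (8 * eps%:num) ^+ 2 +
      3 * 8 ^+ 2 * (t ^+ 2 + 2 * (N ^ 2)%:R * expR (- (n%:R * t ^+ 2 / 8)))))%:E)%E.
Proof.
move=> n0 A0 rho0 t0 sp covQ est reg.
pose Y (k : 'I_N * 'I_N) := yatracos_set (Q k.1) (Q k.2).
have mY k : measurable (Y k) by exact: measurable_yatracos_set.
pose P := contaminate eps (mix_law p) Q0.
have [H [mH H0 IH HH]] := empirical_process_bound P n0 mY t0.
have Cp : mixture_class M (mix_law p) by exists p.
pose b := rho + 3 * (24 * eta) ^+ 2 + 3 * (8 * eps%:num) ^+ 2.
pose c : R := 3 * 8 ^+ 2; have c0 : 0 <= c by exact: mulr_ge0 (ler0n _ _) (sqr_ge0 _).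
have b0 : 0 <= b.
  have h (x : R) : 0 <= 3 * x ^+ 2 by exact: mulr_ge0 (ler0n _ _) (sqr_ge0 _).
  exact: addr_ge0 (addr_ge0 rho0 (h _)) (h _).
pose U X := (A * (b + c * H X))%:E.
have mU : measurable_fun setT U.
  apply/measurable_EFinP; apply: measurable_funM => //; apply: measurable_funD => //.
  exact: measurable_funM.
have gU X : (regret p (fhat X) rho <= U X)%E.
  have [q [sq ->] argmin] := est X.
  apply: (le_trans (reg q (msupport_carried sq))); rewrite lee_fin ler_wpM2l//.
  rewrite /b -!addrA lerD2l !addrA /c.
  have Cq : mixture_class M (mix_law q) by exists q.
  have hs (B : set _) : yatracos_class Q B ->
      `|fine (contaminate eps (mix_law p) Q0 B) - fine (empirical R X B)| <= Num.sqrt (H X).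
    move=> [i [j [_ ->]]]; rewrite empiricalE -sqrtr_sqr ler_sqrt//.
    exact: HH X (i, j).
  have := yatracos_estimator_l1 n0 covQ Cp Cq (argmin _ Cp) (sqrtr_ge0 _) hs.
  move=> L; apply: (@le_trans _ _ ((24 * eta + 8 * (eps%:num + Num.sqrt (H X))) ^+ 2)).
    by rewrite lerXn2r ?nnegrE ?l1_dist_ge0// (le_trans (l1_dist_ge0 p q)).
  by apply: (le_trans (sqr3 _ _ _)); rewrite sqr_sqrtr.
apply: (@le_trans _ _ (\int[iid_law P n]_X U X)%E).
  by apply: ereal_inf_lbound; exists U.
have E X : U X = ((A * b)%:E + (A * c)%:E * (H X)%:E)%E.
  by rewrite /U -EFinM -EFinD; congr EFin; ring.
under eq_integral do rewrite E.
have Ab0 : (0 <= (A * b)%:E :> \bar R)%E by rewrite lee_fin mulr_ge0.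
have Ac0 : (0 <= (A * c)%:E :> \bar R)%E by rewrite lee_fin mulr_ge0.
have mHE : measurable_fun setT (EFin \o H) by exact/measurable_EFinP.
have mZ : measurable_fun setT (fun X => (A * c)%:E * (H X)%:E)%E.
  by apply: emeasurable_funM => //; exact: measurable_cst.
have pc (X : n.-tuple 'rV[R]_d) : setT X -> (0 <= cst (A * b)%:E X)%E by [].
have pZ (X : n.-tuple 'rV[R]_d) : setT X -> (0 <= (A * c)%:E * (H X)%:E)%E.
  by move=> _; rewrite mule_ge0 ?lee_fin.
rewrite (ge0_integralD (iid_law P n) measurableT pc (measurable_cst _) pZ mZ).
rewrite integral_cst//; have PT := probability_setT (iid_law P n).
have -> : ((A * b)%:E * iid_law P n setT = (A * b)%:E)%E.
  exact: (etrans (congr1 (mule (A * b)%:E) PT) (mule1 _)).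
rewrite ge0_integralZl//; last by move=> X _; rewrite lee_fin.
apply: (@le_trans _ _ ((A * b)%:E + (A * c)%:E *
    (t ^+ 2 + 2 * (N ^ 2)%:R * expR (- (n%:R * t ^+ 2 / 8)))%:E)%E).
  rewrite leeD2l// lee_wpmul2l//; move: IH; rewrite card_prod card_ord.
  by rewrite mulnn.
rewrite -EFinM -EFinD lee_fin le_eqVlt; apply/orP; left; apply/eqP; rewrite -/b -/c; ring.
Qed.

End expected_regret_bound.

Section final_rate.
Context {R : realType}.

Lemma deviation_rate (n N : nat) (a C C1 : R) : (2 <= n)%N -> 1 <= a -> 0 <= C1 ->
  ln (N%:R + 1) <= C * expR (a * slow (ln n%:R)) ->
  1 + ln n%:R <= C1 * expR (slow (ln n%:R)) ->
  exists2 t : R, 0 < t &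
    t ^+ 2 + 2 * (N ^ 2)%:R * expR (- (n%:R * t ^+ 2 / 8)) <=
    (32 * C + 16 * C1) * (expR (a * slow (ln n%:R)) * expR (- ln n%:R)).
Proof.
move=> n2 a1 C10; set S := slow _; set lam := ln (_ + 1); set l := ln n%:R => HN Hl.
have n0 : 0 < n%:R :> R by rewrite ltr0n (leq_trans _ n2).
have lgt0 : 0 < l by rewrite ln_gt0// ltr1n.
have S0 : 0 <= S := slow_ge0 (ltW lgt0).
have lam0 : 0 <= lam by rewrite ln_ge0// lerDr.
(* Chosen so that n t2 / 8 = 2 (2 lam + l): since N^2 <= exp(2 lam), the union bound term is then at
   most a constant times 1/n. *)
pose t2 := 16 * (2 * lam + l) * expR (- l).
have t20 : 0 < t2 by rewrite mulr_gt0 ?expR_gt0// mulr_gt0// ltr_wpDl// mulr_ge0.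
exists (Num.sqrt t2); rewrite ?sqrtr_gt0// sqr_sqrtr ?(ltW t20)//.
have -> : n%:R * t2 / 8 = 2 * (2 * lam + l).
  have nl : n%:R * expR (- l) = 1 by rewrite expRN lnK// divff// gt_eqF.
  rewrite /t2 (_ : _ / 8 = 2 * (2 * lam + l) * (n%:R * expR (- l))); last by field.
  by rewrite nl mulr1.
have N2 : (N ^ 2)%:R * expR (- (2 * (2 * lam + l))) <= expR (- l).
  have h : (N ^ 2)%:R <= expR (2 * lam) :> R.
    rewrite natrX expRM_natl /lam lnK ?posrE ?ltr_wpDl//.
    by rewrite lerXn2r ?nnegrE ?addr_ge0// lerDl.
  apply: (@le_trans _ _ (expR (2 * lam) * expR (- (2 * (2 * lam + l))))).
    by rewrite ler_wpM2r ?expR_ge0.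
  rewrite -expRD ler_expR; lra.
have e1 : expR S <= expR (a * S) by rewrite ler_expR ler_peMl.
have Hl2 : 1 + l <= C1 * expR (a * S) by rewrite (le_trans Hl)// ler_wpM2l.
have key : 32 * lam + 16 * l + 2 <= (32 * C + 16 * C1) * expR (a * S).
  move: HN Hl2; move: (expR (a * S)) => Ea; lra.
apply: (@le_trans _ _ ((32 * lam + 16 * l + 2) * expR (- l))).
  by rewrite /t2 -[2 * _ * _]mulrA; lra.
by rewrite [leRHS]mulrA ler_wpM2r ?expR_ge0.
Qed.

Lemma covering_radius_rate (d n : nat) (a c2 eta C : R) : (2 <= n)%N -> 1 <= a ->
  0 <= eta -> 0 <= C -> eta <= c2 * covering_radius R d n ->
  (1 + ln n%:R) ^+ d <= C * expR (slow (ln n%:R)) ->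
  eta ^+ 2 <= c2 ^+ 2 * C * (expR (a * slow (ln n%:R)) * expR (- ln n%:R)).
Proof.
move=> n2 a1 eta0 C0 etac Hd; have n1 : (1 <= n)%N by rewrite (leq_trans _ n2).
have l0 : 0 <= ln n%:R :> R by rewrite ln_ge0// ler1n.
have S0 := slow_ge0 l0.
apply: (@le_trans _ _ ((c2 * covering_radius R d n) ^+ 2)).
  by rewrite lerXn2r ?nnegrE// (le_trans eta0).
rewrite exprMn covering_radius_sqr// -mulrA ler_wpM2l ?sqr_ge0// [leRHS]mulrA.
rewrite ler_wpM2r ?expR_ge0//; apply: (@le_trans _ _ ((1 + ln n%:R) ^+ d)).
  by rewrite lerXn2r ?nnegrE ?addr_ge0// lerDr.
by rewrite (le_trans Hd)// ler_wpM2l// ler_expR ler_peMl.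
Qed.

(** [E4] is the regret loss, [e2] the squared contamination and [X] the statistical error. The loss
    is charged separately to each, giving the two terms [T1] and [Z] of the rate. *)
Lemma total_rate (Cr E4 e2 x3 x4 rho X u T1 Z K3 K4 c : R) :
  0 <= Cr -> 0 <= E4 -> 0 <= c -> 0 <= K3 -> 0 <= K4 -> 0 <= T1 -> 0 <= Z ->
  rho <= e2 + u -> u <= X -> x3 <= K3 * X -> x4 <= K4 * X ->
  E4 * e2 <= T1 -> E4 * X <= Z ->
  Cr * E4 * (rho + x3 + c * e2 + c * x4) <= Cr * (2 + c + K3 + c * K4) * (T1 + Z).
Proof.
move=> Cr0 E0 c0 K30 K40 T0 Z0 hrho hu h3 h4 hT hZ.
rewrite -!mulrA ler_wpM2l//.
have cx4 : c * x4 <= c * K4 * X by rewrite -mulrA ler_wpM2l.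
apply: (@le_trans _ _ (E4 * ((1 + c) * e2 + (1 + K3 + c * K4) * X))).
  by rewrite ler_wpM2l//; lra.
rewrite mulrDr (mulrCA E4) (mulrCA E4).
have k0 : 0 <= 1 + K3 + c * K4 by rewrite !addr_ge0// mulr_ge0.
have c1 : 0 <= 1 + c by rewrite addr_ge0.
have := ler_wpM2l c1 hT; have := ler_wpM2l k0 hZ.
have : 0 <= (1 + c) * Z by rewrite mulr_ge0.
have : 0 <= (1 + K3 + c * K4) * T1 by rewrite mulr_ge0.
by move: (E4 * e2) (E4 * X) (c * K4) => y1 y2 y3; lra.
Qed.

(** The two error levels combined; [n.+1] keeps the value positive for all arguments, including n =
    0. *)
Definition threshold (eps : R) (n : nat) : R := Num.max (eps ^+ 2) n.+1%:R^-1.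

Lemma threshold_gt0 eps n : 0 < threshold eps n.
Proof. by rewrite lt_max invr_gt0 ltr0n orbT. Qed.

Lemma threshold_le1 eps n : 0 <= eps -> eps <= 1 -> threshold eps n <= 1.
Proof.
by move=> e0 e1; rewrite ge_max expr_le1// e1 invf_le1 ?ltr0n// ler1n.
Qed.

Lemma threshold_le eps n : (2 <= n)%N ->
  threshold eps n <= eps ^+ 2 + expR (- ln n%:R).
Proof.
move=> n2; have n0 : 0 < n%:R :> R by rewrite ltr0n (leq_trans _ n2).
have nn : n.+1%:R^-1 <= expR (- ln n%:R) :> R.
  by rewrite expRN lnK// lef_pV2 ?posrE ?ltr0Sn// ler_nat.
rewrite ge_max lerDl expR_ge0/= (le_trans nn)// lerDr sqr_ge0//.
Qed.

(** Since n + 1 <= n^2 for n >= 2. With the analogous bound by ln eps^-1, the loss on eps^2 depends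
    on eps alone and the loss on 1/n on n alone. *)
Lemma half_ln_threshold_le eps n : (2 <= n)%N ->
  2^-1 * ln (threshold eps n)^-1 <= ln n%:R.
Proof.
move=> n2; have n0 : 0 < n%:R :> R by rewrite ltr0n (leq_trans _ n2).
have : ln (threshold eps n)^-1 <= ln (n%:R ^+ 2).
  rewrite ler_ln ?posrE ?invr_gt0 ?threshold_gt0 ?exprn_gt0//.
  apply: (@le_trans _ _ n.+1%:R).
    rewrite invf_ple ?posrE ?threshold_gt0 ?ltr0n//.
    by rewrite le_max lexx orbT.
  rewrite -natrX ler_nat -addn1 -mulnn (leq_trans (n := n + n))//.
    by rewrite leq_add2l (leq_trans _ n2).
  by rewrite addnn -muln2 leq_mul2l n2 orbT.
by rewrite lnXn// -mulr_natl; lra.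
Qed.

Lemma half_ln_threshold_le_eps eps n : 0 < eps ->
  2^-1 * ln (threshold eps n)^-1 <= ln eps^-1.
Proof.
move=> e0; have : ln (threshold eps n)^-1 <= ln (eps^-1 ^+ 2).
  rewrite ler_ln ?posrE ?invr_gt0 ?threshold_gt0 ?exprn_gt0 ?invr_gt0//.
  by rewrite exprVn lef_pV2 ?posrE ?threshold_gt0 ?exprn_gt0// le_max lexx.
by rewrite lnXn ?invr_gt0// -mulr_natl; lra.
Qed.

Lemma half_ln_threshold_ge0 eps n : 0 <= eps -> eps <= 1 ->
  0 <= 2^-1 * ln (threshold eps n)^-1.
Proof.
move=> e0 e1; rewrite mulr_ge0 ?invr_ge0// ln_ge0// invf_ge1 ?threshold_gt0//.
exact: threshold_le1.
Qed.

End final_rate.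

Unset Implicit Arguments.

Theorem theorem4p7 (R : realType) :
  exists o : nat -> nat -> R,
    [/\ forall d n, 0 < o d n,
        forall d, o d n @[n --> \oo] --> (0 : R) &
        forall (d : nat) (M delta c1 c2 : R), (1 <= d)%N ->
          0 < M -> 0 < delta -> 0 < c1 -> 0 < c2 ->
        exists2 C : R, 0 < C &
        exists2 rho : R -> nat -> R, (forall eps n, 0 < rho eps n) &
        forall (n : nat) (eps : {i01 R}) (eta : R)
            (fhat : n.-tuple 'rV[R]_d -> 'rV[R]_d -> R),
          (2 <= n)%N -> eps%:num < 1 ->
          c1 * covering_radius R d n <= eta <= c2 * covering_radius R d n ->
          is_yatracos_estimator M eta fhat ->
          (worst_regret M fhat eps (rho eps%:num n) <=
            (C * regret_rate delta (o d n) eps%:num n)%:E)%E].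
Proof.
exists rate_offset; split; [exact: rate_offset_gt0|exact: rate_offset_cvg0|].
move=> d M delta c1 c2 d1 M0 delta0 c10 c20.
have Mge0 : 0 <= M := ltW M0.
have [Cr Cr0 HCr] := @regret_slow R d M Mge0.
have c0 : 0 < c1 * ln 2 `^ (d%:R / 2).
  by rewrite mulr_gt0// powR_gt0// ln_gt0// ltr1n.
have [Cc Cc0 HCc] := covering_log d1 Mge0 c0.
have [C1 C10 HC1] := @poly_slow R 1; have [Cd Cd0 HCd] := @poly_slow R d.
pose K3 : R := 3 * 24 ^+ 2 * (c2 ^+ 2 * Cd); pose K4 := 32 * Cc + 16 * C1.
pose c : R := 3 * 8 ^+ 2.
have c_ge0 : 0 <= c by exact: mulr_ge0 (ler0n _ _) (sqr_ge0 _).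
have K30 : 0 <= K3.
  apply: mulr_ge0; first exact: mulr_ge0 (ler0n _ _) (sqr_ge0 _).
  exact: mulr_ge0 (sqr_ge0 _) (ltW Cd0).
have K40 : 0 <= K4 by apply: addr_ge0; apply: mulr_ge0 => //; exact: ltW.
exists (Cr * (2 + c + K3 + c * K4)).
  apply: mulr_gt0 => //; apply: ltr_wpDr; first exact: mulr_ge0.
  by apply: ltr_wpDr => //; apply: ltr_wpDr.
exists threshold => [eps n|n eps eta fhat n2 eps1 /andP[eta1 eta2]]; first exact: threshold_gt0.
move=> [N [Q [[covQ minQ] est]]].
have n0 : (0 < n)%N by rewrite (leq_trans _ n2).
set l := ln (n%:R : R); have l0 : 0 <= l by rewrite ln_ge0// ler1n.
set a := covering_exp (R := R) d; have a1 : 1 <= a := covering_exp_ge1 d.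
have eta_ge : c1 * ln 2 `^ (d%:R / 2) / Num.sqrt n%:R <= eta.
  by apply: le_trans eta1; rewrite -mulrA ler_wpM2l ?covering_radius_ge// ltW.
have eta0 : 0 <= eta.
  by apply: le_trans eta_ge; rewrite divr_ge0 ?sqrtr_ge0// ltW.
(* Minimality transfers the size of the explicit covering to the one used by the estimator. *)
have [N' [Q' [covQ' HN']]] := HCc n eta n2 eta_ge.
have HN : ln (N%:R + 1) <= Cc * expR (a * slow l).
  apply: le_trans HN'; rewrite ler_ln ?posrE ?ltr_wpDl//.
  by rewrite lerD2r ler_nat; exact: minQ covQ'.
have H1 := HC1 l l0; rewrite expr1 in H1.
have [t t0 Ht] := deviation_rate n2 a1 (ltW C10) HN H1.
have Heta := covering_radius_rate n2 a1 eta0 (ltW Cd0) eta2 (HCd l l0).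
have e0 : 0 <= eps%:num by [].
have rho0 := threshold_gt0 eps%:num n.
set rho := threshold eps%:num n in rho0 *.
set L := 2^-1 * ln rho^-1.
have L0 : 0 <= L := half_ln_threshold_ge0 n e0 (ltW eps1).
have A0 : 0 <= Cr * expR (4 * slow L) by rewrite mulr_ge0 ?expR_ge0 ?(ltW Cr0).
apply: ge_ereal_sup => _ [p [Q0 [sp ->]]].
have reg q : carried M q -> (regret p (mix_density q) rho <=
    (Cr * expR (4 * slow L) * (rho + l1_dist p q ^+ 2))%:E)%E.
  move=> cq; apply: HCr => //; first exact: msupport_carried.
  exact: threshold_le1 e0 (ltW eps1).
apply: (le_trans (expected_regret_le eps Q0 n0 A0 (ltW rho0) t0 sp covQ est reg)).
rewrite lee_fin /regret_rate powR_rate_offset//.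
have -> : 3 * (8 * eps%:num) ^+ 2 = c * eps%:num ^+ 2 by rewrite exprMn mulrA.
apply: (total_rate (u := expR (- l)) (X := expR (a * slow l) * expR (- l))) => //.
- exact: ltW.
- by case: ifP => // _; exact: powR_ge0.
- exact: threshold_le.
- rewrite ler_peMl ?expR_ge0// -[leLHS]expR0 ler_expR mulr_ge0 ?slow_ge0//.
  exact: le_trans ler01 a1.
- have -> : 3 * (24 * eta) ^+ 2 = 3 * 24 ^+ 2 * eta ^+ 2 by rewrite exprMn mulrA.
  rewrite /K3 -[leRHS]mulrA; apply: ler_wpM2l Heta.
  exact: mulr_ge0 (ler0n _ _) (sqr_ge0 _).
(* At eps = 0 the loss multiplies 0, in agreement with the convention for the first term of the
   rate. *)
- case: eqP => [->|/eqP ne0]; first by rewrite expr0n mulr0.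
  have ep : 0 < eps%:num by rewrite lt_neqAle eq_sym ne0.
  apply: le_trans (powR_eps_rate ep (ltW eps1) (ltW delta0)).
  rewrite ler_wpM2r ?sqr_ge0// ler_expR ler_wpM2l//.
  by apply: slow_mono => //; exact: half_ln_threshold_le_eps.
(* Both exponents are now multiples of [slow (ln n)], and they add up to the numerator of
   [rate_offset]. *)
- rewrite mulrA ler_wpM2r ?expR_ge0// -expRD ler_expR [leRHS]mulrDl lerD2r ler_wpM2l//.
  by apply: slow_mono => //; exact: half_ln_threshold_le.
Qed.
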